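(* For $0<\lambda<1$, each zero $\rho$ of the Riemann zeta function on the critical line $\mathrm{Re}(\rho)=\frac12$ with multiplicity $m_\rho$, and each integer $0\leq k<m_\rho$, let $X^\lambda_{\rho,k}:=\left(\log\frac1\lambda\right)^{-\frac12-k}Y^\lambda_{\rho,k}$. Then for such zeros and indices: $$\lim_{\lambda\to0}(X^\lambda_{\rho_1,k},X^\lambda_{\rho_2,l})=0\quad(\rho_1\neq\rho_2),\qquad \lim_{\lambda\to0}(X^\lambda_{\rho,k},X^\lambda_{\rho,l})=\frac{1}{k+l+1}.$$
   Context: $K=L^2(]0,\infty[,dt)$ over $\mathbb{C}$ with scalar product $(f,g)=\int_0^\infty f\overline g\,dt$. The Mellin transform $\widehat f(s)=\int_0^\infty f(t)t^{s-1}dt$ is an isometry from $K$ onto $L^2(\{s=\frac12+i\tau\},\frac{d\tau}{2\pi})$. $V$ is the unitary operator on $K$ acting in Mellin variables as multiplication by $V(s)=\left(\frac{s}{1-s}\right)^3\frac{\zeta(1-s)}{\zeta(s)}$ on $\mathrm{Re}(s)=\frac12$. $Q_\lambda$ is orthogonal projection of $K$ onto $L^2([\lambda,\infty[,dt)$. With $\chi$ the indicator of $]0,1]$, $\psi_{w,k}(t)=(\log(1/t))^k t^{-w}\chi(t)$ for $\mathrm{Re}(w)<\frac12$. For $\mathrm{Re}(s)=\frac12$, $Y^\lambda_{s,k}$ denotes the $L^2$-limit (which exists) of $V^{-1}Q_\lambda V(\psi_{w,k})$ as $w\to s$ with $\mathrm{Re}(w)<\frac12$. *)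

(* Defs.v *)
From HB Require Import structures.
From mathcomp Require Import all_boot all_order all_algebra.
From mathcomp Require Import all_classical all_reals all_analysis.
From mathcomp Require Import complex.

Set Implicit Arguments.
Unset Strict Implicit.
Unset Printing Implicit Defensive.

Import Order.TTheory GRing.Theory Num.Theory.
Import numFieldNormedType.Exports.

Local Open Scope classical_set_scope.
Local Open Scope ring_scope.

(* Typing the complex numbers as a numFieldType is what gives them their
   canonical topology: R[i] itself carries no topological instance. *)
Definition Cplx (R : realType) : numFieldType := R[i].

Definition cRe (R : realType) (z : Cplx R) : R := @complex.Re R z.
Definition cIm (R : realType) (z : Cplx R) : R := @complex.Im R z.
Definition toC (R : realType) (x : R) : Cplx R := real_complex R x.
Definition cconj (R : realType) (z : Cplx R) : Cplx R := @conjc R z.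
Definition cmod (R : realType) (z : Cplx R) : R :=
  @ComplexField.Normc.normc R z.

(* t^s = exp (s log t); only meaningful for t > 0. *)
Definition cpow (R : realType) (t : R) (s : Cplx R) : Cplx R :=
  toC (expR (cRe s * ln t)) *
  (Complex (cos (cIm s * ln t)) (sin (cIm s * ln t)) : Cplx R).

Definition cintegral (R : realType) (D : set R) (f : R -> Cplx R) : Cplx R :=
  Complex (Rintegral lebesgue_measure D (fun t => cRe (f t)))
          (Rintegral lebesgue_measure D (fun t => cIm (f t))).

Definition sqnorm (R : realType) (D : set R) (f : R -> Cplx R) : \bar R :=
  (\int[lebesgue_measure]_(t in D) (cmod (f t) ^+ 2)%:E)%E.

Definition square_integrable (R : realType) (D : set R) (f : R -> Cplx R) :=
  [/\ measurable_fun D (fun t => cRe (f t)),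
      measurable_fun D (fun t => cIm (f t)) &
      (sqnorm D f < +oo)%E].

(* The elements of K are represented by functions on R whose values outside
   ]0, +oo[ are irrelevant; equality in K is [Keq]. *)
Definition halfline (R : realType) : set R := `]0, +oo[.
Arguments halfline : clear implicits.

Definition inK (R : realType) (f : R -> Cplx R) : Prop :=
  square_integrable (halfline R) f.

Definition Keq (R : realType) (f g : R -> Cplx R) : Prop :=
  {ae lebesgue_measure, forall t : R, halfline R t -> f t = g t}.

Definition Kdot (R : realType) (f g : R -> Cplx R) : Cplx R :=
  cintegral (halfline R) (fun t => f t * cconj (g t)).

(* Operators on K act on representatives, hence the laws hold up to [Keq].
   [Tinv] is a representative of the inverse operator. *)
Record unitary_on_K (R : realType)
    (T Tinv : (R -> Cplx R) -> (R -> Cplx R)) : Prop := UnitaryOnK {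
  unitary_in : forall f, inK f -> inK (T f) ;
  unitary_eq : forall f g, inK f -> inK g -> Keq f g -> Keq (T f) (T g) ;
  unitary_linear : forall (a : Cplx R) f g, inK f -> inK g ->
    Keq (T (fun t => a * f t + g t)) (fun t => a * T f t + T g t) ;
  unitary_dot : forall f g, inK f -> inK g -> Kdot (T f) (T g) = Kdot f g ;
  unitary_inv_in : forall f, inK f -> inK (Tinv f) ;
  unitary_invr : forall f, inK f -> Keq (T (Tinv f)) f ;
  unitary_invl : forall f, inK f -> Keq (Tinv (T f)) f
}.

Definition critical (R : realType) (tau : R) : Cplx R := Complex 2^-1 tau.

Definition mellin_trunc (R : realType) (f : R -> Cplx R) (n : nat)
    (s : Cplx R) : Cplx R :=
  cintegral `[n.+1%:R^-1, n.+1%:R] (fun t => f t * cpow t (s - 1)).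

(* The Mellin integral of a general f in K does not converge absolutely; it is
   the limit of the integrals over [1/n, n], for the norm of L^2 of the
   critical line with d tau / (2 pi).  Only the values of F on the critical
   line matter, and these only up to a null set. *)
Definition is_mellin (R : realType) (f : R -> Cplx R) (F : Cplx R -> Cplx R) :=
  square_integrable setT (fun tau : R => F (critical tau)) /\
  ((2 * pi)^-1%:E * sqnorm setT (fun tau : R =>
     (mellin_trunc f n (critical tau) - F (critical tau))%R))%E
    @[n --> \oo] --> (0 : \bar R).

Definition mellin_multiplier (R : realType) (m : Cplx R -> Cplx R)
    (T : (R -> Cplx R) -> (R -> Cplx R)) : Prop :=
  forall f F, inK f -> is_mellin f F ->
    is_mellin (T f) (fun s => m s * F s).

Definition analytic_at (R : realType) (f : Cplx R -> Cplx R) (c : Cplx R) :=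
  exists a : nat -> Cplx R,
    \forall z \near c, series (fun n => a n * (z - c) ^+ n) @ \oo --> f z.

(* The value at the pole 1 is left unspecified. *)
Definition is_riemann_zeta (R : realType) (zeta : Cplx R -> Cplx R) : Prop :=
  (forall s, s != 1 -> analytic_at zeta s) /\
  (forall s, 1 < cRe s ->
    series (fun n : nat => cpow (n.+1%:R : R) (- s)) @ \oo --> zeta s).

Definition zero_of_multiplicity (R : realType) (f : Cplx R -> Cplx R)
    (rho : Cplx R) (m : nat) : Prop :=
  f rho = 0 /\
  exists g : Cplx R -> Cplx R,
    [/\ analytic_at g rho, g rho != 0 &
        \forall s \near rho, f s = (s - rho) ^+ m * g s].

Definition critical_zero (R : realType) (zeta : Cplx R -> Cplx R)
    (rho : Cplx R) (m : nat) : Prop :=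
  cRe rho = 2^-1 /\ zero_of_multiplicity zeta rho m.

(* At the zeros of zeta on the critical line, a null set, the division gives
   0; this does not affect the multiplication operator. *)
Definition Vmul (R : realType) (zeta : Cplx R -> Cplx R) (s : Cplx R) : Cplx R :=
  (s / (1 - s)) ^+ 3 * (zeta (1 - s) / zeta s).

Definition Qproj (R : realType) (lambda : R) (f : R -> Cplx R) : R -> Cplx R :=
  fun t => if lambda <= t then f t else 0.

Definition psi (R : realType) (w : Cplx R) (k : nat) : R -> Cplx R :=
  fun t => if (0 < t) && (t <= 1)
           then toC (ln t^-1 ^+ k) * cpow t (- w) else 0.

Definition is_Y (R : realType) (V Vinv : (R -> Cplx R) -> (R -> Cplx R))
    (lambda : R) (s : Cplx R) (k : nat) (Y : R -> Cplx R) : Prop :=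
  inK Y /\
  sqnorm (halfline R)
      (fun t => Vinv (Qproj lambda (V (psi w k))) t - Y t)
    @[w --> within [set w : Cplx R | cRe w < 2^-1] (nbhs s)] --> (0 : \bar R).

Definition Xvec (R : realType) (Y : R -> Cplx R -> nat -> (R -> Cplx R))
    (lambda : R) (rho : Cplx R) (k : nat) : R -> Cplx R :=
  fun t => toC (ln lambda^-1 `^ (- 2^-1 - k%:R)) * Y lambda rho k t.

(* Main.v *)
Require Import Defs.
From mathcomp Require Import all_boot all_order all_algebra.
From mathcomp Require Import all_classical all_reals all_analysis.
From mathcomp Require Import measurable_realfun complex ring lra.

(* On the critical line the Mellin transform of [psi w k] is k!/(s-w)^(k+1).
   Take w = rho - e with e > 0. Near rho the multiplier is smooth along the line,
   so up to an error bounded in L^2 uniformly in e, V(s) k!/(s-w)^(k+1) is a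
   combination of the j!/(s-w)^(j+1), j <= k, the coefficient for j = k being close
   to c = V(rho), |c| = 1. Hence V psi_{w,k} is c psi_{w,k}, plus multiples of the
   psi_{w,j} with j < k, plus a bounded vector. After truncation to [lambda, oo[ the
   squared norm of psi_{w,j} is at most L^(2j+1), L = log(1/lambda), so that
   V Y_{rho,k} differs from c Q_lambda psi_{rho,k} by O(L^k) in norm. As V is unitary,
   the scalar products reduce to L^(-k-l-1) int_lambda^1 log(1/t)^(k+l) t^(z-1) dt with
   z = i (Im rho2 - Im rho1).

   Neither the functional equation of zeta nor the full Plancherel theorem is needed.
   Continuing zeta(conj s) = conj(zeta s) from Re s > 1 gives |V(s)| = 1, and
   V(s) = (s/(1-s))^3 conj(zeta s)/zeta s is smooth along the line after cancelling
   the zero of zeta. On the Mellin side one only needs 2 pi |f|^2 >= |Mf|^2 for all f,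
   with equality for the psi_{w,k}: the defect 2 pi |f|^2 - |Mf|^2 satisfies the
   parallelogram identity and is nonnegative, hence
   defect(f - g) <= 2 (defect f + defect g). *)

Set Implicit Arguments.
Unset Strict Implicit.
Unset Printing Implicit Defensive.

Import Order.TTheory GRing.Theory Num.Theory.
Import numFieldNormedType.Exports.
Local Open Scope classical_set_scope.
Local Open Scope ring_scope.

(** * Complex numbers *)

Section ComplexNumbers.
Variable R : realType.
Local Notation C := (Cplx R).
Implicit Types (x y : R) (z w : C).

(** The hypothesis on V leads from a transform of f to a transform of V f; no vector of K is built
    from a prescribed transform. A bound on the line is carried back to K for one vector only, r = V
    psi - phi, with phi the combination of the psi_{w,j}, and this requires control of the defect of
    V psi. As V is unitary, that defect is at most |M psi|^2 - |V M psi|^2. Since [Vmul] is 0 at the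
    zeros of zeta, |V| = 1 is used only in a punctured neighbourhood of rho; on the rest of the line
    |M psi|^2 is bounded, uniformly in e, by a multiple of a Poisson kernel.

    The exact constant 2 pi in Bessel's inequality is essential: |psi_{w,k}|^2 grows like e^(-2k-1),
    and any larger constant would leave defects of that size.

    The orders then decide: the squared error O(L^(2k)) is one power of L below the squared norm of
    the main term, so the normalised vectors differ from explicit ones by O(1/L) in squared norm. *)

Definition imaginary_unit : C := Complex 0 1.

Lemma complex_ext z w : cRe z = cRe w -> cIm z = cIm w -> z = w.
Proof. by case: z w => [a b] [c d]; rewrite /cRe /cIm /= => -> ->. Qed.

Lemma cReD z w : cRe (z + w) = cRe z + cRe w. Proof. by case: z w => [a b] []. Qed.
Lemma cImD z w : cIm (z + w) = cIm z + cIm w. Proof. by case: z w => [a b] []. Qed.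
Lemma cReN z : cRe (- z) = - cRe z. Proof. by case: z. Qed.
Lemma cImN z : cIm (- z) = - cIm z. Proof. by case: z. Qed.
Lemma cReB z w : cRe (z - w) = cRe z - cRe w. Proof. by rewrite cReD cReN. Qed.
Lemma cImB z w : cIm (z - w) = cIm z - cIm w. Proof. by rewrite cImD cImN. Qed.
Lemma cReM z w : cRe (z * w) = cRe z * cRe w - cIm z * cIm w.
Proof. by case: z w => [a b] []. Qed.
Lemma cImM z w : cIm (z * w) = cRe z * cIm w + cIm z * cRe w.
Proof. by case: z w => [a b] [c d]; rewrite /cIm /cRe /=; ring. Qed.
Lemma cRe0 : cRe (0 : C) = 0. Proof. by []. Qed.
Lemma cIm0 : cIm (0 : C) = 0. Proof. by []. Qed.
Lemma cRe1 : cRe (1 : C) = 1. Proof. by []. Qed.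
Lemma cIm1 : cIm (1 : C) = 0. Proof. by []. Qed.
Lemma cRe_toC x : cRe (toC x) = x. Proof. by []. Qed.
Lemma cIm_toC x : cIm (toC x) = 0. Proof. by []. Qed.
Lemma cRe_conj z : cRe (cconj z) = cRe z. Proof. by case: z. Qed.
Lemma cIm_conj z : cIm (cconj z) = - cIm z. Proof. by case: z. Qed.

Definition cReE := (cReD, cReN, cReM, cRe0, cRe1, cRe_toC, cRe_conj).
Definition cImE := (cImD, cImN, cImM, cIm0, cIm1, cIm_toC, cIm_conj).

Lemma toCD x y : toC (x + y) = toC x + toC y.
Proof. by apply: complex_ext; rewrite ?cReE ?cImE //=; ring. Qed.
Lemma toCN x : toC (- x) = - toC x.
Proof. by apply: complex_ext; rewrite ?cReE ?cImE //=; ring. Qed.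
Lemma toCB x y : toC (x - y) = toC x - toC y. Proof. by rewrite toCD toCN. Qed.
Lemma toCM x y : toC (x * y) = toC x * toC y.
Proof. by apply: complex_ext; rewrite !(cReE, cImE) //=; ring. Qed.
Lemma toC0 : toC (0 : R) = 0. Proof. by []. Qed.
Lemma toC1 : toC (1 : R) = 1. Proof. by []. Qed.
Lemma toC_nat n : toC (n%:R : R) = n%:R.
Proof. by elim: n => [//|n ih]; rewrite -addn1 !natrD toCD ih. Qed.
Lemma toCX x n : toC (x ^+ n) = toC x ^+ n.
Proof. by elim: n => [//|n ih]; rewrite !exprS toCM ih. Qed.
Lemma toC_inj : injective (@toC R). Proof. by move=> x y []. Qed.
Lemma toCV x : toC x^-1 = (toC x)^-1.
Proof.
have [->|x0] := eqVneq x 0; first by rewrite toC0 !invr0.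
have tx0 : toC x != 0 by apply: contraNneq x0 => /toC_inj ->.
by apply: (mulfI tx0); rewrite -toCM !divff.
Qed.

Lemma conjcD z w : cconj (z + w) = cconj z + cconj w.
Proof. by apply: complex_ext; rewrite !(cReE, cImE) //; ring. Qed.
Lemma conjcN z : cconj (- z) = - cconj z.
Proof. by apply: complex_ext; rewrite !(cReE, cImE) //; ring. Qed.
Lemma conjcB z w : cconj (z - w) = cconj z - cconj w.
Proof. by rewrite conjcD conjcN. Qed.
Lemma conjcM z w : cconj (z * w) = cconj z * cconj w.
Proof. by apply: complex_ext; rewrite !(cReE, cImE) //; ring. Qed.
Lemma cconjK z : cconj (cconj z) = z.
Proof. by apply: complex_ext; rewrite !(cReE, cImE) //; ring. Qed.
Lemma cconj_toC x : cconj (toC x) = toC x.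
Proof. by apply: complex_ext; rewrite !(cReE, cImE) //; ring. Qed.
Lemma cconj0 : cconj (0 : C) = 0. Proof. exact: (cconj_toC 0). Qed.
Lemma cconj1 : cconj (1 : C) = 1. Proof. exact: (cconj_toC 1). Qed.
Lemma cconjX z n : cconj (z ^+ n) = cconj z ^+ n.
Proof. by elim: n => [|n ih]; rewrite ?cconj1 // !exprS conjcM ih. Qed.
Lemma cconj_sum I (r : seq I) (P : pred I) (F : I -> C) :
  cconj (\sum_(i <- r | P i) F i) = \sum_(i <- r | P i) cconj (F i).
Proof. by apply: (big_morph (@cconj R)); [exact: conjcD|exact: cconj0]. Qed.

Lemma sqr_cmod z : cmod z ^+ 2 = cRe z ^+ 2 + cIm z ^+ 2.
Proof. by case: z => a b; rewrite /cmod /= sqr_sqrtr // addr_ge0 // sqr_ge0. Qed.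
Lemma cmod_ge0 z : 0 <= cmod z.
Proof. by case: z => a b; rewrite /cmod /= sqrtr_ge0. Qed.
Lemma norm_cmod z : `|z| = toC (cmod z).
Proof. by case: z. Qed.
Lemma cmod0 : cmod (0 : C) = 0. Proof. exact: ComplexField.Normc.normc0. Qed.
Lemma cmod1 : cmod (1 : C) = 1. Proof. exact: ComplexField.Normc.normc1. Qed.
Lemma cmodM z w : cmod (z * w) = cmod z * cmod w.
Proof. exact: ComplexField.Normc.normcM. Qed.
Lemma cmodV z : cmod z^-1 = (cmod z)^-1.
Proof. exact: ComplexField.Normc.normcV. Qed.
Lemma cmodX z n : cmod (z ^+ n) = cmod z ^+ n.
Proof. by elim: n => [|n ih]; rewrite ?cmod1 // !exprS cmodM ih. Qed.
Lemma ler_cmodD z w : cmod (z + w) <= cmod z + cmod w.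
Proof. exact: le_normcD. Qed.
Lemma cmodN z : cmod (- z) = cmod z.
Proof. exact: normcN. Qed.
Lemma ler_cmodB z w : cmod (z - w) <= cmod z + cmod w.
Proof. by rewrite -(cmodN w) ler_cmodD. Qed.
Lemma cmod_distC z w : cmod (z - w) = cmod (w - z).
Proof. by rewrite -cmodN opprB. Qed.
Lemma cmod_eq0 z : (cmod z == 0) = (z == 0).
Proof.
by apply/eqP/eqP => [/ComplexField.Normc.eq0_normc //|->]; exact: cmod0.
Qed.
Lemma cmod_gt0 z : (0 < cmod z) = (z != 0).
Proof. by rewrite lt_def cmod_ge0 andbT cmod_eq0. Qed.
Lemma cmod_toC x : cmod (toC x) = `|x|.
Proof. by rewrite /cmod /= expr0n addr0 sqrtr_sqr. Qed.
Lemma cmod_nat n : cmod (n%:R : C) = n%:R.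
Proof. by rewrite -toC_nat cmod_toC ger0_norm. Qed.
Lemma cmod_conj z : cmod (cconj z) = cmod z.
Proof.
by apply: (@pexpIrn _ 2) => //; rewrite ?nnegrE ?cmod_ge0 // !sqr_cmod
  cRe_conj cIm_conj sqrrN.
Qed.
Lemma ler_cmod_sum I (r : seq I) (P : pred I) (F : I -> C) :
  cmod (\sum_(i <- r | P i) F i) <= \sum_(i <- r | P i) cmod (F i).
Proof.
elim/big_ind2 : _ => [|x a y b xa yb|//]; first by rewrite cmod0.
exact: (le_trans (ler_cmodD _ _) (lerD _ _)).
Qed.
Lemma normr_cRe z : `|cRe z| <= cmod z.
Proof.
rewrite -(@ler_pXn2r _ 2) ?nnegrE ?cmod_ge0 // sqr_cmod real_normK ?num_real //.
by rewrite lerDl sqr_ge0.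
Qed.
Lemma normr_cIm z : `|cIm z| <= cmod z.
Proof.
rewrite -(@ler_pXn2r _ 2) ?nnegrE ?cmod_ge0 // sqr_cmod real_normK ?num_real //.
by rewrite lerDr sqr_ge0.
Qed.
Lemma cmod_le_ReIm z : cmod z <= `|cRe z| + `|cIm z|.
Proof.
rewrite -(@ler_pXn2r _ 2) ?nnegrE ?cmod_ge0 ?addr_ge0 // sqr_cmod sqrrD.
by rewrite !real_normK ?num_real // -addrA lerD2l lerDr mulrn_wge0.
Qed.
Lemma mulr_cconj z : z * cconj z = toC (cmod z ^+ 2).
Proof. by apply: complex_ext; rewrite ?sqr_cmod !(cReE, cImE); ring. Qed.

Lemma sqr_cmod_parallelogram z w :
  cmod (z + w) ^+ 2 + cmod (z - w) ^+ 2 = 2 * (cmod z ^+ 2 + cmod w ^+ 2).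
Proof. by rewrite !sqr_cmod !(cReE, cImE); ring. Qed.

Lemma sqr_cmodD_le z w : cmod (z + w) ^+ 2 <= 2 * (cmod z ^+ 2 + cmod w ^+ 2).
Proof. by rewrite -sqr_cmod_parallelogram lerDl sqr_ge0. Qed.

(** The order of [Cplx R] compares only numbers with equal imaginary parts, so a positive complex
    radius is a positive real and the quantifier can range over R. *)
Lemma cvg_cmodP (T : Type) (F : set_system T) (FF : Filter F) (f : T -> C) l :
  f @ F --> l <-> forall e : R, 0 < e -> \forall x \near F, cmod (f x - l) < e.
Proof.
split=> [/cvgrPdist_lt h e e0|h].
  have := h (toC e); rewrite ltcR => /(_ e0).
  by apply: filterS => x; rewrite norm_cmod cmod_distC ltcR.
apply/cvgrPdist_lt => e; rewrite ltcE /= => /andP[/eqP e1 e2].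
by apply: filterS (h _ e2) => x; rewrite cmod_distC norm_cmod ltcE /= e1 eqxx.
Qed.

Lemma nbhs_cmodP (c : C) (P : set C) :
  nbhs c P <-> exists2 r : R, 0 < r & forall z, cmod (z - c) < r -> P z.
Proof.
split=> [/nbhs_ballP[e /= ]|[r r0 h]].
  rewrite ltcE /= => /andP[/eqP e1 e2] h; exists (complex.Re e) => // z zc.
  apply: h; rewrite /ball /= cmod_distC in zc *.
  by rewrite norm_cmod ltcE /= e1 eqxx.
apply/nbhs_ballP; exists (toC r); first by rewrite /= ltcR.
by move=> z; rewrite /ball /= norm_cmod ltcR cmod_distC; exact: h.
Qed.

End ComplexNumbers.

(** * Analytic functions *)

Section AnalyticFunctions.
Variable R : realType.
Local Notation C := (Cplx R).
Implicit Types (f g : C -> C) (c z : C).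

Lemma cmod_limit_le (u : nat -> C) l z (B : R) N :
  u @ \oo --> l -> (forall n, (N <= n)%N -> cmod (u n - z) <= B) ->
  cmod (l - z) <= B.
Proof.
move=> /cvg_cmodP ul uB; apply/ler_addgt0Pr => e e0.
have [M _ hM] := ul _ e0.
have -> : l - z = (u (maxn N M) - z) - (u (maxn N M) - l) by ring.
apply: (le_trans (ler_cmodB _ _)); apply: lerD; first exact/uB/leq_maxl.
exact/ltW/hM/leq_maxr.
Qed.

(** The radius r serves all orders N at once, whereas K may depend on N. The Taylor remainder in the
    second clause gives both the isolation of zeros and the jets along the critical line. *)
Definition power_expansion f c (a : nat -> C) (r : R) :=
  (forall z, cmod (z - c) < r -> series (fun n => a n * (z - c) ^+ n) @ \oo --> f z) /\
  forall N, exists2 K, 0 <= K & forall z, cmod (z - c) < r ->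
    cmod (f z - \sum_(0 <= n < N) a n * (z - c) ^+ n) <= K * cmod (z - c) ^+ N.

(** Convergence at one point at distance q from c bounds |a_n| q^n by some M. On the disc of radius
    q / 2 the tail from N on is then dominated by a geometric series of ratio at most 1/2, hence by
    2 M (|z - c| / q)^N. *)
Lemma analytic_power_expansion f c : analytic_at f c ->
  exists a r, 0 < r /\ power_expansion f c a r.
Proof.
move=> [a /nbhs_cmodP[r0 r00 ha]].
pose q : R := r0 / 2; have q0 : 0 < q by rewrite divr_gt0.
have z0c : cmod (c + toC q - c) = q.
  by rewrite addrAC subrr add0r cmod_toC gtr0_norm.
have [M M0 hM] : exists2 M : R, 0 < M & forall n, cmod (a n) * q ^+ n <= M.
  have /ha h : cmod (c + toC q - c) < r0 by rewrite z0c /q; lra.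
  have /cvg_cmodP/(_ _ ltr01)[N _ hN] :
      (fun n => a n * (c + toC q - c) ^+ n) @ \oo --> (0 : C).
    by apply: cvg_series_cvg_0; apply/cvg_ex; exists (f (c + toC q)).
  exists (1 + \sum_(i < N) cmod (a i) * q ^+ i).
    by rewrite ltr_pwDl // sumr_ge0 // => i _; rewrite mulr_ge0 ?cmod_ge0 ?exprn_ge0 ?ltW.
  move=> n; have [/hN|nN] := leqP N n.
    rewrite /= subr0 cmodM cmodX z0c => /ltW/le_trans; apply.
    by rewrite lerDl sumr_ge0 // => i _; rewrite mulr_ge0 ?cmod_ge0 ?exprn_ge0 ?ltW.
  rewrite (bigD1 (Ordinal nN)) //= addrCA lerDl addr_ge0 //.
  by rewrite sumr_ge0 // => i _; rewrite mulr_ge0 ?cmod_ge0 ?exprn_ge0 ?ltW.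
exists a, (q / 2); split; first by rewrite divr_gt0.
split=> [z zc|N]; first by apply: ha; apply: (lt_trans zc); rewrite /q; lra.
exists (2 * M / q ^+ N).
  by rewrite divr_ge0 ?mulr_ge0 ?exprn_ge0 // ltW.
move=> z zc; set x := cmod (z - c) in zc *.
have x0 : 0 <= x by exact: cmod_ge0.
have xq : x / q <= 2^-1 by rewrite ler_pdivrMr // mulrC; exact: ltW.
apply: (@cmod_limit_le _ _ _ _ N (ha z _)) => [|n Nn].
  by rewrite -/x; rewrite /q in zc; lra.
rewrite -/(series _ N) sub_series_geq // (le_trans (ler_cmod_sum _ _ _)) //.
have term k : cmod (a k * (z - c) ^+ k) <= M * (x / q) ^+ k.
  rewrite cmodM cmodX -/x expr_div_n mulrA ler_pdivlMr ?exprn_gt0 //.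
  rewrite mulrAC ler_wpM2r ?exprn_ge0 //.
(* Adding 2 M (x / q)^n to the sum makes the bound inductive: as x / q <= 1/2, each new term is paid
   for by the decrease of this addend. *)
have geo : \sum_(N <= k < n) M * (x / q) ^+ k <= 2 * M * (x / q) ^+ N.
  suff : \sum_(N <= k < n) M * (x / q) ^+ k + 2 * M * (x / q) ^+ n
      <= 2 * M * (x / q) ^+ N.
    by apply: le_trans; rewrite lerDl !mulr_ge0 ?exprn_ge0 ?divr_ge0 // ltW.
  rewrite -(subnKC Nn); elim: (n - N)%N => [|j ih]; first by rewrite addn0 big_geq ?add0r.
  apply: le_trans ih; rewrite addnS big_nat_recr ?leq_addr //= -addrA lerD2l.
  have h : 0 <= M * (x / q) ^+ (N + j) by rewrite mulr_ge0 ?exprn_ge0 ?divr_ge0 // ltW.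
  rewrite exprSr; nra.
apply: (le_trans (ler_sum _ (fun k _ => term k))); apply: (le_trans geo).
by rewrite expr_div_n le_eqVlt; apply/orP; left; apply/eqP; ring.
Qed.

(** If the coefficients below n vanish, the remainder of order n + 1 at a zero z gives |a_n| |z -
    c|^n <= K |z - c|^(n+1). Dividing and letting z approach c yields a_n = 0. *)
Lemma analytic_isolated_zero f c : analytic_at f c ->
  (forall e : R, 0 < e -> exists z, [/\ 0 < cmod (z - c), cmod (z - c) < e & f z = 0]) ->
  exists2 r : R, 0 < r & forall z, cmod (z - c) < r -> f z = 0.
Proof.
move=> /analytic_power_expansion[a [r [r0 [ha hK]]]] acc.
have a0 n : a n = 0.
  elim/ltn_ind: n => n ih; have [K K0 hKn] := hK n.+1.
  apply/eqP; rewrite -cmod_eq0 eq_le cmod_ge0 andbT; apply/ler_addgt0Pr => e e0.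
  rewrite add0r; pose d := Num.min r (e / (K + 1)).
  have K1 : 0 < K + 1 by lra.
  have d0 : 0 < d by rewrite lt_min r0 divr_gt0.
  have [z [z1 z2 fz]] := acc _ d0.
  move: z2; rewrite lt_min => /andP[zr ze].
  have := hKn z zr; rewrite fz sub0r cmodN big_nat_recr //= big_nat_cond big1 ?add0r.
    rewrite cmodM cmodX exprSr mulrCA mulrC ler_pM2l ?exprn_gt0 // => h.
    by rewrite (le_trans h) // mulrC (le_trans _ (ltW (_ : (K + 1) * cmod (z - c) < e))) //;
      [nra | rewrite mulrC -ltr_pdivlMr].
  by move=> i /andP[/andP[_ ilt] _]; rewrite ih // mul0r.
exists r => // z /ha; under eq_fun do rewrite a0 mul0r.
move=> /cvg_cmodP h; apply/eqP; rewrite -cmod_eq0 eq_le cmod_ge0 andbT.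
apply/ler_addgt0Pr => e /h [N _ hN]; rewrite add0r; apply/ltW.
have := hN N (leqnn N); rewrite /series /= big1 //.
by rewrite sub0r cmodN.
Qed.

(* Horizontal lines with y <> 0 avoid the pole 1, so continuing along them suffices. *)
Lemma analytic_zero_horizontal f (y : R) :
  (forall x : R, analytic_at f (Complex x y : C)) ->
  (forall z, 1 < cRe z -> f z = 0) -> forall x, f (Complex x y) = 0.
Proof.
move=> af f1.
(* S is closed upwards. If it were not all of R, its infimum b would be finite and zeros would
   accumulate at b from the right; f would then vanish around b, and S would contain a point below
   b. *)
pose S := [set x : R | forall x', x < x' -> f (Complex x' y) = 0].
have S1 : S 1 by move=> x' x1; exact: f1.
have Sup x x' : S x -> x <= x' -> S x'.
  by move=> Sx xx' t x't; apply: Sx; apply: le_lt_trans x't.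
suff ST x : S x by move=> x; apply: (ST (x - 1)); lra.
apply: contrapT => nSx.
have lbS : lbound S x.
  by move=> t St; rewrite leNgt; apply/negP => tx; apply: nSx; apply: Sup St (ltW _).
have hiS : has_inf S by split; [exists 1|exists x].
set b := inf S.
have fb t : b < t -> f (Complex t y) = 0.
  move=> bt; have /(inf_adherent)/(_ hiS)[s Ss] : 0 < t - b by lra.
  by rewrite -/b => sb; apply: Ss; lra.
have [e e0|r r0 hr] := analytic_isolated_zero (af b).
  exists (Complex (b + e / 2) y).
  have -> : cmod (Complex (b + e / 2) y - Complex b y : C) = e / 2.
    have -> : (Complex (b + e / 2) y - Complex b y : C) = toC (e / 2).
      by apply: complex_ext; rewrite ?cReB ?cImB /cRe /cIm /=; ring.
    by rewrite cmod_toC gtr0_norm // divr_gt0.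
  by split; [lra|lra|apply: fb; lra].
have : S (b - r / 2).
  move=> t bt; have [/fb //|tb] := ltP b t; apply: hr.
  have -> : (Complex t y - Complex b y : C) = toC (t - b).
    by apply: complex_ext; rewrite ?cReB ?cImB /cRe /cIm /=; ring.
  by rewrite cmod_toC ltr_norml; lra.
by move=> /(ge_inf (ex_intro _ x lbS)); rewrite -/b; lra.
Qed.

Lemma analytic_at_reflect f c : analytic_at f (cconj c) ->
  analytic_at (fun z => cconj (f (cconj z))) c.
Proof.
move=> [a /nbhs_cmodP[r r0 h]]; exists (fun n => cconj (a n)); apply/nbhs_cmodP.
exists r => // z zc; have /h/cvg_cmodP hz : cmod (cconj z - cconj c) < r.
  by rewrite -conjcB cmod_conj.
apply/cvg_cmodP => e /hz; apply: filterS => n.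
rewrite -[X in X < _ -> _]cmod_conj conjcB /series /= cconj_sum.
by under [X in cmod (X - _) < _ -> _]eq_bigr do rewrite conjcM cconjX conjcB !cconjK.
Qed.

Lemma analytic_atB f g c : analytic_at f c -> analytic_at g c ->
  analytic_at (fun z => f z - g z) c.
Proof.
move=> [a /nbhs_cmodP[r r0 ha]] [b /nbhs_cmodP[r' r'0 hb]].
exists (fun n => a n - b n); apply/nbhs_cmodP; exists (Num.min r r').
  by rewrite lt_min r0.
move=> z; rewrite lt_min => /andP[/ha fz /hb gz].
apply/cvg_cmodP => e e0; have e2 : 0 < e / 2 by rewrite divr_gt0.
move: fz gz => /cvg_cmodP/(_ _ e2) + /cvg_cmodP/(_ _ e2); apply: filterS2 => n.
have -> : series (fun n => (a n - b n) * (z - c) ^+ n) n =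
    series (fun n => a n * (z - c) ^+ n) n - series (fun n => b n * (z - c) ^+ n) n.
  by rewrite /series /= -sumrB; apply: eq_bigr => i _; rewrite mulrBl.
set u := series _ _; set v := series _ _ => h1 h2.
have -> : u - v - (f z - g z) = (u - f z) - (v - g z) by ring.
by apply: (le_lt_trans (ler_cmodB _ _)); lra.
Qed.

Lemma cpow_conj (t : R) z : cconj (cpow t z) = cpow t (cconj z).
Proof.
rewrite /cpow conjcM cconj_toC cRe_conj cIm_conj mulNr cosN sinN.
by [].
Qed.

Lemma zeta_reflect (zeta : C -> C) (hz : is_riemann_zeta zeta) z :
  cIm z != 0 -> zeta (cconj z) = cconj (zeta z).
Proof.
move=> z0; suff : zeta z - cconj (zeta (cconj z)) = 0.
  by move=> /subr0_eq ->; rewrite cconjK.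
have -> : z = Complex (cRe z) (cIm z) by apply: complex_ext.
apply: (@analytic_zero_horizontal (fun z => zeta z - cconj (zeta (cconj z)))).
  have ne (u : C) : cIm u != 0 -> u != 1.
    by apply: contraNneq => ->; rewrite cIm1.
  move=> x; apply: analytic_atB; first by apply: hz.1; exact: ne.
  apply: analytic_at_reflect; apply: hz.1; apply: ne.
  by rewrite cIm_conj oppr_eq0.
move=> {z0} {}z z1; apply/eqP; rewrite subr_eq0; apply/eqP.
have /cvg_cmodP h1 := hz.2 z z1.
have /hz.2/cvg_cmodP h2 : 1 < cRe (cconj z) by rewrite cRe_conj.
apply/eqP; rewrite -subr_eq0 -cmod_eq0 eq_le cmod_ge0 andbT.
apply/ler_addgt0Pr => e e0; rewrite add0r; have e2 : 0 < e / 2 by rewrite divr_gt0.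
have [N1 _ H1] := h1 _ e2; have [N2 _ H2] := h2 _ e2.
have := H1 _ (leq_maxl N1 N2); have := H2 _ (leq_maxr N1 N2).
rewrite /= /series /=.
rewrite -[X in X < _ -> _]cmod_conj conjcB cconj_sum.
under [X in cmod (X - _) < _ -> _]eq_bigr do rewrite cpow_conj conjcN cconjK.
set S := \sum_(_ <= _ < _) _ => k1 k2.
have -> : zeta z - cconj (zeta (cconj z)) =
    (S - cconj (zeta (cconj z))) - (S - zeta z) by ring.
by apply: (le_trans (ler_cmodB _ _)); lra.
Qed.

End AnalyticFunctions.

(** * The multiplier along the critical line *)

Section CriticalLineJets.
Variable R : realType.
Local Notation C := (Cplx R).
Implicit Types (f g : R -> C) (P Q : {poly C}).

(* x = 0 is excluded because [Vmul zeta] has the junk value 0 at the zeros of zeta. *)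
Definition jet (N : nat) f P := exists d K : R, [/\ 0 < d, 0 <= K &
  forall x : R, x != 0 -> `|x| < d -> cmod (f x - P.[toC x]) <= K * `|x| ^+ N].

Lemma poly_bounded P (B : R) : 0 <= B ->
  exists2 M : R, 0 <= M & forall z : C, cmod z <= B -> cmod P.[z] <= M.
Proof.
move=> B0; exists (\sum_(i < size P) cmod P`_i * B ^+ i).
  by rewrite sumr_ge0 // => i _; rewrite mulr_ge0 ?cmod_ge0 ?exprn_ge0.
move=> z zB; rewrite horner_coef (le_trans (ler_cmod_sum _ _ _)) //.
apply: ler_sum => i _; rewrite cmodM cmodX ler_wpM2l ?cmod_ge0 //.
by rewrite lerXn2r ?nnegrE ?cmod_ge0.
Qed.

Lemma poly_bounded1 P :
  exists2 M : R, 0 <= M & forall x : R, `|x| < 1 -> cmod P.[toC x] <= M.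
Proof.
have [M M0 h] := poly_bounded P ler01; exists M => // x x1.
by apply: h; rewrite cmod_toC ltW.
Qed.

Lemma poly_vanishing P : P.[0] = 0 ->
  exists2 M : R, 0 <= M & forall x : R, `|x| < 1 -> cmod P.[toC x] <= M * `|x|.
Proof.
move=> P0; have /factor_theorem[Q ->] : root P 0 by apply/eqP.
have [M M0 h] := poly_bounded1 Q; exists M => // x x1.
by rewrite hornerM !hornerE subr0 cmodM cmod_toC ler_wpM2r // h.
Qed.

Lemma jet_poly N P : jet N (fun x => P.[toC x]) P.
Proof. by exists 1, 0; split=> // x _ _; rewrite subrr cmod0 mul0r. Qed.

Lemma jet_ext N f g P (d : R) : 0 < d ->
  (forall x, x != 0 -> `|x| < d -> f x = g x) -> jet N f P -> jet N g P.
Proof.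
move=> d0 fg [d' [K [d'0 K0 h]]]; exists (Num.min d d'), K.
split=> //; first by rewrite lt_min d0.
by move=> x x0; rewrite lt_min => /andP[xd xd']; rewrite -fg // h.
Qed.

Lemma jetM N f g P Q : jet N f P -> jet N g Q -> jet N (fun x => f x * g x) (P * Q).
Proof.
move=> [d1 [K1 [d10 K10 h1]]] [d2 [K2 [d20 K20 h2]]].
have [M1 M10 hM1] := poly_bounded1 P; have [M2 M20 hM2] := poly_bounded1 Q.
exists (Num.min 1 (Num.min d1 d2)), (K1 * (M2 + K2) + M1 * K2); split.
- by rewrite !lt_min ltr01 d10.
- by rewrite addr_ge0 ?mulr_ge0 ?addr_ge0.
move=> x x0; rewrite !lt_min => /and3P[x1 xd1 xd2].
have {}h1 := h1 x x0 xd1; have {}h2 := h2 x x0 xd2.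
rewrite hornerM.
have -> : f x * g x - P.[toC x] * Q.[toC x] =
   (f x - P.[toC x]) * (Q.[toC x] + (g x - Q.[toC x])) + P.[toC x] * (g x - Q.[toC x]) by ring.
apply: (le_trans (ler_cmodD _ _)); rewrite [leRHS]mulrDl !cmodM.
have xN : 0 <= `|x| ^+ N <= 1 by rewrite exprn_ge0 ?exprn_ile1 // ltW.
have hQ : cmod (Q.[toC x] + (g x - Q.[toC x])) <= M2 + K2.
  apply: (le_trans (ler_cmodD _ _)); rewrite lerD ?hM2 //.
  by apply: (le_trans h2); nra.
have := hM1 x x1; have := cmod_ge0 P.[toC x]; have := cmod_ge0 (f x - P.[toC x]).
have := cmod_ge0 (g x - Q.[toC x]); have := cmod_ge0 (Q.[toC x] + (g x - Q.[toC x])).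
move=> a0 b0 c0 e0 hP; apply: lerD.
  by rewrite mulrAC; apply: ler_pM.
by rewrite -mulrA; apply: ler_pM.
Qed.

Lemma jetX N f P n : jet N f P -> jet N (fun x => f x ^+ n) (P ^+ n).
Proof.
move=> h; elim: n => [|n ih].
  by apply: (jet_ext ltr01 _ (jet_poly N 1)) => x _ _; rewrite hornerE.
by rewrite exprS; apply: (jet_ext ltr01 _ (jetM h ih)) => x _ _; rewrite exprS.
Qed.

Lemma jet_conj N f P : jet N f P ->
  jet N (fun x => cconj (f x)) (\poly_(i < size P) cconj P`_i).
Proof.
move=> [d [K [d0 K0 h]]]; exists d, K; split=> // x x0 xd.
suff -> : (\poly_(i < size P) cconj P`_i).[toC x] = cconj P.[toC x].
  by rewrite -conjcB cmod_conj h.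
rewrite horner_poly horner_coef cconj_sum; apply: eq_bigr => i _.
by rewrite conjcM cconjX cconj_toC.
Qed.

Lemma horner0_conj P : (\poly_(i < size P) cconj P`_i).[0] = cconj P.[0].
Proof.
rewrite !horner_coef0 coef_poly; case: ltnP => // h.
by rewrite nth_default // cconj0.
Qed.

Lemma jet_lower_bound N f P : jet N.+1 f P -> P.[0] != 0 ->
  exists2 d : R, 0 < d & forall x, x != 0 -> `|x| < d -> cmod P.[0] / 2 <= cmod (f x).
Proof.
move=> [d [K [d0 K0 h]]] p0; have p00 : 0 < cmod P.[0] by rewrite cmod_gt0.
have [|M M0 hM] := @poly_vanishing (P - P.[0]%:P); first by rewrite !hornerE subrr.
have MK : 0 < M + K + 1 by lra.
exists (Num.min (Num.min 1 d) (cmod P.[0] / 2 / (M + K + 1))).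
  by rewrite !lt_min ltr01 d0 !divr_gt0.
move=> x x0; rewrite !lt_min => /andP[/andP[x1 xd]].
rewrite ltr_pdivlMr // => xe.
have := hM x x1; rewrite !hornerE => h1; have h2 := h x x0 xd.
have h3 : `|x| ^+ N.+1 <= `|x| by rewrite exprS ler_piMr // exprn_ile1 // ltW.
have h4 : K * `|x| ^+ N.+1 <= K * `|x| by exact: ler_wpM2l.
have : cmod P.[0] <= cmod (f x) + cmod (P.[toC x] - P.[0]) + cmod (f x - P.[toC x]).
  have e : P.[0] = f x - (P.[toC x] - P.[0]) - (f x - P.[toC x]) by ring.
  rewrite [in leLHS]e.
  apply: (le_trans (ler_cmodB _ _)); rewrite lerD2r.
  exact: ler_cmodB.
have := normr_ge0 x; nra.
Qed.

Lemma jetV N f P : jet N.+1 f P -> P.[0] != 0 ->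
  exists2 Q, jet N.+1 (fun x => (f x)^-1) Q & Q.[0] = P.[0]^-1.
Proof.
move=> jf p0; have p00 : 0 < cmod P.[0] by rewrite cmod_gt0.
have [d1 d10 hd1] := jet_lower_bound jf p0.
have [d [K [d0 K0 h]]] := jf.
pose T : {poly C} := 1 - P.[0]^-1 *: P.
have T0 : T.[0] = 0 by rewrite !hornerE mulVf ?subrr.
pose Q := P.[0]^-1 *: \sum_(i < N.+1) T ^+ i.
have Q0 : Q.[0] = P.[0]^-1.
  rewrite /Q hornerZ horner_sum big_ord_recl expr0 hornerE big1 ?addr0 ?mulr1 //.
  by move=> i _; rewrite horner_exp T0 expr0n.
have PQ : P * Q = 1 - T ^+ N.+1.
  have -> : P * Q = (1 - T) * \sum_(i < N.+1) T ^+ i.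
    by rewrite {1}/T opprB addrCA subrr addr0 -scalerAr scalerAl.
  by rewrite -[1 - T]opprB mulNr -subrX1 opprB.
exists Q => //; have [M M0 hM] := poly_vanishing T0; have [M' M'0 hM'] := poly_bounded1 Q.
exists (Num.min (Num.min 1 d) d1), ((M ^+ N.+1 + K * M') / (cmod P.[0] / 2)); split.
- by rewrite !lt_min ltr01 d0.
- by rewrite divr_ge0 ?addr_ge0 ?mulr_ge0 ?exprn_ge0 // ltW.
move=> x x0; rewrite !lt_min => /andP[/andP[x1 xd] xd1].
have fx := hd1 x x0 xd1; have c20 : 0 < cmod P.[0] / 2 by rewrite divr_gt0.
have fx0 : f x != 0 by rewrite -cmod_gt0; exact: lt_le_trans fx.
have -> : (f x)^-1 - Q.[toC x] = (T.[toC x] ^+ N.+1 - (f x - P.[toC x]) * Q.[toC x]) / f x.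
  apply: (mulIf fx0); rewrite mulfVK // mulrBl mulVf //.
  have := congr1 (fun p : {poly C} => p.[toC x]) PQ; rewrite hornerM hornerD hornerN horner_exp hornerC => e.
  by rewrite (_ : T.[toC x] ^+ N.+1 = 1 - P.[toC x] * Q.[toC x]); [ring|rewrite e; ring].
rewrite cmodM cmodV [leRHS]mulrAC.
have A : cmod (T.[toC x] ^+ N.+1 - (f x - P.[toC x]) * Q.[toC x]) <=
    (M ^+ N.+1 + K * M') * `|x| ^+ N.+1.
  apply: (le_trans (ler_cmodB _ _)); rewrite [leRHS]mulrDl; apply: lerD.
    by rewrite cmodX -exprMn lerXn2r ?nnegrE ?cmod_ge0 ?mulr_ge0 ?hM.
  by rewrite cmodM mulrAC; apply: ler_pM; rewrite ?cmod_ge0 ?h ?hM'.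
apply: ler_pM => //; rewrite ?invr_ge0 ?cmod_ge0 //.
by rewrite lef_pV2 // posrE cmod_gt0.
Qed.

(** The bound on the degree matters far from rho: with degree at most k, the quotient P(s - rho) /
    (s - w)^(k+1) is still square integrable along the line. *)
Lemma jet_truncate N f P : jet N f P ->
  exists Q, [/\ jet N f Q, (size Q <= N)%N & (0 < N)%N -> Q.[0] = P.[0]].
Proof.
move=> [d [K [d0 K0 h]]]; exists (take_poly N P).
have [M M0 hM] := poly_bounded1 (drop_poly N P); split; last first.
- by move=> N0; rewrite !horner_coef0 coef_take_poly N0.
- exact: size_take_poly.
exists (Num.min 1 d), (K + M); split; first by rewrite lt_min ltr01.
  by rewrite addr_ge0.
move=> x x0; rewrite lt_min => /andP[x1 xd].
have := poly_take_drop N P => /(congr1 (fun p : {poly C} => p.[toC x])).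
rewrite hornerD hornerM hornerXn => e.
have -> : f x - (take_poly N P).[toC x] =
    (f x - P.[toC x]) + (drop_poly N P).[toC x] * toC x ^+ N by rewrite -e; ring.
apply: (le_trans (ler_cmodD _ _)); rewrite mulrDl lerD ?h //.
by rewrite cmodM cmodX cmod_toC ler_wpM2r ?exprn_ge0 ?hM.
Qed.

Lemma criticalE (t x : R) : critical (t + x) = critical t + imaginary_unit R * toC x.
Proof. by apply: complex_ext; rewrite /critical !(cReE, cImE) /cRe /cIm /=; ring. Qed.

Lemma critical_conj (t : R) : 1 - critical t = cconj (critical t).
Proof.
by apply: complex_ext; rewrite /critical !(cReE, cImE) /cRe /cIm /=; lra.
Qed.

Lemma critical_neq0 (t : R) : critical t != 0 :> C.
Proof.
apply/eqP => /(congr1 (@cRe R)); rewrite cRe0 /cRe /= => h.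
by have : (0 : R) < 2^-1 by []; rewrite h ltxx.
Qed.

Lemma cmod_imaginary_unit : cmod (imaginary_unit R) = 1.
Proof. by rewrite /cmod /= expr0n add0r expr1n sqrtr1. Qed.

Lemma analytic_jet (h : C -> C) (t : R) N : analytic_at h (critical t) ->
  exists2 P, jet N (fun x => h (critical (t + x))) P & (0 < N)%N -> P.[0] = h (critical t).
Proof.
move=> /analytic_power_expansion[a [r [r0 [ha hK]]]].
have [K K0 hKN] := hK N.
exists (\poly_(i < N) (a i * imaginary_unit R ^+ i)).
  exists r, K; split=> // x x0 xr.
  have e : critical (t + x) - critical t = imaginary_unit R * toC x.
    by rewrite criticalE; ring.
  have ce : cmod (imaginary_unit R * toC x) = `|x|.
    by rewrite cmodM cmod_imaginary_unit mul1r cmod_toC.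
  have -> : (\poly_(i < N) (a i * imaginary_unit R ^+ i)).[toC x] =
      \sum_(0 <= i < N) a i * (imaginary_unit R * toC x) ^+ i.
    rewrite horner_poly big_mkord; apply: eq_bigr => i _.
    by rewrite exprMn mulrA.
  by have := hKN (critical (t + x)); rewrite e ce => /(_ xr).
move=> N0; rewrite horner_coef0 coef_poly N0 expr0 mulr1.
(* The remainder of order 1, taken at the centre itself, identifies a 0 with the value of h. *)
have [K1 K10 hK1] := hK 1%N.
have := hK1 (critical t); rewrite subrr cmod0 expr1 mulr0 => /(_ r0).
rewrite big_nat1 expr0 mulr1 => le0; apply/esym/eqP.
by rewrite -subr_eq0 -cmod_eq0 eq_le le0 cmod_ge0.
Qed.

Variables (zeta : C -> C) (hz : is_riemann_zeta zeta).

Lemma cmod_criticalD (t : R) : cmod (critical t / (1 - critical t)) = 1.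
Proof.
by rewrite critical_conj cmodM cmodV cmod_conj divff // cmod_eq0 critical_neq0.
Qed.

Lemma cmod_Vmul (t : R) :
  cmod (Vmul zeta (critical t)) = (zeta (critical t) != 0)%:R.
Proof.
rewrite /Vmul cmodM cmodX cmod_criticalD expr1n mul1r critical_conj.
suff -> : cmod (zeta (cconj (critical t)) / zeta (critical t)) =
    cmod (zeta (critical t)) / cmod (zeta (critical t)).
  have [->|h] := eqVneq (zeta (critical t)) 0; first by rewrite cmod0 mul0r.
  by rewrite divff // cmod_eq0.
(* [zeta_reflect] excludes the real axis; at height 0 the point 1/2 is its own conjugate. *)
rewrite cmodM cmodV; have [->|t0] := eqVneq t 0.
  have -> // : cconj (critical (0 : R)) = critical 0.
  by apply: complex_ext; rewrite ?cRe_conj ?cIm_conj /cRe /cIm //= oppr0.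
by rewrite (zeta_reflect hz (t0 : cIm (critical t) != 0)) cmod_conj.
Qed.

Lemma cmod_Vmul_le1 (t : R) : cmod (Vmul zeta (critical t)) <= 1.
Proof. by rewrite cmod_Vmul; case: (_ != 0). Qed.

(* With zeta s = (s - rho)^m g s, the quotient conj (zeta s) / zeta s is
   (-1)^m conj (g s) / g s, as s - rho is purely imaginary on the line. *)
Lemma Vmul_jet (rho : C) m : critical_zero zeta rho m ->
  exists2 c : C, cmod c = 1 & forall N,
  exists P d, [/\ jet N.+1 (fun x => Vmul zeta (critical (cIm rho + x))) P,
    (size P <= N.+1)%N, P.[0] = c, 0 < d &
    forall x, x != 0 -> `|x| < d -> cmod (Vmul zeta (critical (cIm rho + x))) = 1].
Proof.
move=> [re_rho [_ [g [ag g0 /nbhs_cmodP[r r0 hg]]]]].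
have rhoE : rho = critical (cIm rho) by apply: complex_ext.
move: (cIm rho) rhoE => t rhoE; rewrite rhoE in ag g0 hg.
(* This constant is fixed before the order N. The diagonal limit compares two indices k and l at the
   same zero and needs the same c for both, so that c times its conjugate is 1. *)
exists ((critical t / cconj (critical t)) ^+ 3 *
    ((-1) ^+ m * (cconj (g (critical t)) / g (critical t)))).
  rewrite !(cmodM, cmodX, cmodV, cmod_conj, cmodN) cmod1 expr1n mul1r.
  by rewrite !divff ?expr1n ?mulr1 // cmod_eq0 ?critical_neq0.
move=> N; have [G jG /(_ isT) G0] := analytic_jet N.+1 ag.
have Gn0 : G.[0] != 0 by rewrite G0.
have [d1 d10 hd1] := jet_lower_bound jG Gn0.
have crx x : critical (t + x) - critical t = imaginary_unit R * toC x.
  by rewrite criticalE; ring.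
have ccx x : cmod (critical (t + x) - critical t) = `|x|.
  by rewrite crx cmodM cmod_imaginary_unit mul1r cmod_toC.
have zE x : `|x| < r -> zeta (critical (t + x)) = (imaginary_unit R * toC x) ^+ m * g (critical (t + x)).
  by move=> xr; rewrite (hg _ _) ?ccx; [rewrite crx|].
have x0C x : x != 0 -> imaginary_unit R * toC x != 0.
  by move=> x0; rewrite -cmod_gt0 cmodM cmod_imaginary_unit mul1r cmod_toC normr_gt0.
(* Keeping |x| below |t| keeps t + x away from 0, as [zeta_reflect] demands. For t = 0 the condition
   x != 0 already does so. *)
pose d2 : R := if t == 0 then 1 else `|t|.
have d20 : 0 < d2 by rewrite /d2; case: eqVneq => // t0; rewrite normr_gt0.
have imx x : x != 0 -> `|x| < d2 -> t + x != 0.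
  rewrite /d2; case: (eqVneq t 0) => [t0|t0] x0; first by rewrite t0 add0r.
  by apply: contraTneq => /eqP; rewrite addr_eq0 => /eqP ->; rewrite normrN ltxx.
have [GV jGV GV0] := jetV jG Gn0.
pose S : {poly C} := (critical t)%:P + imaginary_unit R *: 'X.
have S0 : S.[0] = critical t by rewrite !hornerE.
have jS : jet N.+1 (fun x => critical (t + x)) S.
  by apply: (jet_ext ltr01 _ (jet_poly _ S)) => x _ _; rewrite !hornerE criticalE.
have cS0 : (\poly_(i < size S) cconj S`_i).[0] != 0.
  by rewrite horner0_conj S0 -cmod_eq0 cmod_conj cmod_eq0 critical_neq0.
have [SV jSV SV0] := jetV (jet_conj jS) cS0.
have jF := jetM (jetX 3 (jetM jS jSV))
  (jetM (jet_poly N.+1 ((-1) ^+ m)%:P) (jetM (jet_conj jG) jGV)).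
have [P [jP sP P0]] := jet_truncate jF.
exists P, (Num.min (Num.min r d1) d2).
have nz x : x != 0 -> `|x| < Num.min (Num.min r d1) d2 -> zeta (critical (t + x)) != 0.
  rewrite !lt_min => x0 /andP[/andP[xr xd1] _].
  rewrite zE // mulf_neq0 ?expf_neq0 ?x0C // -cmod_gt0.
  by apply: lt_le_trans (hd1 x x0 xd1); rewrite divr_gt0 // cmod_gt0.
split=> //.
- have d0 : 0 < Num.min r d2 by rewrite lt_min r0.
  apply: (jet_ext d0 _ jP) => x x0; rewrite !lt_min => /andP[xr xd2].
  rewrite /Vmul critical_conj hornerC; congr (_ * _).
  rewrite (zeta_reflect hz); last by rewrite /cIm /= imx.
  rewrite !zE // conjcM cconjX conjcM cconj_toC.
  have -> : cconj (imaginary_unit R) = - imaginary_unit R.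
    by apply: complex_ext; rewrite !(cReE, cImE) /cRe /cIm /= ?oppr0.
  rewrite mulNr [(- (_ * toC x)) ^+ m]exprNn invfM; set u := (_ * toC x) ^+ m.
  have u0 : u != 0 by rewrite expf_neq0 ?x0C.
  move: ((-1) ^+ m) (cconj (g _)) (g _)^-1 => a b c.
  by field.
- by rewrite P0 // !hornerM hornerC SV0 GV0 !horner0_conj S0 G0.
- by rewrite !lt_min r0 d10.
- by move=> x x0 xd; rewrite cmod_Vmul nz.
Qed.

End CriticalLineJets.

(** * Complex integrals and square norms *)

Section ComplexIntegral.
Variable R : realType.
Local Notation C := (Cplx R).
Local Notation mu := (@lebesgue_measure R).
Variables (D : set (measurableTypeR R)) (mD : measurable D).
Implicit Types (f g h : R -> C) (c : C).

Definition rintegrable (f : R -> R) := mu.-integrable D (EFin \o f).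

Lemma rintegrableD (f g : R -> R) :
  rintegrable f -> rintegrable g -> rintegrable (fun t => f t + g t).
Proof. by move=> fi gi; exact: (integrableD mD fi gi). Qed.

Lemma rintegrableZ (k : R) (f : R -> R) :
  rintegrable f -> rintegrable (fun t => k * f t).
Proof. by move=> fi; exact: (integrableZl mD k fi). Qed.

Lemma rintegrableB (f g : R -> R) :
  rintegrable f -> rintegrable g -> rintegrable (fun t => f t - g t).
Proof. by move=> fi gi; exact: (integrableB mD fi gi). Qed.

Lemma le_rintegrable (f g : R -> R) : measurable_fun D f ->
  (forall t, D t -> `|f t| <= g t) -> rintegrable g -> rintegrable f.
Proof.
move=> mf fg; apply: le_integrable => //; first exact/measurable_EFinP.
by move=> t Dt /=; rewrite lee_fin (le_trans (fg _ Dt)) // ler_norm.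
Qed.

Lemma rintegrable_measurable (f : R -> R) : rintegrable f -> measurable_fun D f.
Proof. by move=> /(measurable_int mu)/measurable_EFinP. Qed.

Definition cmeasurable f :=
  measurable_fun D (fun t => cRe (f t)) /\ measurable_fun D (fun t => cIm (f t)).

Lemma cmeasurableD f g : cmeasurable f -> cmeasurable g ->
  cmeasurable (fun t => f t + g t).
Proof.
move=> [f1 f2] [g1 g2]; split.
  by under eq_fun do rewrite cReD; exact: measurable_funD.
by under eq_fun do rewrite cImD; exact: measurable_funD.
Qed.

Lemma cmeasurableM f g : cmeasurable f -> cmeasurable g ->
  cmeasurable (fun t => f t * g t).
Proof.
move=> [f1 f2] [g1 g2]; split.
  by under eq_fun do rewrite cReM; apply: measurable_funB; exact: measurable_funM.
by under eq_fun do rewrite cImM; apply: measurable_funD; exact: measurable_funM.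
Qed.

Lemma cmeasurable_cst c : cmeasurable (fun=> c).
Proof. by split; exact: measurable_cst. Qed.

Lemma cmeasurable_toC (f : R -> R) : measurable_fun D f -> cmeasurable (fun t => toC (f t)).
Proof. by move=> mf; split => //=; exact: measurable_cst. Qed.

Lemma cmeasurable_conj f : cmeasurable f -> cmeasurable (fun t => cconj (f t)).
Proof.
move=> [f1 f2]; split; first by under eq_fun do rewrite cRe_conj.
by under eq_fun do rewrite cIm_conj; exact: measurable_funN.
Qed.

Lemma measurable_sqr_cmod f : cmeasurable f -> measurable_fun D (fun t => cmod (f t) ^+ 2).
Proof.
move=> [f1 f2]; under eq_fun do rewrite sqr_cmod.
by apply: measurable_funD; exact: measurable_funX.
Qed.

Definition cintegrable f :=
  rintegrable (fun t => cRe (f t)) /\ rintegrable (fun t => cIm (f t)).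

Lemma cintegrableD f g : cintegrable f -> cintegrable g ->
  cintegrable (fun t => f t + g t).
Proof.
move=> [f1 f2] [g1 g2]; split.
  by under eq_fun do rewrite cReD; exact: rintegrableD.
by under eq_fun do rewrite cImD; exact: rintegrableD.
Qed.

Lemma cintegrableZ c f : cintegrable f -> cintegrable (fun t => c * f t).
Proof.
move=> [f1 f2]; split.
  by under eq_fun do rewrite cReM; apply: rintegrableB; exact: rintegrableZ.
by under eq_fun do rewrite cImM; apply: rintegrableD; exact: rintegrableZ.
Qed.

Lemma cintegrable0 : cintegrable (fun=> 0).
Proof. by split; exact: integrable0. Qed.

Lemma cintegrable_sum (I : Type) (s : seq I) (F : I -> R -> C) :
  (forall i, cintegrable (F i)) -> cintegrable (fun t => \sum_(i <- s) F i t).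
Proof.
move=> Fi; elim: s => [|i s ih].
  by under eq_fun do rewrite big_nil; exact: cintegrable0.
by under eq_fun do rewrite big_cons; exact: cintegrableD.
Qed.

Lemma eq_cintegral f g : (forall t, D t -> f t = g t) -> cintegral D f = cintegral D g.
Proof.
move=> fg; rewrite /cintegral; congr Complex; apply: eq_Rintegral => t;
  by rewrite inE => Dt; rewrite fg.
Qed.

Lemma eq_cintegrable f g : (forall t, D t -> f t = g t) -> cintegrable f -> cintegrable g.
Proof.
move=> fg [f1 f2]; split; [apply: eq_integrable f1|apply: eq_integrable f2] => //;
  by move=> t; rewrite inE => Dt /=; rewrite fg.
Qed.

Lemma cRe_cintegral f : cRe (cintegral D f) = Rintegral mu D (fun t => cRe (f t)).
Proof. by []. Qed.
Lemma cIm_cintegral f : cIm (cintegral D f) = Rintegral mu D (fun t => cIm (f t)).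
Proof. by []. Qed.

Lemma cintegralD f g : cintegrable f -> cintegrable g ->
  cintegral D (fun t => f t + g t) = cintegral D f + cintegral D g.
Proof.
move=> [f1 f2] [g1 g2]; apply: complex_ext.
  rewrite cReD !cRe_cintegral -RintegralD //.
  by apply: eq_Rintegral => t _; rewrite cReD.
rewrite cImD !cIm_cintegral -RintegralD //.
by apply: eq_Rintegral => t _; rewrite cImD.
Qed.

Lemma cintegralZ c f : cintegrable f ->
  cintegral D (fun t => c * f t) = c * cintegral D f.
Proof.
move=> [f1 f2]; apply: complex_ext.
  rewrite cReM !cRe_cintegral !cIm_cintegral -!RintegralZl // -RintegralB //;
    do ?exact: rintegrableZ.
  by apply: eq_Rintegral => t _; rewrite cReM.
rewrite cImM !cRe_cintegral !cIm_cintegral -!RintegralZl // -RintegralD //;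
    do ?exact: rintegrableZ.
by apply: eq_Rintegral => t _; rewrite cImM.
Qed.

Lemma cintegral0 : cintegral D (fun=> 0) = 0.
Proof. by apply: complex_ext; rewrite ?cRe_cintegral ?cIm_cintegral Rintegral_cst // mul0r. Qed.

Lemma cintegral_sum (I : Type) (s : seq I) (F : I -> R -> C) :
  (forall i, cintegrable (F i)) ->
  cintegral D (fun t => \sum_(i <- s) F i t) = \sum_(i <- s) cintegral D (F i).
Proof.
move=> Fi; elim: s => [|i s ih].
  by rewrite big_nil -[RHS]cintegral0; apply: eq_cintegral => t _; rewrite big_nil.
rewrite big_cons -ih -cintegralD //; last exact: cintegrable_sum.
by apply: eq_cintegral => t _; rewrite big_cons.
Qed.

Lemma cintegral_conj f : cintegrable f ->
  cintegral D (fun t => cconj (f t)) = cconj (cintegral D f).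
Proof.
move=> [f1 f2]; apply: complex_ext.
  rewrite cRe_conj !cRe_cintegral.
  by apply: eq_Rintegral => t _; rewrite cRe_conj.
rewrite cIm_conj !cIm_cintegral -mulN1r -RintegralZl //.
by apply: eq_Rintegral => t _; rewrite cIm_conj mulN1r.
Qed.

Lemma cintegral_toC (f : R -> R) :
  cintegral D (fun t => toC (f t)) = toC (Rintegral mu D f).
Proof.
apply: complex_ext; first by [].
by rewrite cIm_cintegral cIm_toC Rintegral_cst // mul0r.
Qed.

(** Real and imaginary parts are bounded separately, whence the factor 2; [cmod_dot_le] absorbs it
    in its weights. *)
Lemma cmod_cintegral_le f (B : R -> R) : cmeasurable f ->
  rintegrable B -> (forall t, D t -> cmod (f t) <= B t) ->
  cmod (cintegral D f) <= 2 * Rintegral mu D B.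
Proof.
move=> [m1 m2] Bi fB.
have h1 : rintegrable (fun t => cRe (f t)).
  by apply: le_rintegrable m1 _ Bi => t Dt; exact: le_trans (normr_cRe _) (fB _ Dt).
have h2 : rintegrable (fun t => cIm (f t)).
  by apply: le_rintegrable m2 _ Bi => t Dt; exact: le_trans (normr_cIm _) (fB _ Dt).
apply: (le_trans (cmod_le_ReIm _)); rewrite cRe_cintegral cIm_cintegral mulr2n mulrDl mul1r.
apply: lerD.
  apply: (le_trans (le_normr_Rintegral mD h1)); apply: le_Rintegral => //.
    exact: integrable_norm.
  by move=> t Dt; exact: le_trans (normr_cRe _) (fB _ Dt).
apply: (le_trans (le_normr_Rintegral mD h2)); apply: le_Rintegral => //.
  exact: integrable_norm.
by move=> t Dt; exact: le_trans (normr_cIm _) (fB _ Dt).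
Qed.

Lemma sqintP f : square_integrable D f <->
  cmeasurable f /\ rintegrable (fun t => cmod (f t) ^+ 2).
Proof.
split=> [[f1 f2 f3]|[[f1 f2] f3]]; last first.
  split=> //; move/integrableP : f3 => [_]; rewrite /sqnorm.
  by under eq_integral do rewrite /= ger0_norm ?sqr_ge0 //.
split; first by split.
apply/integrableP; split.
  by apply/measurable_EFinP; apply: measurable_sqr_cmod; split.
by under eq_integral do rewrite /= ger0_norm ?sqr_ge0 //.
Qed.

(** The value is 0 when the integral is infinite, so upper bounds on it mean something only together
    with square integrability. *)
Definition sqnrm f : R := Rintegral mu D (fun t => cmod (f t) ^+ 2).

Lemma sqnrm_ge0 f : 0 <= sqnrm f.
Proof. by apply: Rintegral_ge0 => t _; exact: sqr_ge0. Qed.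

Lemma sqnormE f : square_integrable D f -> sqnorm D f = (sqnrm f)%:E.
Proof.
move=> /sqintP[_ fi]; rewrite /sqnrm /Rintegral fineK //.
exact: integrable_fin_num.
Qed.

Lemma le_sqint f (g : R -> R) : cmeasurable f -> rintegrable g ->
  (forall t, D t -> cmod (f t) ^+ 2 <= g t) -> square_integrable D f.
Proof.
move=> mf gi fg; apply/sqintP; split=> //; apply: le_rintegrable gi.
  exact: measurable_sqr_cmod.
by move=> t Dt; rewrite ger0_norm ?sqr_ge0 // fg.
Qed.

Lemma eq_sqint f g : (forall t, D t -> f t = g t) ->
  square_integrable D f -> square_integrable D g.
Proof.
move=> fg [f1 f2 f3]; split.
- by apply: eq_measurable_fun f1 => t; rewrite inE => Dt; rewrite fg.
- by apply: eq_measurable_fun f2 => t; rewrite inE => Dt; rewrite fg.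
- rewrite /sqnorm in f3 *; apply: le_lt_trans f3; rewrite le_eqVlt; apply/orP; left.
  by apply/eqP; apply: eq_integral => t; rewrite inE => Dt; rewrite fg.
Qed.

Lemma eq_sqnrm f g : (forall t, D t -> f t = g t) -> sqnrm f = sqnrm g.
Proof. by move=> fg; apply: eq_Rintegral => t; rewrite inE => Dt; rewrite fg. Qed.

Lemma sqintD f g : square_integrable D f -> square_integrable D g ->
  square_integrable D (fun t => f t + g t).
Proof.
move=> /sqintP[mf fi] /sqintP[mg gi].
apply: (le_sqint (cmeasurableD mf mg) (rintegrableZ 2 (rintegrableD fi gi))).
by move=> t _; exact: sqr_cmodD_le.
Qed.

Lemma sqintZ c f : square_integrable D f -> square_integrable D (fun t => c * f t).
Proof.
move=> /sqintP[mf fi].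
apply: (le_sqint (cmeasurableM (cmeasurable_cst c) mf) (rintegrableZ (cmod c ^+ 2) fi)).
by move=> t _; rewrite cmodM exprMn.
Qed.

Lemma sqintB f g : square_integrable D f -> square_integrable D g ->
  square_integrable D (fun t => f t - g t).
Proof.
move=> fi /(sqintZ (-1)) gi; apply: eq_sqint (sqintD fi gi) => t _.
by rewrite mulN1r.
Qed.

Lemma sqint_sum (I : Type) (s : seq I) (F : I -> R -> C) :
  (forall i, square_integrable D (F i)) ->
  square_integrable D (fun t => \sum_(i <- s) F i t).
Proof.
move=> Fi; elim: s => [|i s ih].
  apply: eq_sqint (_ : square_integrable D (fun=> 0)) => [t _|]; first by rewrite big_nil.
  apply: (@le_sqint _ (fun=> 0) (cmeasurable_cst 0)); first exact: integrable0.
  by move=> t _; rewrite cmod0 expr0n.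
by apply: eq_sqint (sqintD (Fi i) ih) => t _; rewrite big_cons.
Qed.

Lemma sqnrmZ c f : square_integrable D f -> sqnrm (fun t => c * f t) = cmod c ^+ 2 * sqnrm f.
Proof.
move=> /sqintP[mf fi]; rewrite -RintegralZl //.
by apply: eq_Rintegral => t _; rewrite cmodM exprMn.
Qed.

Lemma sqnrmN f : sqnrm (fun t => - f t) = sqnrm f.
Proof. by apply: eq_Rintegral => t _; rewrite cmodN. Qed.

Lemma sqnrm_parallelogram f g : square_integrable D f -> square_integrable D g ->
  sqnrm (fun t => f t + g t) + sqnrm (fun t => f t - g t) = 2 * (sqnrm f + sqnrm g).
Proof.
move=> fi gi; have /sqintP[_ hB] := sqintB fi gi; have /sqintP[_ hD] := sqintD fi gi.
move: fi gi => /sqintP[mf fi] /sqintP[mg gi].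
rewrite /sqnrm -!RintegralD // -RintegralZl //; last exact: rintegrableD.
by apply: eq_Rintegral => t _; exact: sqr_cmod_parallelogram.
Qed.

Lemma sqnrmD_le f g : square_integrable D f -> square_integrable D g ->
  sqnrm (fun t => f t + g t) <= 2 * (sqnrm f + sqnrm g).
Proof. by move=> fi gi; rewrite -sqnrm_parallelogram // lerDl sqnrm_ge0. Qed.

Lemma le_sqnrm f (g : R -> R) : cmeasurable f -> rintegrable g ->
  (forall t, D t -> cmod (f t) ^+ 2 <= g t) -> sqnrm f <= Rintegral mu D g.
Proof.
move=> mf gi fg; have /sqintP[_ fi] := le_sqint mf gi fg.
exact: le_Rintegral.
Qed.

(** Pointwise the two sides differ by squares (e a - b)^2 / e. In contrast to [sqnrmD_le], the
    coefficient of |f|^2 is as close to 1 as desired, so sharp constants survive a passage to the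
    limit. *)
Lemma sqnrmD_weighted f g (e : R) : 0 < e ->
  square_integrable D f -> square_integrable D g ->
  sqnrm (fun t => f t + g t) <= (1 + e) * sqnrm f + (1 + e^-1) * sqnrm g.
Proof.
move=> e0 fi gi; have /sqintP[_ hD] := sqintD fi gi.
move: fi gi => /sqintP[mf fi] /sqintP[mg gi].
rewrite /sqnrm -!RintegralZl // -RintegralD //; try exact: rintegrableZ.
apply: le_Rintegral => //; first by apply: rintegrableD; exact: rintegrableZ.
move=> t _; rewrite !sqr_cmod !(cReE, cImE).
have aux (a b : R) : (a + b) ^+ 2 <= (1 + e) * a ^+ 2 + (1 + e^-1) * b ^+ 2.
  have -> : (1 + e) * a ^+ 2 + (1 + e^-1) * b ^+ 2 = (a + b) ^+ 2 + (e * a - b) ^+ 2 / e.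
    by field; rewrite gt_eqF.
  by rewrite lerDl divr_ge0 ?sqr_ge0 // ltW.
by have := aux (cRe (f t)) (cRe (g t)); have := aux (cIm (f t)) (cIm (g t)); lra.
Qed.

Lemma sqint_cmulJ f g : square_integrable D f -> square_integrable D g ->
  cintegrable (fun t => f t * cconj (g t)).
Proof.
move=> /sqintP[mf fi] /sqintP[mg gi].
have [m1 m2] := cmeasurableM mf (cmeasurable_conj mg).
have B t : cmod (f t * cconj (g t)) <= cmod (f t) ^+ 2 + cmod (g t) ^+ 2.
  by rewrite cmodM cmod_conj; have := cmod_ge0 (f t); have := cmod_ge0 (g t); nra.
split; apply: le_rintegrable (rintegrableD fi gi) => // t _.
  exact: le_trans (normr_cRe _) (B t).
exact: le_trans (normr_cIm _) (B t).
Qed.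

(** The weighted arithmetic-geometric inequality plays the part of Cauchy-Schwarz. A large s suits a
    small f paired with a bounded g. *)
Lemma cmod_dot_le f g (s : R) : 0 < s ->
  square_integrable D f -> square_integrable D g ->
  cmod (cintegral D (fun t => f t * cconj (g t))) <= s * sqnrm f + s^-1 * sqnrm g.
Proof.
move=> s0 /sqintP[mf fi] /sqintP[mg gi].
have m := cmeasurableM mf (cmeasurable_conj mg).
have e : s * sqnrm f + s^-1 * sqnrm g =
    2 * Rintegral mu D (fun t => (s / 2) * cmod (f t) ^+ 2 + (s^-1 / 2) * cmod (g t) ^+ 2).
  rewrite RintegralD // ?RintegralZl //; try exact: rintegrableZ.
  by rewrite /sqnrm; lra.
rewrite e; apply: cmod_cintegral_le m _ _.
  by apply: rintegrableD; exact: rintegrableZ.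
move=> t _; rewrite cmodM cmod_conj.
set a := cmod (f t); set b := cmod (g t).
have -> : s / 2 * a ^+ 2 + s^-1 / 2 * b ^+ 2 = a * b + (s * a - b) ^+ 2 / (2 * s).
  by field; rewrite gt_eqF.
by rewrite lerDl divr_ge0 ?sqr_ge0 // mulr_ge0 // ltW.
Qed.

Lemma dot_self f : cintegral D (fun t => f t * cconj (f t)) = toC (sqnrm f).
Proof. by rewrite -cintegral_toC; apply: eq_cintegral => t _; exact: mulr_cconj. Qed.

End ComplexIntegral.

(** * Square norms on subsets and under almost everywhere equality *)

Section SubDomains.
Variable R : realType.
Local Notation C := (Cplx R).
Local Notation mu := (@lebesgue_measure R).
Implicit Types (D E : set (measurableTypeR R)) (f g : R -> C).

Lemma sqint_sub D E f : measurable D -> measurable E -> E `<=` D ->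
  square_integrable D f -> square_integrable E f.
Proof.
move=> mD mE ED /sqintP[[m1 m2] fi]; apply/sqintP => //; split.
  by split; [exact: measurable_funS m1|exact: measurable_funS m2].
exact: integrableS fi.
Qed.

Lemma sqnrm_sub D E f : measurable D -> measurable E -> E `<=` D ->
  square_integrable D f -> sqnrm E f <= sqnrm D f.
Proof.
move=> mD mE ED fi; rewrite -lee_fin -!sqnormE //; last exact: sqint_sub fi.
apply: ge0_subset_integral => //.
- by apply/measurable_EFinP; apply: measurable_sqr_cmod; case: fi.
- by move=> t _; rewrite lee_fin sqr_ge0.
Qed.

Lemma sqnrm_ae D f g : measurable D -> square_integrable D f -> square_integrable D g ->
  {ae mu, forall t, D t -> f t = g t} -> sqnrm D f = sqnrm D g.
Proof.
move=> mD [f1 f2 _] [g1 g2 _] fg; rewrite /sqnrm /Rintegral; congr fine.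
apply: ae_eq_integral => //.
- by apply/measurable_EFinP; apply: measurable_sqr_cmod.
- by apply/measurable_EFinP; apply: measurable_sqr_cmod.
- by apply: filterS fg => t h Dt /=; rewrite h.
Qed.

End SubDomains.

(** * Primitives of log(1/t)^k t^(z-1) *)

Section FundamentalTheorem.
Variable R : realType.
Local Notation C := (Cplx R).
Local Notation mu := (@lebesgue_measure R).

Lemma is_derive_continuous (F : R -> R) (x d : R) : is_derive x 1 F d -> {for x, continuous F}.
Proof.
by move=> [dF _]; apply: differentiable_continuous; exact/derivable1_diffP.
Qed.

Lemma itv_within_continuous (f : R -> R) (a b : R) :
  (forall x, a <= x <= b -> {for x, continuous f}) -> {within `[a, b], continuous f}.
Proof.
move=> cf; apply: continuous_in_subspaceT => x.
by rewrite inE /= in_itv /=; exact: cf.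
Qed.

Lemma itv_rintegrable (f : R -> R) (a b : R) :
  (forall x, a <= x <= b -> {for x, continuous f}) -> rintegrable `[a, b] f.
Proof.
move=> cf; apply: continuous_compact_integrable; first exact: segment_compact.
exact: itv_within_continuous.
Qed.

Lemma rFTC (F f : R -> R) (a b : R) : a <= b ->
  (forall x, a <= x <= b -> is_derive x 1 F (f x)) ->
  (forall x, a <= x <= b -> {for x, continuous f}) ->
  Rintegral mu `[a, b] f = F b - F a.
Proof.
rewrite le_eqVlt => /predU1P[<- _ _|ab dF cf].
  by rewrite set_itv1 Rintegral_set1 subrr.
rewrite /Rintegral (@continuous_FTC2 _ f F a b) //.
- exact: itv_within_continuous.
- have cF x : a <= x <= b -> {for x, continuous F}.
    by move=> /dF; exact: is_derive_continuous.
  split.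
  + by move=> x; rewrite in_itv /= => /andP[/ltW ax /ltW xb]; have [|]:= dF x; rewrite ?ax.
  + by apply: cvg_at_right_filter; apply: cF; rewrite lexx ltW.
  + by apply: cvg_at_left_filter; apply: cF; rewrite lexx ltW.
- move=> x; rewrite in_itv /= => /andP[/ltW ax /ltW xb].
  by rewrite derive1E; have [|]:= dF x; rewrite ?ax.
Qed.

Definition is_cderive (F f : R -> C) (x : R) :=
  is_derive x 1 (fun t => cRe (F t)) (cRe (f x)) /\
  is_derive x 1 (fun t => cIm (F t)) (cIm (f x)).

Definition ccontinuous_at (f : R -> C) (x : R) :=
  {for x, continuous (fun t => cRe (f t))} /\ {for x, continuous (fun t => cIm (f t))}.

Lemma is_cderive_continuous F f x : is_cderive F f x -> ccontinuous_at F x.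
Proof. by move=> [h1 h2]; split; exact: is_derive_continuous. Qed.

Lemma itv_cintegrable (f : R -> C) (a b : R) :
  (forall x, a <= x <= b -> ccontinuous_at f x) -> cintegrable `[a, b] f.
Proof.
by move=> cf; split; apply: itv_rintegrable => x xab; have [] := cf x xab.
Qed.

Lemma cFTC (F f : R -> C) (a b : R) : a <= b ->
  (forall x, a <= x <= b -> is_cderive F f x) ->
  (forall x, a <= x <= b -> ccontinuous_at f x) ->
  cintegral `[a, b] f = F b - F a.
Proof.
move=> ab dF cf; apply: complex_ext.
  rewrite cReB cRe_cintegral.
  by apply: (@rFTC (fun t => cRe (F t))) => // [x /dF[] //|x /cf[]].
rewrite cImB cIm_cintegral.
by apply: (@rFTC (fun t => cIm (F t))) => // [x /dF[] //|x /cf[]].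
Qed.

Lemma is_cderiveD F f G g x : is_cderive F f x -> is_cderive G g x ->
  is_cderive (fun t => F t + G t) (fun t => f t + g t) x.
Proof.
move=> [F1 F2] [G1 G2]; split.
  under eq_fun do rewrite cReD; rewrite cReD; exact: is_deriveD.
under eq_fun do rewrite cImD; rewrite cImD; exact: is_deriveD.
Qed.

Lemma is_cderiveM F f G g x : is_cderive F f x -> is_cderive G g x ->
  is_cderive (fun t => F t * G t) (fun t => f t * G t + F t * g t) x.
Proof.
move=> [F1 F2] [G1 G2]; split.
  under eq_fun do rewrite cReM.
  apply: (is_derive_eq (is_deriveB (is_deriveM F1 G1) (is_deriveM F2 G2))).
  by rewrite !cReE /GRing.scale /=; ring.
under eq_fun do rewrite cImM.
apply: (is_derive_eq (is_deriveD (is_deriveM F1 G2) (is_deriveM F2 G1))).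
by rewrite !cImE /GRing.scale /=; ring.
Qed.

Lemma is_cderive_cst (c : C) x : is_cderive (fun=> c) (fun=> 0) x.
Proof. by split; exact: is_derive_cst. Qed.

Lemma is_cderive_toC (F f : R -> R) (x : R) : is_derive x 1 F (f x) ->
  is_cderive (fun t => toC (F t)) (fun t => toC (f t)) x.
Proof. by move=> h; split; [exact: h|exact: is_derive_cst]. Qed.

Lemma eq_is_cderive F f g x : f x = g x -> is_cderive F f x -> is_cderive F g x.
Proof. by rewrite /is_cderive => ->. Qed.

Lemma is_cderiveZ c F f x : is_cderive F f x ->
  is_cderive (fun t => c * F t) (fun t => c * f t) x.
Proof.
move=> h; apply: eq_is_cderive (is_cderiveM (is_cderive_cst c x) h) => /=.
by rewrite mul0r add0r.
Qed.

Lemma cRe_cpow (t : R) (z : C) : cRe (cpow t z) = expR (cRe z * ln t) * cos (cIm z * ln t).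
Proof. by rewrite /cpow cReM cRe_toC cIm_toC mul0r subr0. Qed.

Lemma cIm_cpow (t : R) (z : C) : cIm (cpow t z) = expR (cRe z * ln t) * sin (cIm z * ln t).
Proof. by rewrite /cpow cImM cRe_toC cIm_toC mul0r addr0. Qed.

Lemma cpowD (t : R) (z w : C) : cpow t (z + w) = cpow t z * cpow t w.
Proof.
apply: complex_ext.
  by rewrite [RHS]cReM !cRe_cpow !cIm_cpow cReD cImD !mulrDl expRD cosD; ring.
by rewrite [RHS]cImM !cRe_cpow !cIm_cpow cReD cImD !mulrDl expRD sinD; ring.
Qed.

Lemma cpow0 (t : R) : cpow t 0 = 1.
Proof.
by apply: complex_ext; rewrite ?cRe_cpow ?cIm_cpow cRe0 cIm0 !mul0r expR0 ?cos0 ?sin0 mul1r.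
Qed.

Lemma cpow1 (z : C) : cpow 1 z = 1.
Proof.
by apply: complex_ext; rewrite ?cRe_cpow ?cIm_cpow ln1 !mulr0 expR0 ?cos0 ?sin0 mul1r.
Qed.

Lemma cmod_cpow (t : R) (z : C) : cmod (cpow t z) = expR (cRe z * ln t).
Proof.
rewrite /cpow cmodM cmod_toC gtr0_norm ?expR_gt0 // -[RHS]mulr1; congr (_ * _).
by rewrite /cmod /= cos2Dsin2 sqrtr1.
Qed.

Lemma cpowN1 (t : R) : 0 < t -> cpow t (-1) = toC t^-1.
Proof.
move=> t0; apply: complex_ext; rewrite ?cRe_cpow ?cIm_cpow cReN cImN cRe1 cIm1 oppr0 mul0r.
  by rewrite cos0 mulr1 mulN1r expRN lnK ?posrE.
by rewrite sin0 mulr0.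
Qed.

Lemma cpowB1 (t : R) (z : C) : 0 < t -> cpow t (z - 1) = cpow t z * toC t^-1.
Proof. by move=> t0; rewrite cpowD cpowN1. Qed.

Lemma is_cderive_cpow (z : C) (x : R) : 0 < x ->
  is_cderive (fun t => cpow t z) (fun t => z * cpow t (z - 1)) x.
Proof.
move=> x0; have dl := is_derive1_ln x0.
have dm (a : R) : is_derive x 1 (fun t => a * ln t) (a * x^-1).
  exact: (is_deriveZ a dl).
have de := @is_derive1_comp R expR _ x _ _ (is_derive_expR (cRe z * ln x)) (dm (cRe z)).
have dc := @is_derive1_comp R cos _ x _ _ (is_derive_cos (cIm z * ln x)) (dm (cIm z)).
have ds := @is_derive1_comp R sin _ x _ _ (is_derive_sin (cIm z * ln x)) (dm (cIm z)).
have dE := is_cderive_toC (F := fun t => expR (cRe z * ln t))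
  (f := fun t => expR (cRe z * ln t) * (cRe z * t^-1)) de.
have dU : is_cderive (fun t => (Complex (cos (cIm z * ln t)) (sin (cIm z * ln t)) : C))
    (fun t => (Complex (- sin (cIm z * ln t) * (cIm z * t^-1)) (cos (cIm z * ln t) * (cIm z * t^-1)) : C)) x.
  by split.
apply: eq_is_cderive (is_cderiveM dE dU).
rewrite cpowB1 // /cpow; apply: complex_ext; rewrite !(cReE, cImE) /= /cRe /cIm /=; ring.
Qed.

Definition log_cpow (k : nat) (z : C) (t : R) : C := toC (ln t^-1 ^+ k) * cpow t z.

Lemma log_cpow0 z t : log_cpow 0 z t = cpow t z.
Proof. by rewrite /log_cpow expr0 toC1 mul1r. Qed.

(** For k = 0 the truncated predecessor does no harm, its coefficient being 0. *)
Lemma is_cderive_log_cpow (k : nat) (z : C) (x : R) : 0 < x ->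
  is_cderive (log_cpow k z)
    (fun t => z * log_cpow k (z - 1) t - k%:R * log_cpow k.-1 (z - 1) t) x.
Proof.
move=> x0.
have dl : is_derive x 1 (fun t : R => ln t^-1) (- x^-1).
  have h := is_deriveN (is_derive1_ln x0).
  apply: near_eq_is_derive h; apply: filterS (lt_nbhsr x0) => t t0.
  by rewrite lnV ?posrE.
have dk : is_derive x 1 (fun t : R => ln t^-1 ^+ k) ((k%:R * ln x^-1 ^+ k.-1) *: - x^-1).
  by have := is_deriveX k dl; rewrite exprfctE.
have dK := is_cderive_toC (F := fun t => ln t^-1 ^+ k)
  (f := fun t => (k%:R * ln t^-1 ^+ k.-1) *: (- t^-1)) dk.
apply: eq_is_cderive (is_cderiveM dK (is_cderive_cpow z x0)).
rewrite /log_cpow cpowB1 // /GRing.scale /= !toCM !toCN toC_nat.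
ring.
Qed.

Lemma ccontinuous_log_cpow k z (x : R) : 0 < x -> ccontinuous_at (log_cpow k z) x.
Proof. by move=> x0; exact: is_cderive_continuous (is_cderive_log_cpow k z x0). Qed.

(** A primitive of log(1/t)^k t^(z-1): integration by parts lowers k by one and produces a factor k
    / z. *)
Fixpoint log_cpow_primitive (k : nat) (z : C) (t : R) : C :=
  if k is k'.+1 then z^-1 * (log_cpow k z t + k%:R * log_cpow_primitive k' z t)
  else z^-1 * log_cpow 0 z t.

Lemma is_cderive_log_cpow_primitive k z (x : R) : z != 0 -> 0 < x ->
  is_cderive (log_cpow_primitive k z) (log_cpow k (z - 1)) x.
Proof.
move=> z0 x0; elim: k => [|k ih] /=.
  apply: eq_is_cderive (is_cderiveZ z^-1 (is_cderive_log_cpow 0 z x0)).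
  by rewrite mul0r subr0 mulKf.
apply: eq_is_cderive (is_cderiveZ z^-1
  (is_cderiveD (is_cderive_log_cpow k.+1 z x0) (is_cderiveZ k.+1%:R ih))) => /=.
by rewrite subrK mulKf.
Qed.

Lemma cintegral_log_cpow k z (a : R) : z != 0 -> 0 < a <= 1 ->
  cintegral `[a, 1] (log_cpow k (z - 1)) =
  log_cpow_primitive k z 1 - log_cpow_primitive k z a.
Proof.
move=> z0 /andP[a0 a1]; apply: cFTC => // x /andP[ax _].
  by apply: is_cderive_log_cpow_primitive => //; exact: lt_le_trans ax.
by apply: ccontinuous_log_cpow; exact: lt_le_trans ax.
Qed.

Lemma log_cpow_primitive1 k z : z != 0 ->
  log_cpow_primitive k z 1 = k`!%:R / z ^+ k.+1.
Proof.
move=> z0; elim: k => [|k ih] /=.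
  by rewrite log_cpow0 cpow1 expr1 mulr1 fact0 mul1r.
rewrite ih /log_cpow invr1 ln1 exprS mul0r toC0 mul0r add0r factS natrM [in RHS](exprS z) invfM.
by move: (z ^+ k.+1)^-1 z^-1 => u v; ring.
Qed.

Lemma cmod_log_cpow k z (t : R) : 0 < t <= 1 ->
  cmod (log_cpow k z t) = ln t^-1 ^+ k * expR (- (cRe z * ln t^-1)).
Proof.
move=> /andP[t0 t1]; rewrite /log_cpow cmodM cmod_toC cmod_cpow ger0_norm.
  by rewrite [in RHS]lnV ?posrE // mulrN opprK -lnV ?posrE.
by rewrite exprn_ge0 // ln_ge0 // invf_ge1.
Qed.

(** M is uniform in |z| >= a. Of the powers of 1 / |z| one is kept, for square integrability in z
    along the critical line, and the others are bounded by powers of 1 / a. *)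
Lemma cmod_log_cpow_primitive k (a : R) : 0 < a ->
  exists2 M : R, 0 <= M & forall z (t : R), a <= cmod z -> 0 < t <= 1 ->
    cmod (log_cpow_primitive k z t) <=
    M * (1 + ln t^-1) ^+ k * expR (- (cRe z * ln t^-1)) / cmod z.
Proof.
move=> a0; elim: k => [|k [M M0 ih]].
  exists 1 => // z t za t01 /=; rewrite cmodM cmodV cmod_log_cpow //.
  by rewrite !expr0 !mul1r mulrC.
exists (1 + k.+1%:R * M / a); first by rewrite addr_ge0 ?divr_ge0 ?mulr_ge0 // ltW.
move=> z t za t01 /=; have t0 : 0 < t by case/andP: t01.
have z0 : 0 < cmod z by exact: lt_le_trans za.
have L0 : 0 <= ln t^-1.
  by rewrite ln_ge0 // invf_ge1 //; case/andP: t01.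
rewrite cmodM cmodV [leRHS]mulrC ler_wpM2l ?invr_ge0 ?cmod_ge0 //.
apply: (le_trans (ler_cmodD _ _)).
rewrite cmodM cmod_nat cmod_log_cpow //.
set L := ln _ in L0 *; set e := expR _; have e0 : 0 <= e by exact: expR_ge0.
rewrite mulrDl mul1r mulrDl lerD //.
  by rewrite ler_wpM2r // lerXn2r ?nnegrE ?lerDr ?addr_ge0.
apply: (le_trans (ler_wpM2l _ (ih z t za t01))) => //; rewrite -/L -/e.
have -> : k.+1%:R * M / a * (1 + L) ^+ k.+1 * e =
    k.+1%:R * (M * (1 + L) ^+ k * e / a) * (1 + L) by rewrite exprS; ring.
have P0 : 0 <= M * (1 + L) ^+ k * e by rewrite !mulr_ge0 ?exprn_ge0 // addr_ge0.
have P1 : M * (1 + L) ^+ k * e / cmod z <= M * (1 + L) ^+ k * e / a.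
  by rewrite ler_wpM2l // lef_pV2.
apply: (le_trans (ler_wpM2l _ P1)) => //.
by rewrite ler_peMr ?lerDl // mulr_ge0 // divr_ge0 // ltW.
Qed.

End FundamentalTheorem.

(** * Exhaustion and the integrals of Poisson kernels *)

Section MonotoneExhaustion.
Variable R : realType.
Local Notation C := (Cplx R).
Local Notation RM := (measurableTypeR R).
Local Notation mu := (@lebesgue_measure R).

Lemma rintegrable_integral (D : set RM) (f : R -> R) : measurable D -> rintegrable D f ->
  (\int[mu]_(x in D) (f x)%:E = (Rintegral mu D f)%:E)%E.
Proof. by move=> mD fi; rewrite /Rintegral fineK //; exact: integrable_fin_num. Qed.

(** Monotone convergence: uniform bounds on the pieces, where the integrals come from primitives,
    give integrability on the union together with the same bound. *)
Lemma exhaustion_le (F : nat -> set RM) (f : R -> R) (B : R) :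
  (forall n m, (n <= m)%N -> F n `<=` F m) -> (forall i, measurable (F i)) ->
  (forall i x, F i x -> 0 <= f x) ->
  (forall i, rintegrable (F i) f) -> (forall i, Rintegral mu (F i) f <= B) ->
  rintegrable (\bigcup_i F i) f /\ Rintegral mu (\bigcup_i F i) f <= B.
Proof.
move=> ndF mF f0 fi fB.
have mU : measurable (\bigcup_i F i) by exact: bigcupT_measurable.
have mf : measurable_fun (\bigcup_i F i) f.
  by apply/measurable_fun_bigcup => // i; exact: rintegrable_measurable.
have fU0 x : (\bigcup_i F i) x -> 0 <= f x by move=> [i _ /f0].
have IB : (\int[mu]_(x in \bigcup_i F i) (f x)%:E <= B%:E)%E.
  have h : (\int[mu]_(x in F i) (f x)%:E)%E @[i --> \oo] -->
      (\int[mu]_(x in \bigcup_i F i) (f x)%:E)%E.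
    apply: ge0_nondecreasing_set_cvg_integral => //.
    - by move=> n m nm; rewrite subsetEset; apply: ndF.
    - by move=> i; apply/measurable_EFinP; exact: rintegrable_measurable.
  rewrite -(cvg_lim _ h) //; apply: lime_le; first by apply/cvg_ex; eexists; exact: h.
  by apply: nearW => i; rewrite rintegrable_integral // lee_fin.
have I0 : (0 <= \int[mu]_(x in \bigcup_i F i) (f x)%:E)%E.
  by apply: integral_ge0 => x /fU0; rewrite lee_fin.
have fI : rintegrable (\bigcup_i F i) f.
  apply/integrableP; split; first exact/measurable_EFinP.
  apply: (le_lt_trans _ (ltry B)); apply: le_trans IB.
  rewrite le_eqVlt; apply/orP; left; apply/eqP; apply: eq_integral => x.
  by rewrite inE => /fU0 fx; rewrite /= ger0_norm.
split=> //; by rewrite -lee_fin -rintegrable_integral.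
Qed.

Lemma bigcup_centered (c : R) :
  \bigcup_n (`[c - n%:R, c + n%:R]%classic : set RM) = [set: RM].
Proof.
apply/seteqP; split=> // x _; exists (Num.truncn `|x - c|).+1 => //=.
have := truncnS_gt `|x - c|.
by rewrite in_itv /= ltr_norml => /andP[h1 h2]; lra.
Qed.

Lemma centered_exhaustion_le (c : R) (f : R -> R) (B : R) :
  (forall x, 0 <= f x) ->
  (forall n : nat, rintegrable `[c - n%:R, c + n%:R] f) ->
  (forall n : nat, Rintegral mu `[c - n%:R, c + n%:R] f <= B) ->
  rintegrable setT f /\ Rintegral mu setT f <= B.
Proof.
move=> f0 fi fB; rewrite -[setT](bigcup_centered c); apply: exhaustion_le => //.
move=> n m nm x /=; rewrite !in_itv /= => /andP[h1 h2].
have : n%:R <= m%:R :> R by rewrite ler_nat.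
by lra.
Qed.

Lemma bigcup_unit : \bigcup_n (`[n.+1%:R^-1, 1]%classic : set RM) = `]0, 1]%classic.
Proof.
apply/seteqP; split=> x.
  move=> [n _] /=; rewrite !in_itv /= => /andP[h ->]; rewrite andbT.
  by apply: lt_le_trans h; rewrite invr_gt0.
rewrite /= in_itv /= => /andP[x0 x1]; exists (Num.truncn x^-1) => //=.
rewrite in_itv /= x1 andbT invf_ple ?posrE //; apply/ltW; exact: truncnS_gt.
Qed.

Lemma unit_exhaustion_le (f : R -> R) (B : R) :
  (forall x, 0 < x <= 1 -> 0 <= f x) ->
  (forall n : nat, rintegrable `[n.+1%:R^-1, 1] f) ->
  (forall n : nat, Rintegral mu `[n.+1%:R^-1, 1] f <= B) ->
  rintegrable `]0, 1] f /\ Rintegral mu `]0, 1] f <= B.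
Proof.
move=> f0 fi fB; rewrite -bigcup_unit; apply: exhaustion_le => //.
  move=> n m nm x /=; rewrite !in_itv /= => /andP[h1 ->]; rewrite andbT.
  by apply: le_trans h1; rewrite lef_pV2 ?posrE // ler_nat.
move=> n x /=; rewrite in_itv /= => /andP[h1 h2]; apply: f0; rewrite h2 andbT.
by apply: lt_le_trans h1; rewrite invr_gt0.
Qed.

Lemma Rintegral_support (D E : set RM) (f : R -> R) : E `<=` D ->
  (forall x, D x -> ~ E x -> f x = 0) -> Rintegral mu D f = Rintegral mu E f.
Proof.
move=> ED f0; rewrite [LHS]Rintegral_mkcond [RHS]Rintegral_mkcond; congr (Rintegral mu _ _).
apply/funext => x; rewrite !patchE; case: ifPn; rewrite ?inE ?notin_setE => Dx.
  by case: ifPn; rewrite ?inE ?notin_setE // => /(f0 _ Dx).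
by case: ifPn; rewrite ?inE ?notin_setE // => /ED.
Qed.

Lemma cintegral_support (D E : set RM) (f : R -> C) : E `<=` D ->
  (forall x, D x -> ~ E x -> f x = 0) -> cintegral D f = cintegral E f.
Proof.
move=> ED f0; apply: complex_ext; rewrite ?cRe_cintegral ?cIm_cintegral;
  by apply: Rintegral_support => // x Dx Ex; rewrite f0.
Qed.

Lemma rintegrable_support (D E : set RM) (f : R -> R) : measurable D -> measurable E ->
  E `<=` D -> (forall x, D x -> ~ E x -> f x = 0) -> rintegrable E f -> rintegrable D f.
Proof.
move=> mD mE ED f0 /(integrable_mkcond _ mE) h; apply/integrable_mkcond => //.
move: h; congr (is_true (_.-integrable _ _)); apply/funext => x; rewrite !patchE.
case: ifPn; rewrite ?inE ?notin_setE => Ex; first by rewrite mem_set //; exact: ED.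
by case: ifPn; rewrite ?inE ?notin_setE // => Dx /=; rewrite f0.
Qed.

End MonotoneExhaustion.

(** * Integrals of powers of the Poisson kernel *)

Section PoissonIntegrals.
Variable R : realType.
Local Notation mu := (@lebesgue_measure R).
Variables (a c : R) (a0 : 0 < a).

(** The unnormalised Poisson kernel. With a = 1/2 - Re w and c = Im w it is |s - w|^(-2) on the
    critical line; with a = 1 and c = Im rho it serves as the fixed integrable majorant of the
    remainders. *)
Definition poisson (x : R) : R := (a ^+ 2 + (x - c) ^+ 2)^-1.

Lemma poisson_den_gt0 x : 0 < a ^+ 2 + (x - c) ^+ 2.
Proof. by rewrite ltr_wpDr ?sqr_ge0 // exprn_gt0. Qed.

Lemma poisson_ge0 x : 0 <= poisson x.
Proof. by rewrite invr_ge0 ltW ?poisson_den_gt0. Qed.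

Lemma is_derive_poisson (x : R) :
  is_derive x 1 poisson (- (2 * (x - c) * poisson x ^+ 2)).
Proof.
have dx : is_derive x 1 (fun x : R => x - c) 1.
  have h := is_deriveB (is_derive_id x 1) (is_derive_cst c x 1).
  by apply: (is_derive_eq h); rewrite subr0.
have dq : is_derive x 1 (fun x : R => a ^+ 2 + (x - c) ^+ 2) (2 * (x - c)).
  have h := is_deriveD (is_derive_cst (a ^+ 2) x 1) (is_deriveX 2 dx).
  rewrite exprfctE in h; apply: (is_derive_eq h).
  by rewrite /= /GRing.scale /= expr1; ring.
have h := @is_deriveV _ _ x _ 1 (lt0r_neq0 (poisson_den_gt0 x)) dq.
by apply: (is_derive_eq h); rewrite /poisson exprVn /GRing.scale /=; ring.
Qed.

Lemma is_derive_poissonX (n : nat) (x : R) :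
  is_derive x 1 (fun x => poisson x ^+ n) (- (2 * n%:R * (x - c) * poisson x ^+ n.+1)).
Proof.
have h := is_deriveX n (is_derive_poisson x); rewrite exprfctE in h.
apply: (is_derive_eq h); rewrite /GRing.scale /=.
by case: n {h} => [|n]; rewrite /= ?exprS; ring.
Qed.

Lemma continuous_poissonX n (x : R) : {for x, continuous (fun x => poisson x ^+ n)}.
Proof. exact: is_derive_continuous (is_derive_poissonX n x). Qed.

Lemma measurable_poissonX n : measurable_fun (setT : set (measurableTypeR R)) (fun x => poisson x ^+ n).
Proof. by apply: continuous_measurable_fun => x; exact: continuous_poissonX. Qed.

Definition poisson_integral (n : nat) (T : R) : R :=
  Rintegral mu `[c - T, c + T] (fun x => poisson x ^+ n).

Lemma rintegrable_poissonX n (b d : R) : rintegrable `[b, d] (fun x => poisson x ^+ n).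
Proof. by apply: itv_rintegrable => x _; exact: continuous_poissonX. Qed.

Lemma poisson_integral1 (T : R) : 0 <= T ->
  poisson_integral 1 T = 2 / a * atan (T / a).
Proof.
move=> T0; rewrite /poisson_integral.
transitivity (a^-1 * atan ((c + T - c) / a) - a^-1 * atan ((c - T - c) / a)).
  apply: (@rFTC _ (fun x => a^-1 * atan ((x - c) / a))); [by lra| |]; last first.
    by move=> x _; exact: continuous_poissonX.
  move=> x _.
  have dx : is_derive x 1 (fun x : R => (x - c) / a) a^-1.
    have h := is_deriveZ a^-1 (is_deriveB (is_derive_id x 1) (is_derive_cst c x 1)).
    rewrite subr0 in h; under eq_fun do rewrite mulrC.
    by apply: (is_derive_eq h); rewrite /GRing.scale /= mulr1.
  have h := is_deriveZ a^-1 (@is_derive1_comp R atan _ x _ _ (is_derive1_atan _) dx).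
  apply: (is_derive_eq h); rewrite /GRing.scale /= /poisson expr1.
  by field; rewrite !gt_eqF ?poisson_den_gt0 //= ltr_wpDr ?sqr_ge0.
rewrite (_ : c + T - c = T); last by ring.
rewrite (_ : (c - T - c) / a = - (T / a)); last by ring.
by rewrite atanN; ring.
Qed.

(* Integration of the derivative of (x - c) poisson(x)^(n+1). *)
Lemma poisson_integralS n (T : R) : 0 <= T ->
  (2 * n.+1%:R - 1) * poisson_integral n.+1 T <=
  2 * n.+1%:R * a ^+ 2 * poisson_integral n.+2 T.
Proof.
move=> T0.
have : 0 <= Rintegral mu `[c - T, c + T] (fun x => (1 - 2 * n.+1%:R) * poisson x ^+ n.+1
    + 2 * n.+1%:R * a ^+ 2 * poisson x ^+ n.+2).
  have FTC : Rintegral mu `[c - T, c + T] (fun x => (1 - 2 * n.+1%:R) * poisson x ^+ n.+1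
      + 2 * n.+1%:R * a ^+ 2 * poisson x ^+ n.+2) =
      (c + T - c) * poisson (c + T) ^+ n.+1 - (c - T - c) * poisson (c - T) ^+ n.+1; last first.
    (* Both boundary terms are nonnegative, and dropping them turns the identity into the
       inequality. *)
    rewrite FTC (_ : c + T - c = T); last by ring.
    rewrite (_ : c - T - c = - T); last by ring.
    by rewrite mulNr opprK addr_ge0 // mulr_ge0 // exprn_ge0 // poisson_ge0.
  apply: (@rFTC _ (fun x => (x - c) * poisson x ^+ n.+1)).
  - by lra.
  - move=> x _.
    have dx : is_derive x 1 (fun x : R => x - c) 1.
      have h := is_deriveB (is_derive_id x 1) (is_derive_cst c x 1).
      by apply: (is_derive_eq h); rewrite subr0.
    apply: (is_derive_eq (is_deriveM dx (is_derive_poissonX n.+1 x))).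
    rewrite /GRing.scale /=.
    have e : (x - c) ^+ 2 * poisson x = 1 - a ^+ 2 * poisson x.
      by rewrite /poisson; field; rewrite gt_eqF ?poisson_den_gt0.
    rewrite !exprS; set p := poisson x in e *; set q := p ^+ n.
    have -> : (x - c) * - (2 * n.+1%:R * (x - c) * (p * (p * q))) =
      - (2 * n.+1%:R * ((x - c) ^+ 2 * p) * (p * q)) by ring.
    by rewrite e; ring.
  - move=> x _; apply: cvgD; apply: cvgM; try exact: cvg_cst; exact: continuous_poissonX.
rewrite RintegralD //; try (apply: rintegrableZ => //; exact: rintegrable_poissonX).
rewrite !RintegralZl //; try exact: rintegrable_poissonX.
by rewrite -!/(poisson_integral _ _); lra.
Qed.

(* 'C(2k, k) / (2a)^(2k): the ratio of int poisson^(k+1) to int poisson. *)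
Definition central_weight (k : nat) : R := (2 * k)`!%:R / (k`!%:R ^+ 2 * (2 * a) ^+ (2 * k)).

(** The recursion contributes the factor (2k + 1) / (2 (k + 1) a^2), which is the ratio of
    consecutive weights. *)
Lemma poisson_integral_lower k (T : R) : 0 <= T ->
  central_weight k * (2 / a * atan (T / a)) <= poisson_integral k.+1 T.
Proof.
move=> T0; rewrite -poisson_integral1 //; elim: k => [|k ih].
  by rewrite /central_weight muln0 !fact0 expr0 expr1n mulr1 divr1 mul1r.
have := poisson_integralS k T0; set J := poisson_integral k.+2 T => h.
have k0 : 0 < 2 * k.+1%:R * a ^+ 2 by rewrite !mulr_gt0 // exprn_gt0.
rewrite -(ler_pM2l k0); apply: le_trans h.
have d0 : 0 <= 2 * k.+1%:R - 1 :> R by rewrite -natr1; have := ler0n R k; lra.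
apply: le_trans (ler_wpM2l d0 ih); rewrite (mulrA (2 * k.+1%:R * a ^+ 2)) (mulrA (2 * k.+1%:R - 1)).
suff -> : 2 * k.+1%:R * a ^+ 2 * central_weight k.+1 = (2 * k.+1%:R - 1) * central_weight k by [].
rewrite /central_weight.
have -> : (2 * k.+1)`!%:R = (2 * k%:R + 2) * (2 * k%:R + 1) * (2 * k)`!%:R :> R.
  have -> : (2 * k.+1)%N = (2 * k).+2 by rewrite mulnS.
  rewrite !factS !natrM; have -> : (2 * k).+2%:R = 2 * k%:R + 2 :> R by rewrite -addn2 natrD natrM.
  by have -> : (2 * k).+1%:R = 2 * k%:R + 1 :> R; [rewrite -addn1 natrD natrM|ring].
have -> : (k.+1)`!%:R = (k%:R + 1) * k`!%:R :> R by rewrite factS natrM -natr1.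
have -> : (2 * a) ^+ (2 * k.+1) = (2 * a) ^+ 2 * (2 * a) ^+ (2 * k) by rewrite mulnS exprD.
have -> : k.+1%:R = k%:R + 1 :> R by rewrite natr1.
have f0 : (k`!%:R : R) != 0 by rewrite pnatr_eq0 -lt0n fact_gt0.
have kk : k%:R + 1 != 0 :> R by rewrite natr1 pnatr_eq0.
have aX : (2 * a) ^+ (2 * k) != 0 by rewrite expf_neq0 // mulf_neq0 // gt_eqF.
move: aX f0; move: ((2 * a) ^+ (2 * k)) ((2 * k)`!%:R) (k`!%:R) => X Y Z X0 Z0.
by field; rewrite Z0 X0 kk gt_eqF.
Qed.

Lemma poisson_exhaustion : rintegrable setT poisson /\ Rintegral mu setT poisson <= pi / a.
Proof.
have e : poisson = (fun x => poisson x ^+ 1) by apply/funext => x; rewrite expr1.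
apply: (@centered_exhaustion_le _ c); first exact: poisson_ge0.
  by move=> n; rewrite e; exact: rintegrable_poissonX.
move=> n; rewrite e -/(poisson_integral 1 n%:R) poisson_integral1 //.
have -> : pi / a = 2 / a * (pi / 2) by field; rewrite gt_eqF.
by rewrite ler_wpM2l ?divr_ge0 ?ltW // atan_ltpi2.
Qed.

Lemma rintegrable_poisson_pow k : rintegrable setT (fun x => poisson x ^+ k.+1).
Proof.
have h := rintegrableZ measurableT ((a ^- 2) ^+ k) poisson_exhaustion.1.
apply: (le_rintegrable measurableT _ _ h); first exact: measurable_poissonX.
move=> x _; rewrite ger0_norm ?exprn_ge0 ?poisson_ge0 // exprSr.
have h1 : poisson x <= a ^- 2.
  by rewrite /poisson lef_pV2 ?posrE ?exprn_gt0 ?poisson_den_gt0 // lerDl sqr_ge0.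
rewrite ler_wpM2r ?poisson_ge0 // lerXn2r ?nnegrE ?poisson_ge0 //.
exact: le_trans (poisson_ge0 x) h1.
Qed.

(** Bessel's inequality bounds the transform of psi from above; this is the half of Plancherel for
    psi that it does not give. The value pi / 2 of the arctangent is approached through T = a
    tan(th) with th below pi / 2. *)
Lemma poisson_pow_lower k :
  pi / a * central_weight k <= Rintegral mu setT (fun x => poisson x ^+ k.+1).
Proof.
set J := Rintegral _ _ _.
have w0 : 0 < central_weight k.
  rewrite divr_gt0 ?mulr_gt0 ?exprn_gt0 ?ltr0n ?fact_gt0 //.
  by rewrite mulr_gt0.
have h (th : R) : 0 < th < pi / 2 -> central_weight k * (2 / a * th) <= J.
  move=> /andP[th0 thp]; have thi : th \in `]- (pi / 2), pi / 2[.
    by rewrite in_itv /= thp andbT; have := pi_gt0 R; lra.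
  have T0 : 0 <= a * tan th.
    rewrite mulr_ge0 ?ltW // /tan divr_gt0 //.
      by rewrite sin_gt0_pi // th0; have := pi_gt0 R; lra.
    by rewrite cos_gt0_pihalf // thp andbT; have := pi_gt0 R; lra.
  have := poisson_integral_lower k T0.
  rewrite (_ : a * tan th / a = tan th); last by field; rewrite gt_eqF.
  rewrite tanK // => /le_trans; apply.
  rewrite -lee_fin -!rintegrable_integral //; first last.
  - exact: rintegrable_poissonX.
  - exact: rintegrable_poisson_pow.
  apply: ge0_subset_integral => //.
  - by apply/measurable_EFinP; exact: measurable_poissonX.
  - by move=> x _; rewrite lee_fin exprn_ge0 // poisson_ge0.
apply/ler_addgt0Pr => e e0.
(* At the angle pi / 2 - d the lower bound falls short by d times (2 / a) and the weight, which is
   at most e; d <= pi / 4 keeps the angle positive. *)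
pose d := Num.min (pi / 4) (e / (central_weight k * (2 / a))).
have w2 : 0 < central_weight k * (2 / a) by rewrite mulr_gt0 // divr_gt0.
have d0 : 0 < d by rewrite lt_min; apply/andP; split; rewrite divr_gt0 // pi_gt0.
have d1 : d <= pi / 4 by rewrite ge_min lexx.
have d2 : d * (central_weight k * (2 / a)) <= e.
  by rewrite -ler_pdivlMr // ge_min lexx orbT.
have := h (pi / 2 - d); have := pi_gt0 R => p0.
have -> : 0 < pi / 2 - d < pi / 2 by apply/andP; split; lra.
move=> /(_ isT) hh.
have -> : pi / a * central_weight k = central_weight k * (2 / a * (pi / 2 - d)) +
   d * (central_weight k * (2 / a)) by field; rewrite gt_eqF.
exact: lerD.
Qed.

End PoissonIntegrals.

(** * Truncated Mellin transforms *)

Section MellinOfPsi.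
Variable R : realType.
Local Notation C := (Cplx R).
Local Notation RM := (measurableTypeR R).
Local Notation mu := (@lebesgue_measure R).
Implicit Types (w z : C) (k n : nat).

Local Notation H := (halfline R : set RM).

Lemma measurable_halfline : measurable H.
Proof. exact: measurable_itv. Qed.

Lemma halflineP (t : R) : halfline R t <-> 0 < t.
Proof. by rewrite /halfline /= in_itv /= andbT. Qed.

Lemma cmeasurable_log_cpow k z : cmeasurable H (log_cpow k z).
Proof.
have o : open (halfline R) by exact: interval_open.
have c (t : R) : t \in halfline R -> ccontinuous_at (log_cpow k z) t.
  by rewrite inE => /halflineP; exact: ccontinuous_log_cpow.
by split; apply: open_continuous_measurable_fun => // t /c[].
Qed.

Lemma psiE w k (t : R) : 0 < t <= 1 -> psi w k t = log_cpow k (- w) t.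
Proof. by rewrite /psi => ->. Qed.

Lemma psi0 w k (t : R) : 1 < t -> psi w k t = 0.
Proof. by rewrite /psi ltNge => /negbTE ->; rewrite andbF. Qed.

Lemma cmeasurable_psi w k : cmeasurable H (psi w k).
Proof.
pose U : set RM := `]0, 1]%classic.
have m1 : cmeasurable H (fun t => toC (\1_U t : R)).
  by apply: cmeasurable_toC; apply: measurable_indic; exact: measurable_itv.
have [m2 m3] := cmeasurableM m1 (cmeasurable_log_cpow k (- w)).
have e t : t \in H -> toC (\1_U t : R) * log_cpow k (- w) t = psi w k t.
  rewrite inE => /halflineP t0; rewrite indicE.
  have -> : (t \in U) = (t <= 1) by apply/idP/idP; rewrite inE /U /= in_itv /= t0.
  have [t1|t1] := leP t 1; first by rewrite toC1 mul1r psiE ?t0.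
  by rewrite toC0 mul0r psi0.
by split; [apply: eq_measurable_fun m2|apply: eq_measurable_fun m3] => t /e <-.
Qed.

Lemma log_cpow_primitive_real k (b t : R) : 0 < b -> 0 < t <= 1 ->
  exists2 x : R, 0 <= x & log_cpow_primitive k (toC b) t = toC x.
Proof.
move=> b0 t01; have t0 : 0 < t by case/andP: t01.
have L0 : 0 <= ln t^-1 by rewrite ln_ge0 // invf_ge1 //; case/andP: t01.
have cp j : log_cpow j (toC b) t = toC (ln t^-1 ^+ j * expR (b * ln t)).
  rewrite /log_cpow toCM; congr (_ * _); apply: complex_ext.
    by rewrite cRe_cpow cIm_toC mul0r cos0 mulr1.
  by rewrite cIm_cpow cIm_toC mul0r sin0 mulr0.
have b1 : 0 <= b^-1 by rewrite invr_ge0 ltW.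
have c0 j : 0 <= ln t^-1 ^+ j * expR (b * ln t) by rewrite mulr_ge0 ?exprn_ge0 ?expR_ge0.
elim: k => [|k [x x0 ih]] /=; rewrite cp -toCV.
  exists (b^-1 * (ln t^-1 ^+ 0 * expR (b * ln t))); first exact: mulr_ge0 b1 (c0 0%N).
  by rewrite [RHS]toCM.
exists (b^-1 * (ln t^-1 ^+ k.+1 * expR (b * ln t) + k.+1%:R * x)).
  apply: (mulr_ge0 b1); apply: (addr_ge0 (c0 k.+1)); exact: mulr_ge0.
by rewrite ih [RHS]toCM toCD (toCM _ x) toC_nat.
Qed.

(** The square stays in the same family, with 2k for k and z = 1 - 2 Re w in the exponent z - 1, so
    the same primitive computes the norm. *)
Lemma sqr_cmod_log_cpow k w (t : R) : 0 < t <= 1 ->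
  cmod (log_cpow k (- w) t) ^+ 2 =
  cRe (log_cpow (2 * k) (toC (1 - 2 * cRe w) - 1) t).
Proof.
move=> t01; have t0 : 0 < t by case/andP: t01.
rewrite cmod_log_cpow // /log_cpow cReM cRe_toC cIm_toC mul0r subr0 cRe_cpow.
rewrite cReB cImB cRe_toC cIm_toC cRe1 cIm1 subr0 mul0r cos0 mulr1 cReN.
rewrite exprMn -exprM (mulnC k); congr (_ * _).
by rewrite expr2 -expRD; congr expR; rewrite lnV ?posrE //; ring.
Qed.

Lemma itv_sqint (f : R -> C) (a b : R) :
  (forall x, a <= x <= b -> ccontinuous_at f x) ->
  square_integrable (`[a, b]%classic : set RM) f.
Proof.
move=> c; have [i1 i2] := itv_cintegrable c.
apply/sqintP; split; first by split; exact: rintegrable_measurable.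
have -> : (fun t => cmod (f t) ^+ 2) = (fun t => cRe (f t) ^+ 2 + cIm (f t) ^+ 2).
  by apply/funext => t; rewrite sqr_cmod.
apply: itv_rintegrable => t /c[c1 c2].
by apply: cvgD; apply: cvgM.
Qed.

Lemma rintegrable_sqr_log_cpow k w (b : R) : 0 < b ->
  rintegrable `[b, 1] (fun t => cmod (log_cpow k (- w) t) ^+ 2).
Proof.
move=> b0; have /sqintP[] // : square_integrable (`[b, 1]%classic : set RM) (log_cpow k (- w)).
apply: itv_sqint => t /andP[bt _]; apply: ccontinuous_log_cpow.
exact: lt_le_trans bt.
Qed.

(** The bound is the value at 1 of the primitive of log(1/t)^(2k) t^(-2 Re w); the value at the
    lower endpoint has the favourable sign. *)
Lemma psi_square_integrable w k : cRe w < 2^-1 -> square_integrable H (psi w k) /\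
  sqnrm H (psi w k) <= (2 * k)`!%:R / (1 - 2 * cRe w) ^+ (2 * k).+1.
Proof.
move=> w2; have a0 : 0 < 1 - 2 * cRe w by lra.
have ta0 : toC (1 - 2 * cRe w) != 0 :> C.
  by apply: contraTneq a0 => /toC_inj ->; rewrite ltxx.
have [||n|fi fB] := @unit_exhaustion_le R (fun t => cmod (log_cpow k (- w) t) ^+ 2)
    ((2 * k)`!%:R / (1 - 2 * cRe w) ^+ (2 * k).+1).
- by move=> t _; exact: sqr_ge0.
- by move=> n; apply: rintegrable_sqr_log_cpow; rewrite invr_gt0.
- have n01 : 0 < (n.+1%:R^-1 : R) <= 1 by rewrite invr_gt0 ltr0Sn /= invf_le1 // ler1n.
  have -> : Rintegral mu `[n.+1%:R^-1, 1] (fun t => cmod (log_cpow k (- w) t) ^+ 2) =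
      cRe (cintegral `[n.+1%:R^-1, 1] (log_cpow (2 * k) (toC (1 - 2 * cRe w) - 1))).
    rewrite cRe_cintegral; apply: eq_Rintegral => t; rewrite inE /= in_itv /= => /andP[h1 h2].
    apply: sqr_cmod_log_cpow; rewrite h2 andbT.
    by apply: lt_le_trans h1; rewrite invr_gt0.
  rewrite cintegral_log_cpow // log_cpow_primitive1 //.
  have [x x0 ->] := log_cpow_primitive_real (2 * k) a0 n01.
  rewrite -toCX -toCV -toC_nat -toCM -toCB cRe_toC.
  by rewrite lerBlDr lerDl.
have sub : (`]0, 1]%classic : set RM) `<=` H.
  by move=> t /=; rewrite in_itv /= => /andP[t0 _]; apply/halflineP.
have off t : H t -> ~ (`]0, 1]%classic : set RM) t -> cmod (psi w k t) ^+ 2 = 0.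
  move=> /halflineP t0 /negP; rewrite /= in_itv /= t0 /= -ltNge => t1.
  by rewrite psi0 // cmod0 expr0n.
have on t : t \in (`]0, 1]%classic : set RM) ->
    cmod (log_cpow k (- w) t) ^+ 2 = cmod (psi w k t) ^+ 2.
  by rewrite inE /= in_itv /= => t01; rewrite psiE.
split.
  apply/sqintP; split; first exact: cmeasurable_psi.
  apply: (rintegrable_support measurable_halfline _ sub off) => //.
  by apply: eq_integrable fi => // t /on /= ->.
rewrite /sqnrm (Rintegral_support sub off); apply: le_trans fB.
by rewrite le_eqVlt; apply/orP; left; apply/eqP; apply: eq_Rintegral => t /on ->.
Qed.

Definition trunc_itv n : set RM := `[n.+1%:R^-1, n.+1%:R]%classic.

Lemma trunc_itv_sub n : trunc_itv n `<=` H.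
Proof.
move=> t /=; rewrite /trunc_itv /= in_itv /= => /andP[h _]; apply/halflineP.
by apply: lt_le_trans h; rewrite invr_gt0.
Qed.

Lemma measurable_trunc_itv n : measurable (trunc_itv n).
Proof. exact: measurable_itv. Qed.

Lemma inK_trunc (f : R -> C) n : inK f -> square_integrable (trunc_itv n) f.
Proof.
exact: sqint_sub measurable_halfline (measurable_trunc_itv n) (@trunc_itv_sub n).
Qed.

Lemma cpow_log_cpow z : log_cpow 0 z = (fun t => cpow t z).
Proof. by apply/funext => t; exact: log_cpow0. Qed.

Lemma sqint_cpow n z : square_integrable (trunc_itv n) (fun t => cpow t z).
Proof.
rewrite -cpow_log_cpow.
apply: itv_sqint => t /andP[bt _]; apply: ccontinuous_log_cpow.
by apply: lt_le_trans bt; rewrite invr_gt0.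
Qed.

Lemma trunc_cintegrable (f : R -> C) n z : inK f ->
  cintegrable (trunc_itv n) (fun t => f t * cpow t z).
Proof.
move=> /(inK_trunc n) fi.
have h := sqint_cmulJ (measurable_trunc_itv n) fi (sqint_cpow n (cconj z)).
by apply: (eq_cintegrable (measurable_trunc_itv n) _ h) => t _; rewrite cpow_conj cconjK.
Qed.

(** Dominated convergence: on the critical line |t^(s-1)| does not depend on the height, so |f|^2 +
    |t^(s-1)|^2 is one majorant for all x. Continuity yields measurability and allows the shifts in
    the proof of Bessel's inequality. *)
Lemma ccontinuous_trunc (f : R -> C) n (x0 : R) : inK f ->
  ccontinuous_at (fun x : R => mellin_trunc f n (critical x)) x0.
Proof.
move=> fK; have fi := inK_trunc n fK.
pose g t := cmod (f t) ^+ 2 + cmod (cpow t (critical 0 - 1)) ^+ 2.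
have gi : rintegrable (trunc_itv n) g.
  have /sqintP[_ h1] := fi; have /sqintP[_ h2] := sqint_cpow n (critical 0 - 1).
  by apply: rintegrableD => //; exact: measurable_trunc_itv.
have gE (x t : R) : cmod (f t * cpow t (critical x - 1)) <= g t.
  rewrite cmodM /g !cmod_cpow !cReB /cRe /=.
  move: (expR _) (expR_ge0 ((2^-1 - 1) * ln t : R)) (cmod_ge0 (f t)) => a b c.
  by have := sqr_ge0 (cmod (f t) - a); nra.
have key (F : R -> R -> R) :
    (forall x, rintegrable (trunc_itv n) (F x)) ->
    (forall t, continuous (F ^~ t)) -> (forall x t, `|F x t| <= g t) ->
    continuous (fun x => Rintegral mu (trunc_itv n) (F x)).
  move=> Fi Fc Fg x.
  have := @continuity_under_integral R _ _ mu F (trunc_itv n) (measurable_trunc_itv n)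
    (x - 1) (x + 1) (fun y _ => Fi y) _ g gi _ x.
  apply.
  - by apply: aeW => t _ y _; exact: Fc.
  - by move=> y _; apply: aeW => t _; exact: Fg.
  - by rewrite inE /= in_itv /=; lra.
have c1 (b : R) : continuous (fun x : R => cos (x * b)).
  move=> x; apply: continuous_comp; last exact: continuous_cos.
  by apply: cvgM; [exact: cvg_id|exact: cvg_cst].
have c2 (b : R) : continuous (fun x : R => sin (x * b)).
  move=> x; apply: continuous_comp; last exact: continuous_sin.
  by apply: cvgM; [exact: cvg_id|exact: cvg_cst].
split.
  apply: (key (fun x t => cRe (f t * cpow t (critical x - 1)))).
  - by move=> x; have [] := trunc_cintegrable n (critical x - 1) fK.
  - move=> t x.
    under eq_fun do rewrite cReM cRe_cpow cIm_cpow cReB cImB /= subr0.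
    by apply: cvgB; apply: cvgM; try exact: cvg_cst; apply: cvgM;
      try exact: cvg_cst; [exact: c1|exact: c2].
  - by move=> x t; exact: le_trans (normr_cRe _) (gE x t).
apply: (key (fun x t => cIm (f t * cpow t (critical x - 1)))).
- by move=> x; have [] := trunc_cintegrable n (critical x - 1) fK.
- move=> t x.
  under eq_fun do rewrite cImM cRe_cpow cIm_cpow cReB cImB /= subr0.
  by apply: cvgD; apply: cvgM; try exact: cvg_cst; apply: cvgM;
    try exact: cvg_cst; [exact: c2|exact: c1].
- by move=> x t; exact: le_trans (normr_cIm _) (gE x t).
Qed.

Lemma cmeasurable_trunc (f : R -> C) n : inK f ->
  cmeasurable (setT : set RM) (fun x : R => mellin_trunc f n (critical x)).
Proof.
by move=> fK; split; apply: continuous_measurable_fun => x;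
  have [] := ccontinuous_trunc n x fK.
Qed.

End MellinOfPsi.

(** * Mellin transform of psi *)

Section MellinPairs.
Variable R : realType.
Local Notation C := (Cplx R).
Local Notation RM := (measurableTypeR R).
Local Notation mu := (@lebesgue_measure R).
Local Notation H := (halfline R : set RM).
Local Notation L := (setT : set RM).
Implicit Types (w z : C) (k n : nat) (f g : R -> C) (F G : C -> C).

Lemma ge0_cvge0P (T : Type) (E : set_system T) (FE : Filter E) (r : T -> R) :
  (forall x, 0 <= r x) ->
  ((r x)%:E @[x --> E] --> (0 : \bar R)) <->
  (forall e : R, 0 < e -> \forall x \near E, r x < e).
Proof.
move=> r0; split=> [h e e0|h].
  have /cvgrPdist_lt/(_ e e0) : r x @[x --> E] --> (0 : R).
    exact: (@fine_cvg R T E FE (fun x => (r x)%:E) 0 h).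
  by apply: filterS => x; rewrite sub0r normrN ger0_norm.
have : r x @[x --> E] --> (0 : R).
  apply/cvgrPdist_lt => e e0; apply: filterS (h e e0) => x.
  by rewrite sub0r normrN ger0_norm.
by move=> hr; apply: cvg_EFin => //; exact: nearW.
Qed.

Lemma mellin_error_cvgP (u : nat -> R -> C) : (forall n, square_integrable L (u n)) ->
  ((2 * pi)^-1%:E * sqnorm L (u n))%E @[n --> \oo] --> (0 : \bar R) <->
  forall e : R, 0 < e -> \forall n \near \oo, sqnrm L (u n) < e.
Proof.
move=> ui; have p0 : 0 < (2 * pi : R)^-1 by rewrite invr_gt0 mulr_gt0 // pi_gt0.
under eq_fun do rewrite sqnormE // -EFinM.
rewrite ge0_cvge0P; last by move=> n; rewrite mulr_ge0 ?sqnrm_ge0 // ltW.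
split=> h e e0.
  apply: filterS (h ((2 * pi)^-1 * e) (mulr_gt0 p0 e0)) => n.
  by rewrite ltr_pM2l.
have := h (e / (2 * pi)^-1); rewrite divr_gt0 // => /(_ isT); apply: filterS => n.
by rewrite ltr_pdivlMr // mulrC.
Qed.

(** A relation and not a function of f, since F is determined only on the critical line and up to a
    null set. *)
Definition mellin_pair f F := inK f /\ is_mellin f F.

Lemma mellin_pair_sqint f F : mellin_pair f F ->
  square_integrable L (fun x => F (critical x)).
Proof. by move=> [_ []]. Qed.

End MellinPairs.

(** * The transform of psi: closed form, norm and convergence *)

Section MellinPsi.
Variable R : realType.
Local Notation C := (Cplx R).
Local Notation RM := (measurableTypeR R).
Local Notation mu := (@lebesgue_measure R).
Local Notation H := (halfline R : set RM).
Local Notation L := (setT : set RM).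
Variables (w : C) (w2 : cRe w < 2^-1).
Local Notation a := (2^-1 - cRe w).
Implicit Types (k n : nat).

Definition psi_mellin k (s : C) : C := k`!%:R / (s - w) ^+ k.+1.

Let a0 : 0 < a. Proof. by rewrite subr_gt0. Qed.

Lemma cRe_criticalB (x : R) : cRe (critical x - w) = a.
Proof. by rewrite cReB. Qed.

Lemma sqr_cmod_criticalB (x : R) : cmod (critical x - w) ^+ 2 = (poisson a (cIm w) x)^-1.
Proof. by rewrite sqr_cmod cReB cImB /poisson invrK. Qed.

Lemma criticalB_neq0 (x : R) : critical x - w != 0.
Proof. by apply: contraTneq a0 => h; rewrite -(cRe_criticalB x) h ltxx. Qed.

Lemma cmod_criticalB_ge (x : R) : a <= cmod (critical x - w).
Proof. by rewrite -(cRe_criticalB x); exact: le_trans (ler_norm _) (normr_cRe _). Qed.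

Lemma sqr_cmod_psi_mellin k (x : R) :
  cmod (psi_mellin k (critical x)) ^+ 2 = k`!%:R ^+ 2 * poisson a (cIm w) x ^+ k.+1.
Proof.
rewrite cmodM cmod_nat cmodV cmodX exprMn; congr (_ * _).
by rewrite exprVn -exprM mulnC exprM sqr_cmod_criticalB exprVn invrK.
Qed.

Lemma cmeasurable_psi_mellin k : cmeasurable L (fun x => psi_mellin k (critical x)).
Proof.
have m1 : cmeasurable L (fun x => (critical x - w)^-1).
  have e x : (critical x - w)^-1 = cconj (critical x - w) * toC (poisson a (cIm w) x).
    apply: (mulfI (criticalB_neq0 x)); rewrite divff ?criticalB_neq0 //.
    by rewrite mulrA mulr_cconj sqr_cmod_criticalB -toCM mulVf // gt_eqF // invr_gt0 poisson_den_gt0.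
  under eq_fun do rewrite e.
  apply: cmeasurableM.
    apply: cmeasurable_conj; split.
      by under eq_fun do rewrite cRe_criticalB; exact: measurable_cst.
    under eq_fun do rewrite cImB; apply: measurable_funB; last exact: measurable_cst.
    exact: measurable_id.
  apply: cmeasurable_toC.
  have := measurable_poissonX (cIm w) a0 1.
  by under eq_fun do rewrite expr1.
rewrite /psi_mellin; apply: cmeasurableM; first exact: cmeasurable_cst.
elim: k.+1 => [|n ih].
  by under eq_fun do rewrite expr0 invr1; exact: cmeasurable_cst.
by under eq_fun do rewrite exprS invfM; exact: cmeasurableM.
Qed.

Lemma sqint_psi_mellin k : square_integrable L (fun x => psi_mellin k (critical x)).
Proof.
apply: (le_sqint measurableT (cmeasurable_psi_mellin k)
  (rintegrableZ measurableT (k`!%:R ^+ 2) (rintegrable_poisson_pow (cIm w) a0 k))).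
by move=> x _; rewrite sqr_cmod_psi_mellin.
Qed.

(** The upper bound for the left side and the lower bound for the right side are the same number, 2
    pi (2k)! / (2a)^(2k+1). *)
Lemma sqnrm_psi_le k : 2 * pi * sqnrm H (psi w k) <=
  sqnrm L (fun x => psi_mellin k (critical x)).
Proof.
have [_ h1] := psi_square_integrable k w2.
have h2 := poisson_pow_lower (cIm w) a0 k.
have -> : sqnrm L (fun x => psi_mellin k (critical x)) =
    k`!%:R ^+ 2 * Rintegral mu L (fun x => poisson a (cIm w) x ^+ k.+1).
  rewrite -RintegralZl //; last exact: rintegrable_poisson_pow.
  by apply: eq_Rintegral => x _; rewrite sqr_cmod_psi_mellin.
apply: le_trans (ler_wpM2l (sqr_ge0 _) h2).
apply: (le_trans (ler_wpM2l _ h1)); first by rewrite mulr_ge0 // ltW // pi_gt0.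
rewrite /central_weight.
have -> : 1 - 2 * cRe w = 2 * a by field.
have k0 : (k`!%:R : R) != 0 by rewrite pnatr_eq0 -lt0n fact_gt0.
have X0 : (2 * a) ^+ (2 * k) != 0 by rewrite expf_neq0 // mulf_neq0 // gt_eqF.
rewrite (exprS _ (2 * k)) le_eqVlt; apply/orP; left; apply/eqP.
move: X0; move: ((2 * a) ^+ (2 * k)) ((2 * k)`!%:R) => X Y X0.
have := a0; move: (2^-1 - cRe w) => b b0.
by field; rewrite X0 k0 gt_eqF.
Qed.

Lemma polynomial_le_exp k (b : R) : 0 < b ->
  exists2 K : R, 0 <= K & forall x, 0 <= x -> (1 + x) ^+ k <= K * expR (b * x).
Proof.
elim: k b => [b b0|k ih b b0].
  by exists 1 => // x x0; rewrite expr0 mul1r -[leLHS]expR0 ler_expR mulr_ge0 // ltW.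
have [K K0 hK] := ih _ (divr_gt0 b0 (ltr0Sn R 1)).
have c0 : 0 < 2 / b by rewrite divr_gt0.
exists (K * (1 + 2 / b)); first by rewrite mulr_ge0 // addr_ge0 // ltW.
move=> x x0; rewrite exprSr.
have -> : K * (1 + 2 / b) * expR (b * x) =
    K * expR (b / 2 * x) * ((1 + 2 / b) * expR (b / 2 * x)).
  have -> : b * x = b / 2 * x + b / 2 * x by field.
  by rewrite expRD; ring.
apply: ler_pM; rewrite ?exprn_ge0 ?addr_ge0 ?hK //.
have h1 := expR_ge1Dx (b / 2 * x).
have h2 : 0 <= b / 2 * x by rewrite mulr_ge0 // ltW // divr_gt0.
have h3 : x = 2 / b * (b / 2 * x) by field; rewrite gt_eqF.
have : 2 / b * (b / 2 * x) <= 2 / b * expR (b / 2 * x) by rewrite ler_wpM2l ?ltW //; lra.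
by rewrite -h3; lra.
Qed.

Lemma mellin_trunc_psi k n (x : R) : mellin_trunc (psi w k) n (critical x) =
  psi_mellin k (critical x) - log_cpow_primitive k (critical x - w) n.+1%:R^-1.
Proof.
have n01 : 0 < (n.+1%:R^-1 : R) <= 1 by rewrite invr_gt0 ltr0Sn /= invf_le1 // ler1n.
rewrite /mellin_trunc /psi_mellin -(log_cpow_primitive1 _ (criticalB_neq0 x)).
rewrite -(cintegral_log_cpow k (criticalB_neq0 x) n01).
rewrite (@cintegral_support _ _ (`[n.+1%:R^-1, 1]%classic : set RM)).
- apply: eq_cintegral => t /=; rewrite in_itv /= => /andP[t1 t2].
  have t0 : 0 < t by apply: lt_le_trans t1; rewrite invr_gt0.
  rewrite psiE ?t0 // /log_cpow -mulrA -cpowD; congr (_ * cpow _ _).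
  by ring.
- move=> t /=; rewrite !in_itv /= => /andP[-> t2] /=; apply: (le_trans t2).
  by rewrite ler1n.
- move=> t /=; rewrite !in_itv /= => /andP[-> _] /= /negP; rewrite -ltNge => t1.
  by rewrite psi0 // mul0r.
Qed.

(** With l = ln(n + 1), the truncation error at s is at most M (1 + l)^k exp(- a l) / |s - w|. After
    squaring, one factor exp(- a l) absorbs the power of 1 + l, the other tends to 0, and the
    Poisson kernel remains to be integrated. *)
Lemma psi_mellin_pair k : mellin_pair (psi w k) (psi_mellin k).
Proof.
have [pK _] := psi_square_integrable k w2.
split=> //; split; first exact: sqint_psi_mellin.
have [M M0 hM] := cmod_log_cpow_primitive k a0.
have [K K0 hK] := polynomial_le_exp (2 * k) a0.
have [pi1 pi2] := poisson_exhaustion (cIm w) a0.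
have ub n (x : R) : cmod (mellin_trunc (psi w k) n (critical x) - psi_mellin k (critical x)) ^+ 2 <=
    M ^+ 2 * K * expR (- (a * ln n.+1%:R)) * poisson a (cIm w) x.
  have n01 : 0 < (n.+1%:R^-1 : R) <= 1 by rewrite invr_gt0 ltr0Sn /= invf_le1 // ler1n.
  rewrite mellin_trunc_psi addrAC subrr add0r cmodN.
  have := hM _ _ (cmod_criticalB_ge x) n01; rewrite cRe_criticalB invrK.
  set l := ln _; have l0 : 0 <= l by rewrite ln_ge0 // ler1n.
  move=> h; have /le_trans -> // : cmod (log_cpow_primitive k (critical x - w) n.+1%:R^-1) ^+ 2 <=
      (M * (1 + l) ^+ k * expR (- (a * l)) / cmod (critical x - w)) ^+ 2.
    rewrite lerXn2r ?nnegrE ?cmod_ge0 //.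
    by rewrite !mulr_ge0 ?exprn_ge0 ?addr_ge0 ?expR_ge0 ?invr_ge0 ?cmod_ge0.
  rewrite exprMn exprVn sqr_cmod_criticalB invrK ler_wpM2r ?poisson_ge0 //.
  set X := (1 + l) ^+ k; set E := expR _.
  have -> : (M * X * E) ^+ 2 = M ^+ 2 * (X ^+ 2 * E * E) by ring.
  rewrite -(mulrA (M ^+ 2)) (ler_wpM2l (sqr_ge0 M)) // ler_wpM2r ?expR_ge0 //.
  have := ler_wpM2r (expR_ge0 (- (a * l))) (hK l l0).
  by rewrite -mulrA -expRD subrr expR0 mulr1 mulnC exprM.
have mt n : cmeasurable L (fun x => mellin_trunc (psi w k) n (critical x) - psi_mellin k (critical x)).
  have m1 := cmeasurable_trunc n pK.
  have m2 := cmeasurableM (cmeasurable_cst L (-1)) (cmeasurable_psi_mellin k).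
  have := cmeasurableD m1 m2.
  by under eq_fun do rewrite mulN1r.
have ui n := le_sqint measurableT (mt n) (rintegrableZ measurableT (M ^+ 2 * K * expR (- (a * ln n.+1%:R))) pi1) (fun x _ => ub n x).
apply/mellin_error_cvgP => // e e0.
pose B := M ^+ 2 * K * (pi / a) + 1.
have B0 : 0 < B by rewrite ltr_wpDl // !mulr_ge0 ?sqr_ge0 ?invr_ge0 ?pi_ge0 // ltW.
(* This makes a ln(n + 1) exceed B / e; then exp(a l) >= 1 + a l is enough to bring the error below
   e. *)
exists (Num.truncn (expR (B / e / a))) => // n /= Nn.
have nl : B / e / a < ln n.+1%:R.
  rewrite -[ltLHS]expRK ltr_ln ?posrE ?expR_gt0 //.
  by apply: lt_le_trans (truncnS_gt _) _; rewrite ler_nat.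
apply: (le_lt_trans (le_sqnrm measurableT (mt n) (rintegrableZ measurableT (M ^+ 2 * K * expR (- (a * ln n.+1%:R))) pi1) (fun x _ => ub n x))).
rewrite RintegralZl //.
have hp : 0 <= M ^+ 2 * K * expR (- (a * ln n.+1%:R)) by rewrite !mulr_ge0 ?sqr_ge0 ?expR_ge0.
apply: (le_lt_trans (ler_wpM2l hp pi2)).
have al : B / e < a * ln n.+1%:R by rewrite (mulrC a) -ltr_pdivrMr.
rewrite expRN.
have e1 := expR_ge1Dx (a * ln n.+1%:R).
have E0 : 0 < expR (a * ln n.+1%:R) by exact: expR_gt0.
rewrite mulrAC ltr_pdivrMr //.
have : B < e * (a * ln n.+1%:R) by rewrite (mulrC e) -ltr_pdivrMr.
have : e * (a * ln n.+1%:R) <= e * expR (a * ln n.+1%:R) by rewrite ler_wpM2l ?ltW //; lra.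
by rewrite /B; lra.
Qed.

End MellinPsi.

(** * Bessel's inequality for the Mellin transform *)

Section FiniteBessel.
Variable R : realType.
Local Notation C := (Cplx R).
Variables (D : set (measurableTypeR R)) (mD : measurable D).
Implicit Types (f g h : R -> C).

Definition dot f g : C := cintegral D (fun t => f t * cconj (g t)).

Lemma dot_conj f g : square_integrable D f -> square_integrable D g ->
  dot g f = cconj (dot f g).
Proof.
move=> fi gi; rewrite /dot -(cintegral_conj mD (sqint_cmulJ mD fi gi)).
by apply: eq_cintegral => t _; rewrite conjcM cconjK mulrC.
Qed.

Lemma dot_suml (J : nat) (b : 'I_J -> C) (e : 'I_J -> R -> C) g :
  (forall i, square_integrable D (e i)) -> square_integrable D g ->
  dot (fun t => \sum_(i < J) b i * e i t) g = \sum_(i < J) b i * dot (e i) g.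
Proof.
move=> ei gi; rewrite /dot.
have ii i : cintegrable D (fun t => e i t * cconj (g t)) by exact: sqint_cmulJ.
rewrite (@eq_cintegral _ _ _ (fun t => \sum_(i < J) b i * (e i t * cconj (g t)))).
  rewrite cintegral_sum //; last by move=> i; exact: cintegrableZ.
  by apply: eq_bigr => i _; rewrite cintegralZ.
by move=> t _; rewrite mulr_suml; apply: eq_bigr => i _; rewrite mulrA.
Qed.

Lemma sqnrmB_dot f g : square_integrable D f -> square_integrable D g ->
  toC (sqnrm D (fun t => f t - g t)) =
  toC (sqnrm D f) - dot f g - dot g f + toC (sqnrm D g).
Proof.
move=> fi gi.
have i1 := sqint_cmulJ mD fi fi; have i2 := sqint_cmulJ mD fi gi.
have i3 := sqint_cmulJ mD gi fi; have i4 := sqint_cmulJ mD gi gi.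
rewrite -!(dot_self mD) /dot.
have j2 := cintegrableZ mD (-1) i2; have j3 := cintegrableZ mD (-1) i3.
rewrite -(mulN1r (cintegral D (fun t => f t * cconj (g t)))).
rewrite -(mulN1r (cintegral D (fun t => g t * cconj (f t)))).
rewrite -(cintegralZ mD _ i2) -(cintegralZ mD _ i3).
rewrite -(cintegralD mD i1 j2) -(cintegralD mD (cintegrableD mD i1 j2) j3).
rewrite -(cintegralD mD (cintegrableD mD (cintegrableD mD i1 j2) j3) i4).
by apply: eq_cintegral => t _; rewrite conjcB; ring.
Qed.

(** Nonnegativity of |f - E|^2 for the orthogonal projection E of f on the span of the e i. The
    system is left unnormalised, with common square norm l. *)
Lemma bessel_finite (J : nat) (e : 'I_J -> R -> C) (l : R) f : 0 < l ->
  square_integrable D f -> (forall i, square_integrable D (e i)) ->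
  (forall i j, dot (e i) (e j) = if i == j then toC l else 0) ->
  \sum_(i < J) cmod (dot f (e i)) ^+ 2 <= l * sqnrm D f.
Proof.
move=> l0 fi ei eo; pose b i := dot f (e i) / toC l.
have tl0 : toC l != 0 :> C by apply: contraTneq l0 => /toC_inj ->; rewrite ltxx.
pose E t := \sum_(i < J) b i * e i t.
have Ei : square_integrable D E by apply: sqint_sum => // i; exact: sqintZ.
pose S := \sum_(i < J) cmod (b i) ^+ 2.
have bS : \sum_(i < J) b i * (cconj (b i) * toC l) = toC (l * S).
  rewrite /S mulr_sumr (big_morph (@toC R) (@toCD R) (toC0 R)).
  apply: eq_bigr => i _; rewrite mulrA mulr_cconj -toCM mulrC.
  by [].
have fe i : dot f (e i) = b i * toC l by rewrite /b mulfVK.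
have dEf : dot E f = toC (l * S).
  rewrite dot_suml // -bS; apply: eq_bigr => i _.
  by rewrite (dot_conj fi (ei i)) fe conjcM cconj_toC.
have dfE : dot f E = toC (l * S) by rewrite (dot_conj Ei fi) dEf cconj_toC.
have dEe i : dot E (e i) = b i * toC l.
  rewrite dot_suml // (bigD1 i) //= eo eqxx big1 ?addr0 // => j ji.
  by rewrite eo (negbTE ji) mulr0.
have nE : toC (sqnrm D E) = toC (l * S).
  rewrite -(dot_self mD) -/(dot E E) dot_suml // -bS; apply: eq_bigr => i _.
  by rewrite (dot_conj Ei (ei i)) dEe conjcM cconj_toC.
have := sqnrmB_dot fi Ei; rewrite dEf dfE nE.
rewrite -toCB -toCB -toCD => /toC_inj eq.
have := sqnrm_ge0 D (fun t => f t - E t); rewrite eq => h.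
have -> : \sum_(i < J) cmod (dot f (e i)) ^+ 2 = l * (l * S).
  rewrite mulrA /S mulr_sumr; apply: eq_bigr => i _.
  by rewrite fe cmodM cmod_toC gtr0_norm // exprMn mulrC.
by rewrite ler_pM2l //; lra.
Qed.

End FiniteBessel.

(** * Bessel's inequality for truncated and full transforms *)

Section MellinBessel.
Variable R : realType.
Local Notation C := (Cplx R).
Local Notation RM := (measurableTypeR R).
Local Notation mu := (@lebesgue_measure R).
Local Notation H := (halfline R : set RM).
Local Notation L := (setT : set RM).

Lemma sin_natpi (n : nat) : sin (n%:R * pi : R) = 0.
Proof.
elim: n => [|n ih]; first by rewrite mul0r sin0.
by rewrite -natr1 mulrDl mul1r sinDpi ih oppr0.
Qed.

Lemma Rintegral_shift (q : R -> R) (a b d : R) : a <= b -> continuous q ->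
  Rintegral mu `[a + d, b + d] q = Rintegral mu `[a, b] (fun x => q (x + d)).
Proof.
move=> ab cq; have dF (x : R) : is_derive x 1 (fun x => x + d) 1.
  have h := is_deriveD (is_derive_id x 1) (is_derive_cst d x 1).
  by apply: (is_derive_eq h); rewrite addr0.
have F1 : derive1 (fun x : R => x + d) = cst 1.
  by apply/funext => x; rewrite derive1E; have [] := dF x.
have cF x : {for x, continuous (fun x : R => x + d)} by exact: is_derive_continuous (dF x).
rewrite /Rintegral (@integration_by_substitution_increasing _ (fun x => x + d)) //.
- congr fine; apply: eq_integral => x _; rewrite F1 /=.
  by rewrite mulr1.
- by move=> x y _ _ xy; rewrite ltrD2r.
- by rewrite F1 => x _; exact: cvg_cst.
- by rewrite F1; exact: is_cvg_cst.
- by rewrite F1; exact: is_cvg_cst.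
- split.
  + by move=> x _; have [] := dF x.
  + by apply: cvg_at_right_filter; exact: cF.
  + by apply: cvg_at_left_filter; exact: cF.
- exact: continuous_subspaceT.
Qed.

Lemma Rintegral_itv_split (q : R -> R) (a b c : R) : a <= b <= c -> continuous q ->
  Rintegral mu `[a, c] q = Rintegral mu `[a, b] q + Rintegral mu `[b, c] q.
Proof.
move=> /andP[ab bc] cq.
have qi x y : rintegrable `[x, y] q by apply: itv_rintegrable => z _; exact: cq.
have h := @Rintegral_itvB R q (BLeft a) (BRight c) b (qi a c).
rewrite -(subrK (Rintegral mu `[a, b] q) (Rintegral mu `[a, c] q)) h ?bnd_simp // addrC.
congr (_ + _); rewrite Rintegral_itv_obnd_cbnd //.
have m1 : measurable (`[b, c]%classic : set RM) by exact: measurable_itv.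
have m2 : measurable (`]b, c]%classic : set RM) by exact: measurable_itv.
apply: (integrableS m1 m2 _ (qi b c)).
by move=> x /=; rewrite !in_itv /= => /andP[/ltW -> ->].
Qed.

(* On [1/N, N] the functions t^(-1/2 - i (x + om j)), om = pi / ln N, j integer, are
   orthogonal with square norm 2 ln N. Integrating Bessel's inequality for them over a
   period of x gives the bound with its exact constant. *)
Lemma trunc_bessel (f : R -> C) n : inK f ->
  square_integrable L (fun x => mellin_trunc f n (critical x)) /\
  sqnrm L (fun x => mellin_trunc f n (critical x)) <= 2 * pi * sqnrm H f.
Proof.
(* For n = 0 the interval is the point 1 and ln N = 0, so the spacing pi / ln N makes no sense; the
   transform is 0 there. *)
move=> fK; case: (posnP n) => [->|n0].
  have z x : mellin_trunc f 0 (critical x) = 0.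
    by apply: complex_ext; rewrite /mellin_trunc /cRe /cIm /cintegral /= invr1
      set_itv1 Rintegral_set1.
  under eq_fun do rewrite z.
  have i0 : square_integrable L (fun=> 0 : C).
    apply: (le_sqint measurableT (cmeasurable_cst L 0) (integrable0 _ _)) => t _.
    by rewrite cmod0 expr0n.
  split=> //; rewrite /sqnrm; under eq_Rintegral do rewrite cmod0 expr0n.
  by rewrite Rintegral_cst // mul0r !mulr_ge0 ?pi_ge0 ?sqnrm_ge0.
set D : set RM := trunc_itv n.
have mD : measurable D := @measurable_trunc_itv R n.
have fD : square_integrable D f := inK_trunc n fK.
pose lN : R := ln n.+1%:R.
have lN0 : 0 < lN by rewrite ln_gt0 // ltr1n.
have nn : 0 < (n.+1%:R^-1 : R) by rewrite invr_gt0.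
have n1 : (n.+1%:R^-1 : R) <= n.+1%:R.
  by apply: (@le_trans _ _ 1); rewrite ?invf_le1 ?ler1n.
pose om : R := pi / lN; have om0 : 0 < om by rewrite divr_gt0 // pi_gt0.
pose e (x : R) (t : R) : C := cpow t (cconj (critical x - 1)).
have ei x : square_integrable D (e x) by exact: sqint_cpow.
have Ge x : mellin_trunc f n (critical x) = dot D f (e x).
  by rewrite /mellin_trunc /dot /e; apply: eq_cintegral => t _; rewrite cpow_conj cconjK.
have ee x y : dot D (e x) (e y) = cintegral D (fun t => cpow t ((Complex 0 (y - x) : C) - 1)).
  rewrite /dot /e; apply: eq_cintegral => t _; rewrite cpow_conj cconjK -cpowD.
  congr (cpow _ _); apply: complex_ext;
    rewrite !(cReE, cImE) /cRe /cIm /=; lra.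
have Dpos (t : R) : n.+1%:R^-1 <= t <= n.+1%:R -> 0 < t.
  by move=> /andP[h _]; exact: lt_le_trans h.
have ccp z (t : R) : n.+1%:R^-1 <= t <= n.+1%:R -> ccontinuous_at (fun t => cpow t z) t.
  by move=> /Dpos t0; rewrite -cpow_log_cpow; exact: ccontinuous_log_cpow.
have orth x : dot D (e x) (e x) = toC (2 * lN).
  have z0 : (Complex 0 (x - x) : C) = 0 by rewrite subrr.
  rewrite ee z0 (@cFTC _ (fun t => toC (ln t)) _ _ _ n1) ?lnV ?posrE //.
  - by rewrite -toCB; congr toC; rewrite /lN; ring.
  - move=> t /Dpos t0; apply: eq_is_cderive (is_cderive_toC (f := fun t => t^-1) (is_derive1_ln t0)).
    by rewrite cpowB1 // cpow0 mul1r.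
  - by move=> t; exact: ccp.
have orth0 x y (i j : nat) : i != j -> y - x = om * (j%:R - i%:R) -> dot D (e x) (e y) = 0.
  move=> ij yx; rewrite ee yx; set z : C := Complex 0 _.
  have z0 : z != 0.
    apply/eqP => /(congr1 (@cIm R)); rewrite cIm0 /cIm /= => /eqP.
    rewrite mulf_eq0 gt_eqF //= subr_eq0 eqr_nat => /eqP ji.
    by rewrite ji eqxx in ij.
  rewrite (@cFTC _ (fun t => z^-1 * cpow t z) _ _ _ n1).
  - rewrite -mulrBr; suff -> : cpow n.+1%:R z = cpow n.+1%:R^-1 z by rewrite subrr mulr0.
    have sz : sin (cIm z * lN) = 0.
      have -> : cIm z * lN = j%:R * pi - i%:R * pi.
        by rewrite /z /cIm /= /om; field; rewrite gt_eqF.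
      by rewrite sinB !sin_natpi mul0r mulr0 subrr.
    apply: complex_ext; rewrite ?cRe_cpow ?cIm_cpow lnV ?posrE // /cRe /= !mul0r mulrN.
      by rewrite cosN.
    by rewrite -/lN sinN sz oppr0.
  - move=> t /Dpos t0; apply: eq_is_cderive (is_cderiveZ z^-1 (is_cderive_cpow z t0)).
    by rewrite mulKf.
  - by move=> t; exact: ccp.
pose q x : R := cmod (mellin_trunc f n (critical x)) ^+ 2.
have q0 x : 0 <= q x by exact: sqr_ge0.
have cq : continuous q.
  move=> x; have [c1 c2] := ccontinuous_trunc n x fK.
  have -> : q = (fun x => cRe (mellin_trunc f n (critical x)) ^+ 2 +
      cIm (mellin_trunc f n (critical x)) ^+ 2) by apply/funext => y; rewrite /q sqr_cmod.
  by apply: cvgD; apply: cvgM.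
have qi x y : rintegrable `[x, y] q by apply: itv_rintegrable => z _; exact: cq.
pose B := sqnrm D f.
have B0 : 0 <= B := sqnrm_ge0 D f.
have pointwise (x : R) (J : nat) : \sum_(j < J) q (x + om * j%:R) <= 2 * lN * B.
  have l0 : 0 < 2 * lN by rewrite mulr_gt0.
  have := @bessel_finite R D mD J (fun j => e (x + om * j%:R)) (2 * lN) f l0 fD
    (fun j => ei _) _.
  under eq_bigr do rewrite -Ge.
  apply=> i j; case: eqVneq => [->|ij]; first exact: orth.
  by apply: (@orth0 _ _ i j) => //; ring.
have si x y j : rintegrable `[x, y] (fun x => q (x + om * j%:R)).
  apply: itv_rintegrable => z _.
  apply: (@continuous_comp _ _ _ (fun x => x + om * j%:R) q); last exact: cq.
  by apply: cvgD; [exact: cvg_id|exact: cvg_cst].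
have ssi x y (J' : nat) : rintegrable `[x, y] (fun x => \sum_(j < J') q (x + om * j%:R)).
  elim: J' => [|J' ih].
    have -> : (fun x => \sum_(j < 0) q (x + om * j%:R)) = cst 0.
      by apply/funext => z; rewrite big_ord0.
    exact: integrable0.
  have -> : (fun x => \sum_(j < J'.+1) q (x + om * j%:R)) =
      (fun x => \sum_(j < J') q (x + om * j%:R) + q (x + om * J'%:R)).
    by apply/funext => z; rewrite big_ord_recr.
  by apply: rintegrableD => //; exact: measurable_itv.
have block (c : R) (J : nat) : Rintegral mu `[c, c + om * J%:R] q =
    Rintegral mu `[c, c + om] (fun x => \sum_(j < J) q (x + om * j%:R)).
  elim: J => [|J ih].
    under [RHS]eq_Rintegral do rewrite big_ord0.
    by rewrite mulr0 addr0 set_itv1 Rintegral_set1 Rintegral_cst // mul0r.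
  have -> : Rintegral mu `[c, c + om] (fun x => \sum_(j < J.+1) q (x + om * j%:R)) =
      Rintegral mu `[c, c + om] (fun x => \sum_(j < J) q (x + om * j%:R) + q (x + om * J%:R)).
    by apply: eq_Rintegral => z _; rewrite big_ord_recr.
  have mI : measurable (`[c, c + om]%classic : set RM) by exact: measurable_itv.
  rewrite (RintegralD mI (ssi _ _ J) (si _ _ J)) -ih.
  have cc : c <= c + om by rewrite lerDl ltW.
  rewrite -(@Rintegral_shift q c (c + om) (om * J%:R) cc cq).
  have e1 : c + om + om * J%:R = c + om * J.+1%:R by rewrite -natr1; ring.
  rewrite e1; apply: Rintegral_itv_split cq; apply/andP; split.
    by rewrite lerDl mulr_ge0 // ltW.
  by rewrite lerD2l ler_pM2l // ler_nat.
(* The length om of a period times the pointwise bound 2 lN B is exactly 2 pi B, whatever n is. *)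
have blockle (c : R) (J : nat) : Rintegral mu `[c, c + om * J%:R] q <= 2 * pi * B.
  have cc : Rintegral mu `[c, c + om] (cst (2 * lN * B)) = 2 * pi * B.
    transitivity (2 * lN * B * (c + om) - 2 * lN * B * c); last first.
      by rewrite -mulrBr addrAC subrr add0r /om; field; rewrite gt_eqF.
    apply: (@rFTC _ (fun x => 2 * lN * B * x)).
    - by rewrite lerDl ltW.
    - move=> x _; apply: (is_derive_eq (is_deriveZ (2 * lN * B) (is_derive_id x 1))).
      by rewrite /GRing.scale /= mulr1.
    - by move=> x _; exact: cvg_cst.
  have mI : measurable (`[c, c + om]%classic : set RM) by exact: measurable_itv.
  have ci : rintegrable `[c, c + om] (cst (2 * lN * B)).
    by apply: itv_rintegrable => z _; exact: cvg_cst.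
  rewrite block -cc; exact: (le_Rintegral mI (ssi _ _ J) ci (fun x _ => pointwise x J)).
have [Qi QB] : rintegrable setT q /\ Rintegral mu setT q <= 2 * pi * B.
  apply: (@centered_exhaustion_le _ 0) => // m.
  pose J := (Num.truncn (2 * m%:R / om)).+1.
  have mJ : 2 * m%:R <= om * J%:R.
    by rewrite (mulrC om) -ler_pdivrMr //; apply/ltW; exact: truncnS_gt.
  have m0 : 0 <= m%:R :> R by [].
  apply: le_trans (blockle (0 - m%:R) J).
  rewrite (@Rintegral_itv_split q (0 - m%:R) (0 + m%:R) (0 - m%:R + om * J%:R)) //; last by apply/andP; split; lra.
  by rewrite lerDl; apply: Rintegral_ge0 => t _; exact: q0.
split; first by apply/sqintP; split => //; exact: cmeasurable_trunc.
apply: (le_trans QB); rewrite ler_wpM2l ?mulr_ge0 ?pi_ge0 //.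
exact: sqnrm_sub (@measurable_halfline R) mD (@trunc_itv_sub R n) fK.
Qed.

(** F is the L^2 limit of the truncated transforms. The weighted inequality lets the bound pass to
    the limit with its constant, as e tends to 0. *)
Lemma mellin_bessel (f : R -> C) (F : C -> C) : mellin_pair f F ->
  sqnrm L (fun x => F (critical x)) <= 2 * pi * sqnrm H f.
Proof.
move=> [fK [Fi Fc]]; set B := 2 * pi * sqnrm H f.
have B0 : 0 <= B by rewrite !mulr_ge0 ?pi_ge0 ?sqnrm_ge0.
set X := sqnrm _ _.
have X0 : 0 <= X := sqnrm_ge0 _ _.
suff h e : 0 < e -> X <= (1 + e) * B + e.
  apply/ler_addgt0Pr => e e0; have e1 : 0 < e / (B + 1) by rewrite divr_gt0 //; lra.
  apply: (le_trans (h _ e1)).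
  have -> : (1 + e / (B + 1)) * B + e / (B + 1) = B + e by field; rewrite gt_eqF //; lra.
  by [].
move=> e0.
have ti n := trunc_bessel n fK.
have ui n : square_integrable L (fun x => mellin_trunc f n (critical x) - F (critical x)).
  by apply: sqintB => //; have [] := ti n.
move/(mellin_error_cvgP ui) : Fc => Fc.
have ie : 0 < 1 + e^-1 by rewrite addr_gt0 ?invr_gt0.
have [N _ /(_ N (leqnn N)) /= hN] := Fc (e / (1 + e^-1)) (divr_gt0 e0 ie).
have [tN tB] := ti N.
have -> : X = sqnrm L (fun x => mellin_trunc f N (critical x) +
    -1 * (mellin_trunc f N (critical x) - F (critical x))).
  by apply: eq_sqnrm => x _; ring.
have mui : square_integrable L (fun x => -1 * (mellin_trunc f N (critical x) - F (critical x))).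
  exact: sqintZ.
apply: (le_trans (sqnrmD_weighted measurableT e0 tN mui)); apply: lerD.
  by rewrite ler_wpM2l // addr_ge0 // ltW.
rewrite sqnrmZ // cmodN cmod1 expr1n mul1r.
by rewrite mulrC -ler_pdivlMr // ltW.
Qed.

End MellinBessel.

(** * The Plancherel defect *)

Section MellinDefect.
Variable R : realType.
Local Notation C := (Cplx R).
Local Notation RM := (measurableTypeR R).
Local Notation mu := (@lebesgue_measure R).
Local Notation H := (halfline R : set RM).
Local Notation L := (setT : set RM).
Implicit Types (f g : R -> C) (F G : C -> C).

Let mH : measurable H := @measurable_halfline R.

Lemma mellin_error_sqint f F n : mellin_pair f F ->
  square_integrable L (fun x => mellin_trunc f n (critical x) - F (critical x)).
Proof.
move=> [fK [Fi _]]; apply: sqintB => //.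
by have [] := trunc_bessel n fK.
Qed.

Lemma mellin_pair_cvg f F : mellin_pair f F -> forall e : R, 0 < e ->
  \forall n \near \oo, sqnrm L (fun x => mellin_trunc f n (critical x) - F (critical x)) < e.
Proof.
move=> fF; have [_ [_ Fc]] := fF.
by move/(mellin_error_cvgP (fun n => mellin_error_sqint n fF)) : Fc.
Qed.

Lemma mellin_pairD f g F G : mellin_pair f F -> mellin_pair g G ->
  mellin_pair (fun t => f t + g t) (fun s => F s + G s).
Proof.
move=> fF gG; have [fK [Fi _]] := fF; have [gK [Gi _]] := gG.
have hK : inK (fun t => f t + g t) by exact: sqintD.
have e n x : mellin_trunc (fun t => f t + g t) n (critical x) - (F (critical x) + G (critical x)) =
    (mellin_trunc f n (critical x) - F (critical x)) + (mellin_trunc g n (critical x) - G (critical x)).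
  suff -> : mellin_trunc (fun t => f t + g t) n (critical x) =
    mellin_trunc f n (critical x) + mellin_trunc g n (critical x) by ring.
  rewrite /mellin_trunc -(cintegralD (@measurable_trunc_itv R n) (trunc_cintegrable n _ fK) (trunc_cintegrable n _ gK)).
  by apply: eq_cintegral => t _; rewrite mulrDl.
have u1 n := mellin_error_sqint n fF; have u2 n := mellin_error_sqint n gG.
split=> //; split; first exact: sqintD.
apply/mellin_error_cvgP => [n|r r0].
  by apply: eq_sqint (sqintD measurableT (u1 n) (u2 n)) => x _; rewrite -e.
have r4 : 0 < r / 4 by rewrite divr_gt0.
move: (mellin_pair_cvg fF r4) (mellin_pair_cvg gG r4); apply: filterS2 => n h1 h2.
rewrite (eq_sqnrm (g := fun x => (mellin_trunc f n (critical x) - F (critical x)) +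
  (mellin_trunc g n (critical x) - G (critical x)))); last by move=> x _; exact: e.
by apply: (le_lt_trans (sqnrmD_le measurableT (u1 n) (u2 n))); lra.
Qed.

Lemma mellin_pairZ c f F : mellin_pair f F ->
  mellin_pair (fun t => c * f t) (fun s => c * F s).
Proof.
move=> fF; have [fK [Fi _]] := fF; have u1 n := mellin_error_sqint n fF.
have hK : inK (fun t => c * f t) by exact: sqintZ.
have e n x : mellin_trunc (fun t => c * f t) n (critical x) - c * F (critical x) =
    c * (mellin_trunc f n (critical x) - F (critical x)).
  rewrite mulrBr; congr (_ - _).
  rewrite /mellin_trunc -(cintegralZ (@measurable_trunc_itv R n) c (trunc_cintegrable n _ fK)).
  by apply: eq_cintegral => t _; rewrite mulrA.
split=> //; split; first exact: sqintZ.
apply/mellin_error_cvgP => [n|r r0].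
  by apply: eq_sqint (sqintZ measurableT c (u1 n)) => x _; rewrite -e.
have c1 : 0 < cmod c ^+ 2 + 1 by rewrite ltr_wpDl ?sqr_ge0.
have := mellin_pair_cvg fF (divr_gt0 r0 c1); apply: filterS => n h1.
rewrite (eq_sqnrm (g := fun x => c * (mellin_trunc f n (critical x) - F (critical x))));
  last by move=> x _; exact: e.
rewrite sqnrmZ //; move: h1; rewrite ltr_pdivlMr // => h1.
apply: le_lt_trans h1; rewrite mulrC ler_wpM2l ?sqnrm_ge0 // lerDl.
by [].
Qed.

Lemma mellin_pairB f g F G : mellin_pair f F -> mellin_pair g G ->
  mellin_pair (fun t => f t - g t) (fun s => F s - G s).
Proof.
move=> fF /(mellin_pairZ (-1)) gG; have := mellin_pairD fF gG.
have -> : (fun t => f t + -1 * g t) = (fun t => f t - g t) by apply/funext => t; rewrite mulN1r.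
by have -> : (fun t => F t + -1 * G t) = (fun t => F t - G t) by apply/funext => t; rewrite mulN1r.
Qed.

Definition defect f F : R := 2 * pi * sqnrm H f - sqnrm L (fun x => F (critical x)).

Lemma defect_ge0 f F : mellin_pair f F -> 0 <= defect f F.
Proof. by move=> /mellin_bessel h; rewrite subr_ge0. Qed.

Lemma defect_parallelogram f g F G : mellin_pair f F -> mellin_pair g G ->
  defect (fun t => f t + g t) (fun s => F s + G s) +
  defect (fun t => f t - g t) (fun s => F s - G s) = 2 * (defect f F + defect g G).
Proof.
move=> [fK [Fi _]] [gK [Gi _]]; rewrite /defect.
have h1 := sqnrm_parallelogram mH fK gK.
have h2 := sqnrm_parallelogram measurableT Fi Gi.
rewrite addrACA -mulrDr h1 -opprD h2; ring.
Qed.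

Lemma defectD_le f g F G : mellin_pair f F -> mellin_pair g G ->
  defect (fun t => f t + g t) (fun s => F s + G s) <= 2 * (defect f F + defect g G).
Proof.
move=> fF gG; rewrite -(defect_parallelogram fF gG) lerDl.
exact: defect_ge0 (mellin_pairB fF gG).
Qed.

Lemma defectB_le f g F G : mellin_pair f F -> mellin_pair g G ->
  defect (fun t => f t - g t) (fun s => F s - G s) <= 2 * (defect f F + defect g G).
Proof.
move=> fF gG; rewrite -(defect_parallelogram fF gG) lerDr.
exact: defect_ge0 (mellin_pairD fF gG).
Qed.

(** With [defect_ge0] this means that the defect is 0. The parallelogram identity makes such pairs
    stable under sums, which need not be orthogonal. *)
Definition mellin_isometric f F := mellin_pair f F /\ defect f F <= 0.

Lemma mellin_isometricD f g F G : mellin_isometric f F -> mellin_isometric g G ->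
  mellin_isometric (fun t => f t + g t) (fun s => F s + G s).
Proof.
move=> [fF f0] [gG g0]; split; first exact: mellin_pairD.
by apply: (le_trans (defectD_le fF gG)); lra.
Qed.

Lemma mellin_isometricZ c f F : mellin_isometric f F ->
  mellin_isometric (fun t => c * f t) (fun s => c * F s).
Proof.
move=> [fF f0]; split; first exact: mellin_pairZ.
have [fK [Fi _]] := fF; move: f0; rewrite /defect !sqnrmZ // => f0.
rewrite mulrCA -mulrBr; have := sqr_ge0 (cmod c); nra.
Qed.

Lemma mellin_isometric_sum n (c : nat -> C) (f : nat -> R -> C) (F : nat -> C -> C) :
  (forall i, (i <= n)%N -> mellin_isometric (f i) (F i)) ->
  mellin_isometric (fun t => \sum_(i < n.+1) c i * f i t) (fun s => \sum_(i < n.+1) c i * F i s).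
Proof.
elim: n => [|n ih] h.
  have := mellin_isometricZ (c 0%N) (h 0%N isT).
  have -> : (fun t => \sum_(i < 1) c i * f i t) = (fun t => c 0%N * f 0%N t).
    by apply/funext => t; rewrite big_ord1.
  by have -> : (fun t => \sum_(i < 1) c i * F i t) = (fun t => c 0%N * F 0%N t);
    first by apply/funext => t; rewrite big_ord1.
have h1 : forall i, (i <= n)%N -> mellin_isometric (f i) (F i).
  by move=> i ni; apply: h; exact: leqW.
have := mellin_isometricD (ih h1) (mellin_isometricZ (c n.+1) (h n.+1 (leqnn _))).
have -> : (fun t => \sum_(i < n.+2) c i * f i t) =
    (fun t => \sum_(i < n.+1) c i * f i t + c n.+1 * f n.+1 t).
  by apply/funext => t; rewrite big_ord_recr.
by have -> : (fun t => \sum_(i < n.+2) c i * F i t) =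
    (fun t => \sum_(i < n.+1) c i * F i t + c n.+1 * F n.+1 t);
  first by apply/funext => t; rewrite big_ord_recr.
Qed.

Lemma psi_isometric (w : C) k : cRe w < 2^-1 -> mellin_isometric (psi w k) (psi_mellin w k).
Proof.
move=> w2; split; first exact: psi_mellin_pair.
by rewrite subr_le0 sqnrm_psi_le.
Qed.

(** Meant for estimates that fail at the zero rho itself, where [Vmul] takes the value 0 and not its
    limit. *)
Lemma le_Rintegral_punctured (f g : R -> R) (t : R) : rintegrable L f -> rintegrable L g ->
  (forall y, y != t -> f y <= g y) -> Rintegral mu L f <= Rintegral mu L g.
Proof.
move=> fi gi fg.
have mD : measurable (L `\ t) by apply: measurableD => //; exact: measurable_set1.
have red h : rintegrable L h -> rintegrable (L `\ t) h /\
    Rintegral mu L h = Rintegral mu (L `\ t) h.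
  move=> hi; have hD : rintegrable (L `\ t) h by exact: integrableS hi.
  split=> //; rewrite /Rintegral (@integral_setD1 _ _ t L) //.
  exact: (measurable_int mu hD).
have [fD ->] := red f fi; have [gD ->] := red g gi.
by apply: le_Rintegral => // y [_ /eqP yt]; exact: fg.
Qed.

End MellinDefect.

(** * Bounds for the remainder on the critical line *)

Section VPsiApproximation.
Variable R : realType.
Local Notation C := (Cplx R).
Local Notation RM := (measurableTypeR R).
Local Notation mu := (@lebesgue_measure R).
Local Notation H := (halfline R : set RM).
Local Notation L := (setT : set RM).
Local Notation I := (imaginary_unit R).
Variables (zeta : C -> C) (hz : is_riemann_zeta zeta).
Implicit Types (k : nat) (rho w : C).

Let mH : measurable H := @measurable_halfline R.

Lemma ler_sqr_ge0 (a b : R) : 0 <= a -> a <= b -> a ^+ 2 <= b ^+ 2.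
Proof. by move=> a0 ab; rewrite lerXn2r ?nnegrE // (le_trans a0). Qed.

Lemma horner_growth (P : {poly C}) k : (size P <= k.+1)%N ->
  exists2 M : R, 0 <= M & forall z : C, cmod P.[z] <= M * (1 + cmod z) ^+ k.
Proof.
move=> sP; exists (\sum_(i < k.+1) cmod P`_i).
  by rewrite sumr_ge0 // => i _; exact: cmod_ge0.
move=> z; rewrite (horner_coef_wide _ sP) mulr_suml.
apply: (le_trans (ler_cmod_sum _ _ _)); apply: ler_sum => i _.
rewrite cmodM cmodX ler_wpM2l ?cmod_ge0 //.
have z1 : 1 <= 1 + cmod z by rewrite lerDl cmod_ge0.
apply: (@le_trans _ _ ((1 + cmod z) ^+ i)).
  by rewrite lerXn2r ?nnegrE ?cmod_ge0 ?addr_ge0 ?cmod_ge0 // lerDr.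
by rewrite ler_weXn2l // -ltnS.
Qed.

(* As w = rho - e is at the height of rho, |s - rho| <= |s - w| on the line, which makes
   B independent of e. *)
Lemma remainder_bounds rho m : critical_zero zeta rho m ->
  exists2 c : C, cmod c = 1 & forall k,
  exists (P : {poly C}) (B : R), [/\ (size P <= k.+1)%N, P.[0] = c, 0 <= B &
    forall (e y : R), 0 < e -> y != cIm rho ->
    let w := rho - toC e in let s := critical y in
    cmod (Vmul zeta s * psi_mellin w k s - k`!%:R * P.[s - rho] / (s - w) ^+ k.+1) ^+ 2
      <= B * poisson 1 (cIm rho) y /\
    cmod (psi_mellin w k s) ^+ 2 <=
      cmod (Vmul zeta s * psi_mellin w k s) ^+ 2 + B * poisson 1 (cIm rho) y].
Proof.
move=> zr; have rhoE : rho = critical (cIm rho) by apply: complex_ext => //; case: zr.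
have [c c1 jets] := Vmul_jet hz zr; exists c => // k.
have [P0 [d0 [[d1 [K [d10 K0 hK]]] sP0 P00 d00 hV]]] := jets k.
(* The jet is a polynomial in the real height x, and s - rho = i x; the substitution makes it a
   polynomial in s - rho. *)
pose P := P0 \Po (- I *: 'X).
have sP : (size P <= k.+1)%N.
  apply: leq_trans (size_comp_poly_leq _ _) _.
  have : (size (- I *: 'X : {poly C}) <= 2)%N by apply: leq_trans (size_scale_leq _ _) _; rewrite size_polyX.
  by move: sP0; case: (size P0) => [|a]; case: (size _) => [|[|[|b]]] //=;
    rewrite ?muln0 ?muln1.
have PE x : P.[I * toC x] = P0.[toC x].
  rewrite horner_comp; congr (_.[_]).
  have II : I * I = -1 by apply: complex_ext; rewrite ?cReM ?cImM /cRe /cIm /= ?oppr0; ring.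
  by rewrite hornerZ hornerX mulNr mulrA II mulN1r opprK.
have P0E : P.[0] = P0.[0] by have := PE 0; rewrite toC0 mulr0.
have [M M0 hM] := horner_growth sP.
pose d := Num.min d0 d1; have d_0 : 0 < d by rewrite lt_min d00.
pose fk : R := k`!%:R; have fk0 : 0 <= fk by [].
(* B1 covers |x| < d, where the jet applies. For |x| >= d, B2 covers the first estimate, through |V|
   <= 1 and the growth of P, and B3 the second. The factors 1 + d^2 and 1 + d^(-2) turn a constant,
   respectively 1 / x^2, into a multiple of the Poisson kernel. *)
pose A := fk * (1 + M) * (1 + d^-1) ^+ k.
pose B1 := (fk * K) ^+ 2 * (1 + d ^+ 2).
pose B2 := A ^+ 2 * (1 + d^-1 ^+ 2).
pose B3 := fk ^+ 2 * (d^-1 ^+ 2) ^+ k * (1 + d^-1 ^+ 2).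
have B10 : 0 <= B1 by rewrite mulr_ge0 ?sqr_ge0 // addr_ge0 // sqr_ge0.
have B20 : 0 <= B2 by rewrite mulr_ge0 ?sqr_ge0 // addr_ge0 // sqr_ge0.
have B30 : 0 <= B3.
  apply: mulr_ge0; last by rewrite addr_ge0 // sqr_ge0.
  by apply: mulr_ge0; [exact: sqr_ge0|apply: exprn_ge0; exact: sqr_ge0].
exists P, (B1 + B2 + B3); split => //; [by rewrite P0E|by rewrite !addr_ge0|].
move=> e y e0 yr /=; set x := y - cIm rho.
have x0 : x != 0 by rewrite subr_eq0.
have yE : critical y = critical (cIm rho + x) by rewrite /x addrC subrK.
have srho : critical y - rho = I * toC x.
  by rewrite yE criticalE -rhoE addrAC subrr add0r.
set X := critical y - (rho - toC e).
have XE : X = toC e + I * toC x by rewrite -srho /X; ring.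
have X2 : cmod X ^+ 2 = e ^+ 2 + x ^+ 2.
  by rewrite sqr_cmod XE !(cReE, cImE) /cRe /cIm /=; ring.
have x20 : 0 < x ^+ 2 by rewrite exprn_even_gt0.
have xX : `|x| <= cmod X.
  rewrite -(@ler_pXn2r _ 2) ?nnegrE ?cmod_ge0 // real_normK ?num_real // X2.
  by rewrite lerDr sqr_ge0.
have ax0 : 0 < `|x| by rewrite normr_gt0.
have X0 : 0 < cmod X by exact: lt_le_trans xX.
have pE : poisson 1 (cIm rho) y = (1 + x ^+ 2)^-1 by rewrite /poisson expr1n.
have q0 : 0 < 1 + x ^+ 2 by rewrite ltr_wpDl.
rewrite pE /psi_mellin -/X srho PE.
have -> : Vmul zeta (critical y) * (k`!%:R / X ^+ k.+1) - k`!%:R * P0.[toC x] / X ^+ k.+1 =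
    k`!%:R / X ^+ k.+1 * (Vmul zeta (critical y) - P0.[toC x]) by ring.
have cF : cmod (k`!%:R / X ^+ k.+1) = fk / cmod X ^+ k.+1.
  by rewrite cmodM cmod_nat cmodV cmodX.
have cFle : cmod (k`!%:R / X ^+ k.+1) <= fk / `|x| ^+ k.+1.
  rewrite cF ler_wpM2l // lef_pV2 ?posrE ?exprn_gt0 //.
  by rewrite lerXn2r ?nnegrE ?cmod_ge0.
set v := Vmul zeta (critical y); move: (k`!%:R / X ^+ k.+1) cF cFle => u cF cFle.
rewrite !(cmodM u) (cmodM v) cF in cFle *.
have [xd|xd] := ltP `|x| d.
  have /andP[xd0 xd1] : (`|x| < d0) && (`|x| < d1) by move: xd; rewrite lt_min.
  have v1 : cmod v = 1 by rewrite /v yE hV.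
  split; last by rewrite v1 mul1r lerDl !mulr_ge0 ?addr_ge0 ?invr_ge0 // ltW.
  have h := hK x x0 xd1; rewrite -yE -/v in h.
  apply: (@le_trans _ _ ((fk * K) ^+ 2)).
    apply: ler_sqr_ge0; first by rewrite mulr_ge0 ?cmod_ge0 // divr_ge0 ?exprn_ge0 ?cmod_ge0.
    have -> : fk * K = fk / `|x| ^+ k.+1 * (K * `|x| ^+ k.+1).
      by field; rewrite expf_neq0 // normr_eq0.
    by apply: ler_pM; rewrite ?cmod_ge0 // divr_ge0 ?exprn_ge0 ?cmod_ge0.
  rewrite ler_pdivlMr //; apply: (@le_trans _ _ B1); last by rewrite -addrA lerDl addr_ge0.
  rewrite ler_wpM2l ?sqr_ge0 // lerD2l -(@real_normK _ x) ?num_real //.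
  by rewrite lerXn2r ?nnegrE ?ltW.
have dx : d^-1 ^+ 2 * x ^+ 2 >= 1.
  rewrite -(@real_normK _ x) ?num_real // -exprMn exprn_ege1 //.
  by rewrite mulrC ler_pdivlMr // mul1r.
have qx : 1 + x ^+ 2 <= (1 + d^-1 ^+ 2) * x ^+ 2 by rewrite mulrDl mul1r addrC lerD2l.
have far (Z B : R) : 0 <= Z -> Z * (1 + d^-1 ^+ 2) <= B -> Z / x ^+ 2 <= B / (1 + x ^+ 2).
  move=> Z0 ZB; rewrite ler_pdivlMr // mulrAC ler_pdivrMr //.
  apply: (le_trans (ler_wpM2l Z0 qx)); rewrite mulrA ler_wpM2r ?sqr_ge0 //.
split.
  apply: (@le_trans _ _ (A ^+ 2 / x ^+ 2)); last first.
    apply: far; first exact: sqr_ge0.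
    by rewrite -/B2 addrAC lerDr addr_ge0.
  have vP : cmod (v - P0.[toC x]) <= (1 + M) * (1 + `|x|) ^+ k.
    apply: (le_trans (ler_cmodB _ _)); rewrite mulrDl mul1r; apply: lerD.
      apply: (le_trans (cmod_Vmul_le1 hz y)); rewrite exprn_ege1 // lerDl.
      exact: ltW.
    have := hM (I * toC x); rewrite PE cmodM cmod_imaginary_unit mul1r cmod_toC.
    by [].
  have x1 : 1 + `|x| <= (1 + d^-1) * `|x|.
    by rewrite mulrDl mul1r addrC lerD2l mulrC ler_pdivlMr // mul1r.
  have -> : A ^+ 2 / x ^+ 2 = (A / `|x|) ^+ 2.
    by rewrite [RHS]exprMn exprVn real_normK ?num_real.
  apply: ler_sqr_ge0; first by rewrite mulr_ge0 ?cmod_ge0 // divr_ge0 ?exprn_ge0 ?cmod_ge0.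
  apply: (@le_trans _ _ (fk / `|x| ^+ k.+1 * ((1 + M) * ((1 + d^-1) * `|x|) ^+ k))).
    apply: ler_pM; rewrite ?cmod_ge0 ?divr_ge0 ?exprn_ge0 ?cmod_ge0 //.
    apply: (le_trans vP); rewrite ler_wpM2l ?addr_ge0 //.
    by rewrite lerXn2r ?nnegrE ?mulr_ge0 ?addr_ge0 ?invr_ge0 ?(ltW d_0).
  rewrite le_eqVlt; apply/orP; left; apply/eqP.
  by rewrite /A exprMn exprSr; field; rewrite normr_eq0 x0 expf_neq0 // normr_eq0.
(* Another zero of zeta on the line may lie here, where [Vmul] is 0. Only the nonnegativity of the
   first term is used, and all of |M psi|^2 goes into the remainder. *)
rewrite -[leLHS]add0r lerD ?sqr_ge0 //.
apply: (@le_trans _ _ (fk ^+ 2 * (d^-1 ^+ 2) ^+ k / x ^+ 2)); last first.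
  apply: far; first by rewrite mulr_ge0 ?sqr_ge0 // exprn_ge0 ?sqr_ge0.
  by rewrite -/B3 lerDr addr_ge0.
apply: (@le_trans _ _ ((fk / `|x| ^+ k.+1) ^+ 2)).
  by apply: ler_sqr_ge0 => //; rewrite divr_ge0 ?exprn_ge0 ?cmod_ge0.
have vd : `|x|^-1 <= d^-1 by rewrite lef_pV2.
have -> : (fk / `|x| ^+ k.+1) ^+ 2 = fk ^+ 2 * (`|x|^-1 ^+ 2) ^+ k / x ^+ 2.
  rewrite -(@real_normK _ x) ?num_real // -!exprVn (exprAC _ 2 k) (exprS _ k).
  by ring.
rewrite ler_wpM2r ?invr_ge0 ?sqr_ge0 // ler_wpM2l ?sqr_ge0 //.
rewrite lerXn2r ?nnegrE ?sqr_ge0 //.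
by apply: ler_sqr_ge0 => //; rewrite invr_ge0.
Qed.

End VPsiApproximation.

(** * The vectors V psi *)

Section UnitaryPart.
Variable R : realType.
Local Notation C := (Cplx R).
Local Notation RM := (measurableTypeR R).
Local Notation mu := (@lebesgue_measure R).
Local Notation H := (halfline R : set RM).
Local Notation L := (setT : set RM).
Implicit Types (k : nat) (rho w : C) (f g : R -> C).

Let mH : measurable H := @measurable_halfline R.

Lemma Kdot_self f : Kdot f f = toC (sqnrm H f).
Proof. exact: (dot_self mH). Qed.

Lemma Keq_imp f g f' g' :
  (forall t, 0 < t -> f t = g t -> f' t = g' t) -> Keq f g -> Keq f' g'.
Proof.
move=> h; pose P t := halfline R t -> f t = g t.
pose Q t := halfline R t -> f' t = g' t.
have PQ t : P t -> Q t by move=> hP /[dup] /halflineP t0 /hP; exact: h.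
exact: (@filterS _ (almost_everywhere mu) _ P Q PQ).
Qed.

Lemma unitary_sqnrm V Vinv f : unitary_on_K V Vinv -> inK f ->
  sqnrm H (V f) = sqnrm H f.
Proof. by move=> hV fK; apply: toC_inj; rewrite -!Kdot_self (unitary_dot hV). Qed.

Lemma sqnrm_Keq f g : inK f -> inK g -> Keq f g -> sqnrm H f = sqnrm H g.
Proof. exact: sqnrm_ae. Qed.

Lemma unitary_sqnrmB V Vinv f g : unitary_on_K V Vinv -> inK f -> inK g ->
  sqnrm H (fun t => V f t - V g t) = sqnrm H (fun t => f t - g t).
Proof.
move=> hV fK gK; have dK : inK (fun t => -1 * g t + f t).
  by apply: sqintD => //; exact: sqintZ.
have -> : sqnrm H (fun t => f t - g t) = sqnrm H (fun t => -1 * g t + f t).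
  by apply: eq_sqnrm => t _; ring.
rewrite -(unitary_sqnrm hV dK).
have VfK := unitary_in hV fK; have VgK := unitary_in hV gK.
apply: sqnrm_Keq; [exact: sqintB|exact: (unitary_in hV)|].
apply: Keq_imp (unitary_linear hV (-1) gK fK) => t _ ->.
by ring.
Qed.

Variables (zeta : C -> C) (hz : is_riemann_zeta zeta).
Variables (V Vinv : (R -> C) -> (R -> C)) (hV : unitary_on_K V Vinv).
Hypothesis hVmul : mellin_multiplier (Vmul zeta) V.

(* Coefficients of k! P(s - rho) / (s - w)^(k+1) on the (k-i)! / (s - w)^(k-i+1), from the
   Taylor expansion of P at - e = w - rho. *)
Definition taylor_weight (P : {poly C}) (e : R) k (i : nat) : C :=
  (P^`N(i)).[- toC e] * (k`!%:R / (k - i)`!%:R).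

(** For the difference r of V psi and the combination of the psi_{w,j}, the transform is small on
    the line by [remainder_bounds]. Its defect is at most twice the sum of the defects: that of the
    combination is 0, and that of V psi is the mass lost in multiplying by V. *)
Lemma V_psi_approx rho m : critical_zero zeta rho m ->
  exists2 c : C, cmod c = 1 & forall k,
  exists (P : {poly C}) (B : R), [/\ (size P <= k.+1)%N, P.[0] = c, 0 <= B &
    forall e : R, 0 < e -> let w := rho - toC e in
    sqnrm H (fun t => V (psi w k) t -
      \sum_(i < k.+1) taylor_weight P e k i * psi w (k - i) t) <= B].
Proof.
move=> zr; have [re_rho _] := zr.
have [c c1 rem] := remainder_bounds hz zr; exists c => // k.
have [P [B [sP P0 B0 hB]]] := rem k.
(* The transform of r contributes B pi and its defect 2 B pi, so that 2 pi |r|^2 <= 3 B pi, below 2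
   pi (2 B). *)
exists P, (2 * B); split => //; first by rewrite mulr_ge0.
move=> e e0 /=; set w := rho - toC e.
have w2 : cRe w < 2^-1 by rewrite /w cReB cRe_toC re_rho; lra.
have psiP := psi_isometric k w2.
have psiK : inK (psi w k) by case: psiP => [[]].
have VP : mellin_pair (V (psi w k)) (fun s => Vmul zeta s * psi_mellin w k s).
  by split; [exact: (unitary_in hV)|apply: hVmul => //; case: psiP => [[]]].
have sP' := @mellin_isometric_sum R k (taylor_weight P e k) (fun i => psi w (k - i))
  (fun i => psi_mellin w (k - i)) (fun i _ => psi_isometric (k - i) w2).
set phi := (fun t : R => \sum_(i < k.+1) _) in sP' *.
set Phi := (fun s : C => \sum_(i < k.+1) _) in sP'.
have [phiP phid] := sP'.
have PhiE y : Phi (critical y) = k`!%:R * P.[critical y - rho] / (critical y - w) ^+ k.+1.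
  set X := critical y - w; have X0 : X != 0 := criticalB_neq0 w2 y.
  have -> : critical y - rho = - toC e + X by rewrite /X /w; ring.
  rewrite (nderiv_taylor_wide _ sP); last exact: mulrC.
  rewrite mulr_sumr mulr_suml /Phi; apply: eq_bigr => i _.
  have ik : (i <= k)%N by rewrite -ltnS.
  rewrite /taylor_weight /psi_mellin -/X.
  have -> : X ^+ k.+1 = X ^+ (k - i).+1 * X ^+ i.
    by rewrite -exprD addSn subnK.
  have f0 : ((k - i)`!%:R : C) != 0.
    by rewrite pnatr_eq0 -lt0n fact_gt0.
  move: (P^`N(i)).[_] => a.
  by field; rewrite f0 !expf_neq0.
have rP := mellin_pairB VP phiP.
have rd := defectB_le VP phiP.
have [rK [ri _]] := rP.
have pB := poisson_exhaustion (cIm rho) (ltr01 : 0 < (1 : R)).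
rewrite divr1 in pB; have [pi1 pi2] := pB.
have gi := rintegrableZ measurableT B pi1.
have gB : Rintegral mu L (fun y => B * poisson 1 (cIm rho) y) <= B * pi.
  by rewrite RintegralZl // ler_wpM2l.
have h1 : sqnrm L (fun x => Vmul zeta (critical x) * psi_mellin w k (critical x) - Phi (critical x)) <= B * pi.
  apply: le_trans gB; apply: (@le_Rintegral_punctured _ _ _ (cIm rho)) => //.
    by move/sqintP : ri => [].
  by move=> y yr; rewrite PhiE; have [] := hB e y e0 yr.
have Fi := sqint_psi_mellin w2 k.
have mFi := mellin_pair_sqint VP.
have h2 : sqnrm L (fun x => psi_mellin w k (critical x)) <=
    sqnrm L (fun x => Vmul zeta (critical x) * psi_mellin w k (critical x)) + B * pi.
  apply: (@le_trans _ _ (Rintegral mu L (fun x =>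
    cmod (Vmul zeta (critical x) * psi_mellin w k (critical x)) ^+ 2 + B * poisson 1 (cIm rho) x))).
    move/sqintP : Fi => [_ Fi]; move/sqintP : mFi => [_ mFi].
    apply: (@le_Rintegral_punctured _ _ _ (cIm rho)) => //.
      exact: rintegrableD.
    by move=> y yr; have [] := hB e y e0 yr.
  move/sqintP : mFi => [_ mFi].
  by rewrite RintegralD // lerD2l.
have h3 := sqnrm_psi_le w2 k.
have p0 := pi_gt0 R.
have d1 : defect (V (psi w k)) (fun s => Vmul zeta s * psi_mellin w k s) <= B * pi.
  by rewrite /defect (unitary_sqnrm hV psiK); lra.
set N := sqnrm H _.
have : 2 * pi * N <= 2 * pi * (2 * B).
  have : 2 * pi * N = defect (fun t => V (psi w k) t - phi t)
      (fun s => Vmul zeta s * psi_mellin w k s - Phi s) +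
      sqnrm L (fun x => Vmul zeta (critical x) * psi_mellin w k (critical x) - Phi (critical x)).
    by rewrite /defect subrK.
  have := mulr_ge0 B0 (ltW p0); lra.
by rewrite ler_pM2l // mulr_gt0.
Qed.

(** * Truncation to [lambda, oo[ *)

Section Truncation.
Variables (lambda : R) (l0 : 0 < lambda) (l1 : lambda < 1).
Local Notation Lam := (ln lambda^-1).

Lemma cmeasurable_Qproj f : cmeasurable H f -> cmeasurable H (Qproj lambda f).
Proof.
move=> mf; pose U : set RM := `[lambda, +oo[%classic.
have mU : cmeasurable H (fun t => toC (\1_U t : R)).
  by apply: cmeasurable_toC; apply: measurable_indic; exact: measurable_itv.
have [m1 m2] := cmeasurableM mU mf.
have e t : toC (\1_U t : R) * f t = Qproj lambda f t.
  rewrite indicE /Qproj.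
  have -> : (t \in U) = (lambda <= t) by apply/idP/idP; rewrite inE /U /= in_itv /= andbT.
  by case: ifP; rewrite ?toC1 ?mul1r ?toC0 ?mul0r.
by split; [apply: eq_measurable_fun m1|apply: eq_measurable_fun m2] => t _; rewrite e.
Qed.

Lemma cmod_Qproj f t : cmod (Qproj lambda f t) ^+ 2 <= cmod (f t) ^+ 2.
Proof. by rewrite /Qproj; case: ifP => // _; rewrite cmod0 expr0n sqr_ge0. Qed.

Lemma inK_Qproj f : inK f -> inK (Qproj lambda f).
Proof.
move=> /sqintP[mf fi]; apply: (le_sqint mH (cmeasurable_Qproj mf) fi) => t _.
exact: cmod_Qproj.
Qed.

Lemma sqnrm_Qproj f : inK f -> sqnrm H (Qproj lambda f) <= sqnrm H f.
Proof.
move=> /sqintP[mf fi]; apply: (le_sqnrm mH (cmeasurable_Qproj mf) fi) => t _.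
exact: cmod_Qproj.
Qed.

Lemma Lam_ge (t : R) : lambda <= t <= 1 -> 0 <= ln t^-1 <= Lam.
Proof.
move=> /andP[h1 h2]; have t0 : 0 < t by exact: lt_le_trans h1.
rewrite ln_ge0 ?invf_ge1 //= ler_ln ?posrE ?invr_gt0 //.
by rewrite lef_pV2.
Qed.

(** Squaring bounds |v|^2 by B^2 log(1/t)^(2j) / t. The logarithm is at most Lam on [lambda, 1], and
    the integral of 1 / t supplies the last power of Lam. *)
Lemma log_bound_sqnrm j (B : R) (v : R -> C) : 0 <= B -> cmeasurable H v ->
  (forall t, lambda <= t <= 1 -> cmod (v t) <= B * (ln t^-1 ^+ j * expR (2^-1 * ln t^-1))) ->
  (forall t, 0 < t -> ~~ (lambda <= t <= 1) -> v t = 0) ->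
  inK v /\ sqnrm H v <= B ^+ 2 * Lam ^+ (2 * j).+1.
Proof.
move=> B0 mv hv v0; pose D : set RM := `[lambda, 1]%classic.
have mD : measurable D by exact: measurable_itv.
have DH : D `<=` H.
  by move=> t; rewrite /D /= in_itv /= => /andP[h _]; apply/halflineP; exact: lt_le_trans h.
have off t : H t -> ~ D t -> cmod (v t) ^+ 2 = 0.
  by move=> /halflineP t0 /negP Dt; rewrite v0 ?cmod0 ?expr0n // -in_itv.
have inv_pos t : lambda <= t <= 1 -> 0 < t by move=> /andP[h _]; exact: lt_le_trans h.
have gi : rintegrable D (fun t => B ^+ 2 * Lam ^+ (2 * j) * t^-1).
  apply: rintegrableZ => //; apply: itv_rintegrable => t /inv_pos t0.
  by apply: cvgV; [rewrite gt_eqF|exact: cvg_id].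
have gE : Rintegral mu D (fun t => B ^+ 2 * Lam ^+ (2 * j) * t^-1) = B ^+ 2 * Lam ^+ (2 * j).+1.
  rewrite RintegralZl //; last first.
    apply: itv_rintegrable => t /inv_pos t0.
    by apply: cvgV; [rewrite gt_eqF|exact: cvg_id].
  rewrite (exprSr Lam) mulrA; congr (_ * _).
  transitivity (ln (1 : R) - ln lambda); last by rewrite ln1 sub0r lnV ?posrE.
  apply: rFTC; first exact: ltW.
    by move=> t /inv_pos t0; exact: is_derive1_ln.
  by move=> t /inv_pos t0; apply: cvgV; [rewrite gt_eqF|exact: cvg_id].
have vB t : D t -> cmod (v t) ^+ 2 <= B ^+ 2 * Lam ^+ (2 * j) * t^-1.
  rewrite /D /= in_itv /= => Dt; have t0 := inv_pos _ Dt.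
  have /andP[a1 a2] := Lam_ge Dt.
  apply: (le_trans (ler_sqr_ge0 (cmod_ge0 _) (hv t Dt))).
  rewrite exprMn -mulrA ler_wpM2l ?sqr_ge0 // exprMn.
  have -> : expR (2^-1 * ln t^-1) ^+ 2 = t^-1.
    rewrite expr2 -expRD (_ : _ + _ = ln t^-1); last by field.
    by rewrite lnK // posrE invr_gt0.
  rewrite ler_wpM2r ?invr_ge0 ?(ltW t0) // -exprM mulnC.
  by rewrite lerXn2r ?nnegrE // (le_trans a1).
have mvD : cmeasurable D v by case: mv => m1 m2; split; [exact: measurable_funS m1|exact: measurable_funS m2].
have /sqintP[_ vi] := le_sqint mD mvD gi vB.
split.
  by apply/sqintP; split=> //; apply: (rintegrable_support mH mD DH off vi).
by rewrite /sqnrm (Rintegral_support DH off) -gE; exact: (le_sqnrm mD mvD gi vB).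
Qed.

End Truncation.

End UnitaryPart.

(** * The vectors V Y *)

Section YApproximation.
Variable R : realType.
Local Notation C := (Cplx R).
Local Notation RM := (measurableTypeR R).
Local Notation H := (halfline R : set RM).
Implicit Types (k : nat) (rho w : C) (f g : R -> C).

Let mH : measurable H := @measurable_halfline R.

Lemma cmod_log_cpow_le k w (t : R) : cRe w <= 2^-1 -> 0 < t <= 1 ->
  cmod (log_cpow k (- w) t) <= ln t^-1 ^+ k * expR (2^-1 * ln t^-1).
Proof.
move=> w2 t01; have l0 : 0 <= ln t^-1.
  by case/andP: t01 => t0 t1; rewrite ln_ge0 // invf_ge1.
rewrite cmod_log_cpow // cReN mulNr opprK ler_wpM2l ?exprn_ge0 // ler_expR.
exact: ler_wpM2r.
Qed.

Lemma Q_psi (lambda : R) w j : 0 < lambda < 1 -> cRe w <= 2^-1 ->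
  inK (Qproj lambda (psi w j)) /\
  sqnrm H (Qproj lambda (psi w j)) <= ln lambda^-1 ^+ (2 * j).+1.
Proof.
move=> /andP[l0 l1] w2; have m := cmeasurable_Qproj lambda (cmeasurable_psi w j).
have [||h1 h2] := log_bound_sqnrm l0 l1 (j := j) ler01 m.
- move=> t /andP[t1 t2]; rewrite /Qproj t1 mul1r.
  have t0 : 0 < t by exact: lt_le_trans t1.
  by rewrite psiE ?t0 // cmod_log_cpow_le ?t0.
- move=> t t0; rewrite /Qproj negb_and -!ltNge => /orP[t1|t1].
    by rewrite leNgt t1.
  by rewrite psi0 //; case: ifP.
by split=> //; rewrite expr1n mul1r in h2.
Qed.

(** The factor 2^n comes from iterating the two-term bound; the number of terms depends on k only,
    so it enters constants and no rate. *)
Lemma sqnrm_sum_le n (f : nat -> R -> C) : (forall i, (i < n)%N -> inK (f i)) ->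
  inK (fun t => \sum_(i < n) f i t) /\
  sqnrm H (fun t => \sum_(i < n) f i t) <= 2 ^+ n * \sum_(i < n) sqnrm H (f i).
Proof.
elim: n => [|n ih] fi.
  have z : (fun t => \sum_(i < 0) f i t) = (fun=> 0) by apply/funext => t; rewrite big_ord0.
  rewrite z big_ord0 mulr0; split.
    apply: (le_sqint mH (cmeasurable_cst H 0) (integrable0 _ _)) => t _.
    by rewrite cmod0 expr0n.
  rewrite /sqnrm; under eq_Rintegral do rewrite cmod0 expr0n.
  by rewrite Rintegral_cst // mul0r.
have [i1 i2] := ih (fun i ni => fi i (ltnW ni)).
have -> : (fun t => \sum_(i < n.+1) f i t) = (fun t => \sum_(i < n) f i t + f n t).
  by apply/funext => t; rewrite big_ord_recr.
have fn := fi n (ltnSn n); split; first exact: sqintD.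
apply: (le_trans (sqnrmD_le mH i1 fn)); rewrite big_ord_recr /= exprS.
have p1 : 1 <= 2 ^+ n :> R by rewrite exprn_ege1 // ler1n.
have := ler_wpM2r (sqnrm_ge0 H (f n)) p1; rewrite mul1r.
by move: (2 ^+ n) (sqnrm H (f n)) i2 => p F i2 h; rewrite -mulrA ler_wpM2l // mulrDr lerD.
Qed.

Lemma taylor_weight_bounded (P : {poly C}) k n : exists2 M : R, 0 <= M &
  forall i e, (i < n)%N -> 0 < e < 1 -> cmod (taylor_weight P e k i) <= M.
Proof.
elim: n => [|n [M M0 ih]]; first by exists 0.
have [M' M'0 hM'] := poly_bounded1 (P^`N(n)).
exists (M + M' * k`!%:R); first by rewrite addr_ge0 // mulr_ge0.
move=> i e; rewrite ltnS leq_eqVlt => /predU1P[->|ni] e01; last first.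
  by apply: (le_trans (ih i e ni e01)); rewrite lerDl mulr_ge0.
apply: (@le_trans _ _ (M' * k`!%:R)); last by rewrite lerDr.
rewrite /taylor_weight cmodM; apply: ler_pM; rewrite ?cmod_ge0 //.
  rewrite -toCN; apply: hM'; rewrite normrN gtr0_norm; by case/andP: e01.
rewrite cmodM cmodV !cmod_nat ler_pdivrMr ?ltr0n ?fact_gt0 //.
by rewrite ler_peMr // ler1n fact_gt0.
Qed.

Variables (zeta : C -> C) (hz : is_riemann_zeta zeta).
Variables (V Vinv : (R -> C) -> (R -> C)) (hV : unitary_on_K V Vinv).
Hypothesis hVmul : mellin_multiplier (Vmul zeta) V.

(** Q does not increase norms, so the bounded remainder stays bounded. The lower terms have squared
    norm at most a constant times L^(2(k-1)+1), which is below L^(2k) since L >= 1. The leading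
    coefficient is still P(- e) and not yet c. *)
Lemma QV_psi_approx rho m : critical_zero zeta rho m ->
  exists2 c : C, cmod c = 1 & forall k,
  exists (P : {poly C}) (B : R), [/\ P.[0] = c, 0 <= B &
    forall lambda e : R, 0 < lambda < 1 -> 1 <= ln lambda^-1 -> 0 < e < 1 ->
    sqnrm H (fun t => Qproj lambda (V (psi (rho - toC e) k)) t -
      P.[- toC e] * Qproj lambda (psi (rho - toC e) k) t) <= B * ln lambda^-1 ^+ (2 * k)].
Proof.
move=> zr; have [re_rho _] := zr.
have [c c1 approx] := V_psi_approx hz hV hVmul zr; exists c => // k.
have [P [B [sP P0 B0 hB]]] := approx k.
have [M M0 hM] := taylor_weight_bounded P k k.+1.
exists P, (2 * (B + 2 ^+ k * (k%:R * M ^+ 2))); split => //.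
  by rewrite !(mulr_ge0, addr_ge0) ?exprn_ge0 ?sqr_ge0.
move=> lambda e l01 L1 e01; set w := rho - toC e; set Lam := ln _ in L1 *.
have e0 : 0 < e by case/andP: e01.
have w2 : cRe w < 2^-1 by rewrite /w cReB cRe_toC re_rho; lra.
have psiK j : inK (psi w j) by have [] := psi_square_integrable j w2.
pose r t := V (psi w k) t - \sum_(i < k.+1) taylor_weight P e k i * psi w (k - i) t.
have rK : inK r.
  apply: sqintB => //; first exact: (unitary_in hV).
  by apply: (@sqint_sum _ _ mH _ _ (fun (i : 'I_k.+1) t => taylor_weight P e k i * psi w (k - i) t))
    => i; exact: (sqintZ mH _ (psiK _)).
pose f (i : nat) t := taylor_weight P e k i.+1 * Qproj lambda (psi w (k - i.+1)) t.
have Qi j := (Q_psi j l01 (ltW w2)).1.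
have fK i : (i < k)%N -> inK (f i) by move=> _; exact: (sqintZ mH _ (Qi _)).
have [sK sB] := sqnrm_sum_le fK.
have -> : sqnrm H (fun t => Qproj lambda (V (psi w k)) t - P.[- toC e] * Qproj lambda (psi w k) t) =
    sqnrm H (fun t => Qproj lambda r t + \sum_(i < k) f i t).
  apply: eq_sqnrm => t _; rewrite /f /Qproj /r; case: ifP => _; last first.
    by rewrite mulr0 subr0 add0r big1 // => i _; rewrite mulr0.
  (* The term i = 0 has weight P(- e) and cancels the subtracted main term; the terms i >= 1 are
     collected in f. *)
  rewrite big_ord_recl /= subn0 /taylor_weight nderivn0 subn0 divff ?mulr1; last first.
    by rewrite pnatr_eq0 -lt0n fact_gt0.
  by set S := \sum_(i < k) _; ring.
apply: (le_trans (sqnrmD_le mH (inK_Qproj lambda rK) sK)).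
rewrite -[leRHS]mulrA ler_wpM2l // mulrDl lerD //.
  apply: (le_trans (sqnrm_Qproj lambda rK)); apply: (le_trans (hB e e0)).
  by rewrite ler_peMr // exprn_ege1.
apply: (le_trans sB); rewrite -mulrA ler_wpM2l ?exprn_ge0 //.
have term (i : 'I_k) : sqnrm H (f i) <= M ^+ 2 * Lam ^+ (2 * k).
  rewrite /f (sqnrmZ mH _ (Qi _)); apply: ler_pM; rewrite ?sqr_ge0 ?sqnrm_ge0 //.
    by apply: ler_sqr_ge0; rewrite ?cmod_ge0 // hM // ltnS.
  apply: (le_trans (Q_psi (k - i.+1) l01 (ltW w2)).2); rewrite ler_weXn2l //.
  have ik : (k - i.+1 < k)%N by rewrite ltn_subrL /= (leq_trans _ (ltn_ord i)).
  by apply: (@leq_trans (2 * (k - i.+1).+1)); [rewrite mulnS|rewrite leq_mul2l].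
apply: (le_trans (ler_sum _ (fun i _ => term i))).
by rewrite sumr_const card_ord -[leLHS]mulr_natl mulrA.
Qed.

(* The error in [QV_psi_approx] does not depend on e, so a single e, chosen small enough
   in terms of lambda, is enough: no limit has to be taken. *)
Lemma VY_approx rho m : critical_zero zeta rho m ->
  exists2 c : C, cmod c = 1 & forall k, exists2 B : R, 0 <= B &
    forall (lambda : R) (Y : R -> C), 0 < lambda < 1 -> 1 <= ln lambda^-1 ->
    is_Y V Vinv lambda rho k Y ->
    sqnrm H (fun t => V Y t - c * Qproj lambda (psi rho k) t) <= B * ln lambda^-1 ^+ (2 * k).
Proof.
move=> zr; have [re_rho _] := zr.
have [c c1 approx] := QV_psi_approx zr; exists c => // k.
have [P [B [P0c B0 hB]]] := approx k.
have P0 : cmod P.[0] = 1 by rewrite P0c.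
have [|M M0 hM] := @poly_vanishing _ (P - P.[0]%:P); first by rewrite !hornerE subrr.
(* The error is split as (V Y - q) + ((q - P(- e) Q psi_w) + d), with squared norms at most 1, B
   L^(2k) and 1. Two uses of the parallelogram bound give 2 + 4 B L^(2k) + 4. *)
rewrite -P0c; exists (6 + 4 * B); first by rewrite addr_ge0 // mulr_ge0.
move=> lambda Y l01 L1 [YK Ycvg]; set Lam := ln _ in L1 *.
have /andP[l0 l1] := l01.
have L0 : 0 < Lam by exact: lt_le_trans L1.
have [r r0 hr] : exists2 r : R, 0 < r & forall w, cmod (w - rho) < r -> cRe w < 2^-1 ->
    sqnrm H (fun t => Vinv (Qproj lambda (V (psi w k))) t - Y t) < 1.
  have /fine_cvgP[_ /cvgrPdist_lt/(_ 1 ltr01)] := Ycvg.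
  move=> /nbhs_cmodP[r r0 hr]; exists r => // w wr w2.
  have := hr w wr w2; rewrite sub0r normrN; apply: le_lt_trans.
  exact: ler_norm.
(* Replacing w by rho and P(- e) by P(0) multiplies psi_rho by a factor of size at most (M + Lam) e
   on [lambda, 1]: M e from P, and Lam e from 1 - t^e <= e log(1/t). With D e <= 1 the squared norm
   of this change is at most 1. *)
pose D := (M + Lam) * Lam ^+ k.+1.
have ML : 0 < M + Lam by rewrite ltr_wpDl.
have D0 : 0 < D by rewrite mulr_gt0 // exprn_gt0.
pose e := Num.min (Num.min (2^-1) (r / 2)) D^-1.
have e0 : 0 < e by rewrite !lt_min invr_gt0 ltr0n /= divr_gt0 // invr_gt0.
have e1 : e < 1.
  have : e <= 2^-1 by rewrite !ge_min lexx.
  by lra.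
have er : e < r.
  have : e <= r / 2 by rewrite !ge_min lexx orbT.
  by lra.
have eD : D * e <= 1 by rewrite mulrC -ler_pdivlMr // mul1r ge_min lexx orbT.
have e01 : 0 < e < 1 by rewrite e0.
have {}hB := hB lambda e l01 L1 e01; rewrite -/Lam in hB.
set w := rho - toC e in hB.
have w2 : cRe w < 2^-1 by rewrite /w cReB cRe_toC re_rho; lra.
have psiK : inK (psi w k) by have [] := psi_square_integrable k w2.
have VpK := unitary_in hV psiK.
set q := Qproj lambda (V (psi w k)) in hB.
have qK : inK q by exact: inK_Qproj.
have VqK := unitary_inv_in hV qK.
have hYq : sqnrm H (fun t => V Y t - q t) < 1.
  have wr : cmod (w - rho) < r.
    by rewrite /w addrAC subrr add0r cmodN cmod_toC gtr0_norm.
  apply: le_lt_trans (hr w wr w2); rewrite -/q.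
  rewrite -(unitary_sqnrmB hV VqK YK) -[leRHS]sqnrmN le_eqVlt; apply/orP; left; apply/eqP.
  apply: sqnrm_Keq.
  - by apply: sqintB => //; exact: (unitary_in hV).
  - apply: eq_sqint (sqintB mH (unitary_in hV YK) (unitary_in hV VqK)) => t _.
    by ring.
  - apply: Keq_imp (unitary_invr hV qK) => t _ ->.
    by ring.
pose d t := P.[- toC e] * Qproj lambda (psi w k) t - P.[0] * Qproj lambda (psi rho k) t.
have Qw := (Q_psi k l01 (ltW w2)).1.
have re2 : cRe rho <= 2^-1 by rewrite re_rho.
have Qr := (Q_psi k l01 re2).1.
have md : cmeasurable H d.
  have [//] : square_integrable H d by apply: sqintB => //; exact: sqintZ.
have Pe : cmod (P.[- toC e] - P.[0]) <= M * e.
  have := hM (- e); rewrite normrN (gtr0_norm e0) toCN !hornerE => /(_ e1).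
  by [].
have [|||dK dB] := log_bound_sqnrm l0 l1 (j := k) (B := (M + Lam) * e) _ md.
- by rewrite mulr_ge0 // ltW.
- move=> t lt1; have /andP[t1 t2] := lt1; have t0 : 0 < t by exact: lt_le_trans t1.
  have t01 : 0 < t <= 1 by rewrite t0.
  have /andP[a0 a1] := Lam_ge l0 lt1; rewrite -/Lam in a1.
  have -> : d t = log_cpow k (- rho) t * (P.[- toC e] * cpow t (toC e) - P.[0]).
    rewrite /d /Qproj t1 !psiE // /log_cpow.
    have -> : - w = - rho + toC e by rewrite /w; ring.
    by rewrite cpowD; ring.
  rewrite cmodM mulrC; apply: ler_pM; rewrite ?cmod_ge0 ?cmod_log_cpow_le //.
  have -> : P.[- toC e] * cpow t (toC e) - P.[0] =
      (P.[- toC e] - P.[0]) * cpow t (toC e) + P.[0] * (cpow t (toC e) - 1) by ring.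
  have ce : cpow t (toC e) = toC (expR (- (e * ln t^-1))).
    apply: complex_ext.
      by rewrite cRe_cpow cIm_toC mul0r cos0 mulr1 cRe_toC lnV ?posrE // mulrN opprK.
    by rewrite cIm_cpow cIm_toC mul0r sin0 mulr0.
  have el : 0 <= e * ln t^-1 by rewrite mulr_ge0 // ltW.
  have E1 : expR (- (e * ln t^-1)) <= 1 by rewrite -expR0 ler_expR oppr_le0.
  have E2 := expR_ge1Dx (- (e * ln t^-1)).
  apply: (le_trans (ler_cmodD _ _)); rewrite [leRHS]mulrDl; apply: lerD.
    rewrite cmodM -[leRHS]mulr1; apply: ler_pM; rewrite ?cmod_ge0 //.
    by rewrite ce cmod_toC ger0_norm ?expR_ge0.
  rewrite cmodM P0 mul1r ce -toC1 -toCB cmod_toC distrC ger0_norm ?subr_ge0 //.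
  apply: (@le_trans _ _ (e * ln t^-1)); first by lra.
  by rewrite mulrC ler_wpM2r // ltW.
- move=> t t0; rewrite /d /Qproj negb_and -!ltNge => /orP[t1|t1].
    by rewrite leNgt t1 /= !mulr0 subrr.
  by rewrite !psi0 //; case: ifP; rewrite !mulr0 subrr.
have d1 : sqnrm H d <= 1.
  apply: (le_trans dB); rewrite -/Lam.
  apply: (@le_trans _ _ ((D * e) ^+ 2)); last first.
    by apply: exprn_ile1 => //; rewrite mulr_ge0 // ltW.
  have -> : (D * e) ^+ 2 = ((M + Lam) * e) ^+ 2 * Lam ^+ (2 * k.+1).
    by rewrite /D mulnC exprM; ring.
  by rewrite ler_wpM2l ?sqr_ge0 // ler_weXn2l // mulnS.
have qdK : inK (fun t => q t - P.[- toC e] * Qproj lambda (psi w k) t).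
  by apply: sqintB => //; exact: sqintZ.
have VYK := unitary_in hV YK.
have s1 : inK (fun t => V Y t - q t) by exact: sqintB.
have s2 : inK (fun t => (q t - P.[- toC e] * Qproj lambda (psi w k) t) + d t) by exact: sqintD.
have -> : sqnrm H (fun t => V Y t - P.[0] * Qproj lambda (psi rho k) t) =
  sqnrm H (fun t => (V Y t - q t) + ((q t - P.[- toC e] * Qproj lambda (psi w k) t) + d t)).
  by apply: eq_sqnrm => t _; rewrite /d; ring.
have h1 := sqnrmD_le mH s1 s2; have h2 := sqnrmD_le mH qdK dK.
have LL : 1 <= Lam ^+ (2 * k) by rewrite exprn_ege1.
rewrite mulrDl -mulrA; lra.
Qed.

End YApproximation.

(** * Asymptotics of the scalar products *)

Section Asymptotics.
Variable R : realType.
Local Notation C := (Cplx R).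
Local Notation RM := (measurableTypeR R).
Local Notation mu := (@lebesgue_measure R).
Local Notation H := (halfline R : set RM).
Implicit Types (k l : nat) (rho w z : C) (f g : R -> C).

Let mH : measurable H := @measurable_halfline R.

Lemma le_of_eq (x y : R) : x = y -> x <= y.
Proof. by move=> ->. Qed.

Lemma KdotE f g : Kdot f g = dot H f g. Proof. by []. Qed.

(** The difference is (df, dg) + (df, g0) + (f0, dg). The first product gets weight 1, and the mixed
    ones weight s on the errors and 1 / s on the main vectors. *)
Lemma dot_approx f f0 g g0 (s : R) : 0 < s -> inK f -> inK f0 -> inK g -> inK g0 ->
  cmod (Kdot f g - Kdot f0 g0) <=
  (1 + s) * (sqnrm H (fun t => f t - f0 t) + sqnrm H (fun t => g t - g0 t)) +
  s^-1 * (sqnrm H f0 + sqnrm H g0).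
Proof.
move=> s0 fK f0K gK g0K.
have dfK : inK (fun t => f t - f0 t) by exact: sqintB.
have dgK : inK (fun t => g t - g0 t) by exact: sqintB.
pose df t := f t - f0 t; pose dg t := g t - g0 t.
have e : Kdot f g - Kdot f0 g0 = Kdot df dg + Kdot df g0 + cconj (Kdot dg f0).
  have i1 := sqint_cmulJ mH dfK dgK; have i2 := sqint_cmulJ mH dfK g0K.
  have i3 := sqint_cmulJ mH f0K dgK; have i4 := sqint_cmulJ mH f0K g0K.
  rewrite !KdotE -(dot_conj mH dgK f0K); apply/eqP; rewrite subr_eq; apply/eqP.
  rewrite /dot -(cintegralD mH i1 i2) -(cintegralD mH (cintegrableD mH i1 i2) i3).
  rewrite -(cintegralD mH (cintegrableD mH (cintegrableD mH i1 i2) i3) i4).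
  by apply: eq_cintegral => t _; rewrite /df /dg !conjcB; ring.
rewrite e; apply: (le_trans (ler_cmodD _ _)); rewrite cmod_conj.
have h1 := cmod_dot_le mH ltr01 dfK dgK.
have h2 := cmod_dot_le mH s0 dfK g0K.
have h3 := cmod_dot_le mH s0 dgK f0K.
rewrite invr1 !mul1r in h1.
have h4 := ler_cmodD (Kdot df dg) (Kdot df g0).
apply: (le_trans (lerD h4 (le_refl _))).
apply: (le_trans (lerD (lerD h1 h2) h3)).
by rewrite -/df -/dg; lra.
Qed.

Definition scale_exponent (lambda : R) k : R := ln lambda^-1 `^ (- 2^-1 - k%:R).

Lemma scale_exponentM (lambda : R) k l : 1 <= ln lambda^-1 ->
  scale_exponent lambda k * scale_exponent lambda l = (ln lambda^-1 ^+ (k + l).+1)^-1.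
Proof.
move=> L1; rewrite /scale_exponent; set L := ln _ in L1 *.
have L0 : 0 < L by exact: lt_le_trans L1.
have Ln0 : L != 0 by rewrite gt_eqF.
rewrite -powRD; last by rewrite Ln0 implybT.
rewrite -powR_mulrn ?(ltW L0) // -powRN; congr (_ `^ _).
by have -> : (k + l).+1%:R = k%:R + l%:R + 1 :> R; [rewrite -addn1 !natrD|lra].
Qed.

Lemma KdotZ (a b : R) f g : inK f -> inK g ->
  Kdot (fun t => toC a * f t) (fun t => toC b * g t) = toC (a * b) * Kdot f g.
Proof.
move=> fK gK; rewrite /Kdot -(cintegralZ mH _ (sqint_cmulJ mH fK gK)).
by apply: eq_cintegral => t _; rewrite conjcM cconj_toC toCM; ring.
Qed.

Lemma Kdot_Q_psi (lambda : R) rho1 rho2 k l : 0 < lambda < 1 ->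
  cRe rho1 = 2^-1 -> cRe rho2 = 2^-1 ->
  Kdot (Qproj lambda (psi rho1 k)) (Qproj lambda (psi rho2 l)) =
  cintegral `[lambda, 1] (log_cpow (k + l) ((Complex 0 (cIm rho2 - cIm rho1) : C) - 1)).
Proof.
move=> /andP[l0 l1] r1 r2; rewrite /Kdot.
rewrite (@cintegral_support _ H (`[lambda, 1]%classic : set RM)).
- apply: eq_cintegral => t; rewrite /= in_itv /= => /andP[t1 t2].
  have t01 : 0 < t <= 1 by rewrite t2 andbT; exact: lt_le_trans t1.
  rewrite /Qproj t1 !psiE // /log_cpow conjcM cconj_toC cpow_conj exprD toCM.
  have -> : (Complex 0 (cIm rho2 - cIm rho1) : C) - 1 = - rho1 + cconj (- rho2).
    apply: complex_ext; rewrite !(cReE, cImE) ?r1 ?r2 /cRe /cIm /=; first by field.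
    by ring.
  by rewrite cpowD; ring.
- by move=> t /=; rewrite in_itv /= => /andP[h _]; apply/halflineP; exact: lt_le_trans h.
- move=> t /halflineP t0 /negP; rewrite /= in_itv /= negb_and -!ltNge /Qproj => /orP[t1|t1].
    by rewrite [lambda <= t]leNgt t1 mul0r.
  by rewrite psi0 //; case: ifP; rewrite mul0r.
Qed.

Lemma cintegral_log_diagonal (lambda : R) n : 0 < lambda < 1 ->
  cintegral `[lambda, 1] (log_cpow n (0 - 1)) = toC (ln lambda^-1 ^+ n.+1 / n.+1%:R).
Proof.
move=> /andP[l0 l1].
have pos t : lambda <= t <= 1 -> 0 < t by move=> /andP[h _]; exact: lt_le_trans h.
rewrite (@cFTC _ (fun t => - n.+1%:R^-1 * log_cpow n.+1 0 t) _ _ _ (ltW l1)).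
- rewrite /log_cpow !cpow0 !mulr1 invr1 ln1 expr0n toC0 mulr0 sub0r mulNr opprK.
  by rewrite toCM toCV toC_nat mulrC.
- move=> t /pos t0.
  apply: eq_is_cderive (is_cderiveZ (- n.+1%:R^-1) (is_cderive_log_cpow n.+1 0 t0)).
  by rewrite mul0r sub0r mulrNN /= mulKf // pnatr_eq0.
- by move=> t /pos t0; exact: ccontinuous_log_cpow.
Qed.

(** For z != 0 the primitive divides by z and does not raise the power of the logarithm: one power
    of L is gained over the diagonal case. The factor 2^n comes from 1 + L <= 2 L. *)
Lemma cmod_cintegral_log_oscillating z n : z != 0 -> cRe z = 0 ->
  exists2 B : R, 0 <= B & forall lambda : R, 0 < lambda < 1 -> 1 <= ln lambda^-1 ->
  cmod (cintegral `[lambda, 1] (log_cpow n (z - 1))) <= B * ln lambda^-1 ^+ n.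
Proof.
move=> z0 rz; have cz : 0 < cmod z by rewrite cmod_gt0.
have [M M0 hM] := cmod_log_cpow_primitive n cz.
pose K := M / cmod z; have K0 : 0 <= K by rewrite divr_ge0 // ltW.
exists (K + K * 2 ^+ n); first by rewrite addr_ge0 // mulr_ge0 // exprn_ge0.
move=> lambda /andP[l0 l1] L1.
have l01 : 0 < lambda <= 1 by rewrite l0 ltW.
rewrite cintegral_log_cpow //; apply: (le_trans (ler_cmodB _ _)).
have h1 := hM z 1 (le_refl _) (_ : 0 < 1 <= 1).
have h2 := hM z lambda (le_refl _) l01.
rewrite rz mul0r oppr0 expR0 mulr1 in h2.
have {}h1 : cmod (log_cpow_primitive n z 1) <= K.
  have := h1; rewrite rz mul0r oppr0 expR0 mulr1 invr1 ln1 addr0 expr1n mulr1.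
  by apply; rewrite ltr01 lexx.
have LX : 1 <= ln lambda^-1 ^+ n by rewrite exprn_ege1.
rewrite mulrDl; apply: lerD; first by apply: (le_trans h1); rewrite ler_peMr.
apply: (le_trans h2); rewrite /K mulrAC -!mulrA ler_wpM2l // ler_wpM2l ?invr_ge0 ?cmod_ge0 //.
rewrite -exprMn lerXn2r ?nnegrE ?addr_ge0 ?mulr_ge0 //; try lra.
Qed.

Lemma cvg_of_log_rate (F : R -> C) (c : C) (A : R) : 0 <= A ->
  (forall s lambda : R, 0 < s -> 0 < lambda < 1 -> 1 <= ln lambda^-1 ->
    cmod (F lambda - c) <= (1 + s) * A / ln lambda^-1 + 2 / s) ->
  F lambda @[lambda --> (0 : R)^'+] --> c.
Proof.
move=> A0 h; apply/cvg_cmodP => e e0.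
(* This makes 2 / s = e / 2. With s fixed, T is such that the other term falls below e / 2 once L >
   T. *)
pose s := 4 / e; have s0 : 0 < s by rewrite divr_gt0.
pose T := Num.max 1 (2 * ((1 + s) * A + 1) / e).
have T1 : 1 <= T by rewrite le_max lexx.
have near1 : \forall x \near (0 : R)^'+, 0 < x by exact: nbhs_right_gt.
have near2 : \forall x \near (0 : R)^'+, x < expR (- T).
  by apply: nbhs_right_lt; exact: expR_gt0.
apply: filterS2 near1 near2 => x x0 xT.
have lx : T < ln x^-1.
  rewrite lnV ?posrE // ltrNr -[ltRHS]expRK ltr_ln ?posrE ?expR_gt0 //.
have x1 : x < 1.
  by apply: (lt_le_trans xT); rewrite -expR0 ler_expR; lra.
have L0 : 0 < ln x^-1 by lra.
have := h s x s0; rewrite x0 x1 => /(_ isT) hh.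
apply: (le_lt_trans (hh _)); first by lra.
have -> : 2 / s = e / 2 by rewrite /s; field; rewrite gt_eqF.
have : 2 * ((1 + s) * A + 1) / e < ln x^-1 by apply: le_lt_trans lx; rewrite le_max lexx orbT.
rewrite ltr_pdivrMr // => h2.
suff : (1 + s) * A / ln x^-1 < e / 2 by lra.
by rewrite ltr_pdivrMr //; lra.
Qed.

Variables (zeta : C -> C) (hz : is_riemann_zeta zeta).
Variables (V Vinv : (R -> C) -> (R -> C)) (hV : unitary_on_K V Vinv).
Hypothesis hVmul : mellin_multiplier (Vmul zeta) V.
Variable Y : R -> C -> nat -> (R -> C).
Hypothesis hY : forall (lambda : R) (s : C) (k : nat),
  0 < lambda < 1 -> cRe s = 2^-1 -> is_Y V Vinv lambda s k (Y lambda s k).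

(** The square of the scaling factor is L^(-2k-1): the error B L^(2k) becomes B / L, and the main
    term is normalised to squared norm at most 1. *)
Lemma scaled_VY_approx rho k c (B lambda : R) : cRe rho = 2^-1 -> cmod c = 1 -> 0 <= B ->
  0 < lambda < 1 -> 1 <= ln lambda^-1 ->
  sqnrm H (fun t => V (Y lambda rho k) t - c * Qproj lambda (psi rho k) t) <=
    B * ln lambda^-1 ^+ (2 * k) ->
  [/\ inK (fun t => toC (scale_exponent lambda k) * V (Y lambda rho k) t),
      inK (fun t => toC (scale_exponent lambda k) * (c * Qproj lambda (psi rho k) t)),
      sqnrm H (fun t => toC (scale_exponent lambda k) * V (Y lambda rho k) t -
        toC (scale_exponent lambda k) * (c * Qproj lambda (psi rho k) t)) <= B / ln lambda^-1 &
      sqnrm H (fun t => toC (scale_exponent lambda k) * (c * Qproj lambda (psi rho k) t)) <= 1].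
Proof.
move=> rr c1 B0 l01 L1 hB.
have L0 : 0 < ln lambda^-1 by exact: lt_le_trans L1.
have a2 : cmod (toC (scale_exponent lambda k)) ^+ 2 = (ln lambda^-1 ^+ (2 * k).+1)^-1.
  rewrite cmod_toC real_normK ?num_real // expr2 scale_exponentM //.
  by rewrite addnn -mul2n.
have [QK Qn] := Q_psi k l01 (le_of_eq rr).
move: (toC (scale_exponent lambda k)) a2 => a a2.
move: (ln lambda^-1) L0 L1 hB a2 Qn => L L0 L1 hB a2 Qn.
have Ln0 : L != 0 by rewrite gt_eqF.
have VYK : inK (V (Y lambda rho k)) by apply: (unitary_in hV); have [] := hY k l01 rr.
have cQK : inK (fun t => c * Qproj lambda (psi rho k) t) by exact: sqintZ.
have LX : 0 < L ^+ (2 * k).+1 by rewrite exprn_gt0.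
split; [exact: sqintZ|exact: sqintZ| |].
  have -> : sqnrm H (fun t => a * V (Y lambda rho k) t - a * (c * Qproj lambda (psi rho k) t)) =
      sqnrm H (fun t => a * (V (Y lambda rho k) t - c * Qproj lambda (psi rho k) t)).
    by apply: eq_sqnrm => t _; ring.
  rewrite (sqnrmZ mH a (sqintB mH VYK cQK)).
  rewrite a2 mulrC ler_pdivrMr //; apply: (le_trans hB).
  by rewrite (exprS L) mulrA mulfVK.
rewrite (sqnrmZ mH a cQK) (sqnrmZ mH c QK) a2 c1 expr1n mul1r mulrC.
by rewrite ler_pdivrMr // mul1r.
Qed.

Definition VY_close rho c k (B : R) := forall (lambda : R) (Y' : R -> C),
  0 < lambda < 1 -> 1 <= ln lambda^-1 -> is_Y V Vinv lambda rho k Y' ->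
  sqnrm H (fun t => V Y' t - c * Qproj lambda (psi rho k) t) <= B * ln lambda^-1 ^+ (2 * k).

Lemma Kdot_Xvec_approx rho1 rho2 k l c1 c2 (B1 B2 : R) :
  cRe rho1 = 2^-1 -> cRe rho2 = 2^-1 -> cmod c1 = 1 -> cmod c2 = 1 -> 0 <= B1 -> 0 <= B2 ->
  VY_close rho1 c1 k B1 -> VY_close rho2 c2 l B2 ->
  forall s lambda : R, 0 < s -> 0 < lambda < 1 -> 1 <= ln lambda^-1 ->
    cmod (Kdot (Xvec Y lambda rho1 k) (Xvec Y lambda rho2 l) -
      c1 * cconj c2 * (toC (ln lambda^-1 ^+ (k + l).+1)^-1 *
      cintegral `[lambda, 1] (log_cpow (k + l) ((Complex 0 (cIm rho2 - cIm rho1) : C) - 1)))) <=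
    (1 + s) * (B1 + B2) / ln lambda^-1 + 2 / s.
Proof.
move=> r1 r2 n1 n2 B10 B20 close1 close2 s lambda s0 l01 L1.
have Y1 := hY k l01 r1; have Y2 := hY l l01 r2.
have [Y1K _] := Y1; have [Y2K _] := Y2.
have [x1K x01K d1 x01] := scaled_VY_approx r1 n1 B10 l01 L1 (close1 _ _ l01 L1 Y1).
have [x2K x02K d2 x02] := scaled_VY_approx r2 n2 B20 l01 L1 (close2 _ _ l01 L1 Y2).
have := dot_approx s0 x1K x01K x2K x02K.
have V1K := unitary_in hV Y1K; have V2K := unitary_in hV Y2K.
have [Q1 _] := Q_psi k l01 (le_of_eq r1); have [Q2 _] := Q_psi l l01 (le_of_eq r2).
have c1K : inK (fun t => c1 * Qproj lambda (psi rho1 k) t) by exact: sqintZ.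
have c2K : inK (fun t => c2 * Qproj lambda (psi rho2 l) t) by exact: sqintZ.
(* Unitarity replaces the scalar product of the vectors V Y by that of the Y, and the scaling
   factors restore the X. *)
rewrite (KdotZ _ _ V1K V2K) (unitary_dot hV Y1K Y2K) -(KdotZ _ _ Y1K Y2K).
rewrite (KdotZ _ _ c1K c2K) scale_exponentM //.
have -> : Kdot (fun t => c1 * Qproj lambda (psi rho1 k) t) (fun t => c2 * Qproj lambda (psi rho2 l) t) =
    c1 * cconj c2 * Kdot (Qproj lambda (psi rho1 k)) (Qproj lambda (psi rho2 l)).
  rewrite /Kdot -(cintegralZ mH _ (sqint_cmulJ mH Q1 Q2)).
  by apply: eq_cintegral => t _; rewrite conjcM; ring.
rewrite Kdot_Q_psi // mulrCA => /le_trans; apply.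
have s1 : 0 <= 1 + s by lra.
have si : 0 <= s^-1 by rewrite invr_ge0 ltW.
apply: lerD.
  by rewrite -[leRHS]mulrA ler_wpM2l // mulrDl lerD.
by rewrite [leRHS]mulrC ler_wpM2l //; lra.
Qed.

End Asymptotics.

Unset Implicit Arguments.

Theorem theorem5p3 (R : realType)
  (zeta : Cplx R -> Cplx R) (hzeta : is_riemann_zeta zeta)
  (V Vinv : (R -> Cplx R) -> (R -> Cplx R))
  (hV : unitary_on_K V Vinv)
  (hVmul : mellin_multiplier (Vmul zeta) V)
  (Y : R -> Cplx R -> nat -> (R -> Cplx R))
  (hY : forall (lambda : R) (s : Cplx R) (k : nat),
      0 < lambda < 1 -> cRe s = 2^-1 -> is_Y V Vinv lambda s k (Y lambda s k)) :
  (forall (rho1 rho2 : Cplx R) (m1 m2 k l : nat),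
      critical_zero zeta rho1 m1 -> critical_zero zeta rho2 m2 ->
      (k < m1)%N -> (l < m2)%N -> rho1 <> rho2 ->
      Kdot (Xvec Y lambda rho1 k) (Xvec Y lambda rho2 l)
        @[lambda --> (0 : R)^'+] --> (0 : Cplx R)) /\
  (forall (rho : Cplx R) (m k l : nat),
      critical_zero zeta rho m -> (k < m)%N -> (l < m)%N ->
      Kdot (Xvec Y lambda rho k) (Xvec Y lambda rho l)
        @[lambda --> (0 : R)^'+] --> ((k + l + 1)%:R^-1 : Cplx R)).
Proof.
split=> [rho1 rho2 m1 m2 k l z1 z2 _ _ r12|rho m k l zr _ _].
- have [re1 _] := z1; have [re2 _] := z2.
  have [c1 n1 /(_ k)[B1 B10 h1]] := VY_approx hzeta hV hVmul z1.
  have [c2 n2 /(_ l)[B2 B20 h2]] := VY_approx hzeta hV hVmul z2.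
  pose z : Cplx R := Complex 0 (cIm rho2 - cIm rho1).
  have z0 : z != 0.
    apply/eqP => /(congr1 (@cIm R)); rewrite cIm0 /cIm /= => /eqP.
    rewrite subr_eq0 => /eqP im; apply: r12; apply: complex_ext; first by rewrite re1 re2.
    exact/esym.
  have [B B0 hB] := cmod_cintegral_log_oscillating (k + l) z0 (erefl : cRe z = 0).
  (* The oscillating main term is itself at most B / L, hence at most (1 + s) B / L, and is counted
     among the errors. *)
  apply: (@cvg_of_log_rate _ _ _ (B1 + B2 + B)) => [|s lambda s0 l01 L1].
    by rewrite !addr_ge0.
  have := Kdot_Xvec_approx hV hY re1 re2 n1 n2 B10 B20 h1 h2 s0 l01 L1.
  have := hB lambda l01 L1; rewrite -/z.
  move: (cintegral _ _) (Kdot _ _) => J K hJ hK.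
  set L := ln _ in L1 hJ hK *; have L0 : 0 < L by exact: lt_le_trans L1.
  rewrite subr0; set q := c1 * _ * _ in hK.
  have hq : cmod q <= B / L.
    rewrite /q !cmodM cmod_conj n1 n2 !mul1r cmod_toC ger0_norm; last first.
      by rewrite invr_ge0 exprn_ge0 // ltW.
    rewrite mulrC ler_pdivrMr ?exprn_gt0 //; apply: (le_trans hJ).
    by rewrite exprS mulrA mulfVK // gt_eqF.
  have -> : K = (K - q) + q by rewrite subrK.
  apply: (le_trans (ler_cmodD _ _)).
  have BL : 0 <= s * (B / L) by rewrite mulr_ge0 ?divr_ge0 ?(ltW s0) ?(ltW L0).
  have -> : (1 + s) * (B1 + B2 + B) / L =
    (1 + s) * (B1 + B2) / L + (B / L + s * (B / L)) by ring.
  by lra.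
- have [re _] := zr.
  (* One constant c serves both k and l, so the factor in front of the main term is |c|^2 = 1. *)
  have [c n hc] := VY_approx hzeta hV hVmul zr.
  have [B1 B10 h1] := hc k; have [B2 B20 h2] := hc l.
  apply: (@cvg_of_log_rate _ _ _ (B1 + B2)) => [|s lambda s0 l01 L1].
    by rewrite addr_ge0.
  have := Kdot_Xvec_approx hV hY re re n n B10 B20 h1 h2 s0 l01 L1.
  rewrite subrr (cintegral_log_diagonal _ l01) mulr_cconj n expr1n toC1 mul1r -toCM.
  have L0 : 0 < ln lambda^-1 by exact: lt_le_trans L1.
  rewrite mulrA mulVf ?mul1r; last by rewrite expf_neq0 // gt_eqF.
  by rewrite toCV toC_nat addn1.
Qed.
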